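(* Let $E,F,G$ be Banach spaces, $\alpha$ a uniform crossnorm and $(\pi_n)$ a sequence of partitions of $\mathbb R_{\ge0}$. Let $X\in D(\mathbb R_{\ge0},E)$ be a path with strong (resp. weak) $\alpha$-tensor quadratic variation ${}^\alpha[X,X]$ and finite 2-variation along $(\pi_n)$, and let $A\colon\mathbb R_{\ge0}\to F$ be a càdlàg path of finite variation. Assume that $(\pi_n)$ satisfies Condition (C) for $(A,X)$ and approximates $(A,X)$ from the left. Let $f\colon F\times E\to G$ be once Gâteaux differentiable in $a\in F$ and twice Gâteaux differentiable in $x\in E$, with $D_af\in C_{\mathcal K}(F\times E,\mathcal L(F,G))$, $D_xf\in C_{\mathcal K}(F\times E,\mathcal L(E,G))$, and such that $D_x^2f\colon F\times E\to\mathcal L(E\widehat\otimes E,G)$ extends to a function in $C_{\mathcal K}(F\times E,\mathcal L(E\widehat\otimes_\alpha E,G))$. Define a $G$-valued càdlàg path $Y$ by the Itô–Föllmer integral $$Y_t=\int_0^tD_xf(A_{s-},X_{s-})\,\mathrm dX_s,\qquad t\ge0.$$ Then $Y$ has the strong (resp. weak) $\alpha$-tensor quadratic variation along $(\pi_n)$, given by $${}^\alpha[Y,Y]_t=\int_0^tD_xf(A_{s-},X_{s-})^{\otimes2}\,\mathrm d\,{}^\alpha[X,X]_s,\qquad t\ge0.$$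
   Context: Banach spaces are real. A uniform crossnorm $\alpha$ is an assignment of a reasonable crossnorm on $E\otimes F$ to every pair of Banach spaces $(E,F)$ (i.e. $\alpha(x\otimes y)\le\|x\|\|y\|$ and $x^*\otimes y^*$ is $\alpha$-bounded with norm $\le\|x^*\|\|y^*\|$) such that for all $T\in\mathcal L(E_1,E_2)$, $S\in\mathcal L(F_1,F_2)$, $T\otimes S$ extends to a bounded operator $E_1\widehat\otimes_\alpha F_1\to E_2\widehat\otimes_\alpha F_2$ with $\|T\otimes S\|\le\|T\|\|S\|$. $E\widehat\otimes_\alpha F$ is the $\alpha$-completion of $E\otimes F$, $E\widehat\otimes E$ the completed projective tensor product; bounded bilinear maps $E\times E\to G$ are identified with elements of $\mathcal L(E\widehat\otimes E,G)$; $T^{\otimes2}=T\otimes T$. $C_{\mathcal K}(S,S')$ is the set of functions $S\to S'$ whose restriction to each compact subset of $S$ is continuous. A partition of $\mathbb R_{\ge0}$ is $\pi=\{\,]t_i,t_{i+1}]:i\in\mathbb N\}$ with $0=t_0<t_1<\dots\to\infty$; for $t>0$, $\pi(t)=]\underline\pi(t),\overline\pi(t)]$ is the element of $\pi$ containing $t$. $D(\mathbb R_{\ge0},E)$ is the set of càdlàg $E$-valued paths; $\Delta X_t=X_t-X_{t-}$ ($t>0$), $\Delta X_0=0$; $\delta X_t(]r,s])=X_{s\wedge t}-X_{r\wedge t}$. Finite variation means finite total variation on compact intervals. A càdlàg $X$ in $E$ has strong (weak) $\alpha$-tensor quadratic variation along $(\pi_n)$ if there is an $E\widehat\otimes_\alpha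 E$-valued càdlàg path ${}^\alpha[X,X]$ of finite variation with $\sum_{I\in\pi_n}\delta X_t(I)\otimes\delta X_t(I)\to{}^\alpha[X,X]_t$ in norm (weakly) for every $t\ge0$, and $\Delta\,{}^\alpha[X,X]_t=\Delta X_t\otimes\Delta X_t$ for all $t$. $X$ has finite 2-variation along $(\pi_n)$ if $\sup_n\sum_{I\in\pi_n}\|\delta X_t(I)\|^2<\infty$ for all $t\ge0$. Integrals $\int_0^t$ against finite variation paths are vector Stieltjes integrals over $]0,t]$. The Itô–Föllmer integral along $(\pi_n)$ is $\int_0^tD_xf(A_{s-},X_{s-})\,\mathrm dX_s=\lim_{n\to\infty}\sum_{]r,s]\in\pi_n}D_xf(A_r,X_r)(X_{s\wedge t}-X_{r\wedge t})$, the limit being in the norm (resp. weak) topology of $G$ when ${}^\alpha[X,X]$ is the strong (resp. weak) quadratic variation; under the present assumptions the limit exists, by the known Itô formula. For a càdlàg path $Z$ let $D(Z)=\{t:\Delta Z_t\ne0\}$, $D_\varepsilon(Z)=\{t:\|\Delta Z_t\|>\varepsilon\}$, $J_\varepsilon(Z)_t=\sum_{0<s\le t}\Delta Z_s1_{D_\varepsilon(Z)}(s)$, $O^+_t(Z,\pi)=\sup_{]r,s]\in\pi}\sup_{u,v\in]r,s]\cap[0,t]}\|Z_u-Z_v\|$. $(\pi_n)$ satisfies Condition (C) for $Z$ if: (C1) for all $t\ge0$, $\varepsilon>0$ there is $N$ such that $I\cap[0,t]\cap D_\varepsilon(Z)$ has at most one element for all $n\ge N$, $I\in\pi_n$; (C2)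 $\delta Z_t(\pi_n(s))\to\Delta Z_s$ for all $s\in D(Z)$, $t\ge s$; (C3) for all $t\ge 0$, $\varlimsup_{\varepsilon\downarrow0}\varlimsup_{n\to\infty}O^+_t(Z-J_\varepsilon(Z),\pi_n)=0$. $(\pi_n)$ approximates $Z$ from the left if $Z(\underline{\pi_n}(t))\to Z(t-)$ for all $t>0$. *)

(* Defs.v *)
From HB Require Import structures.
From mathcomp Require Import all_boot all_order all_algebra sesquilinear.
From mathcomp Require Import all_classical all_reals all_analysis.

Set Implicit Arguments.
Unset Strict Implicit.
Unset Printing Implicit Defensive.

Import Order.TTheory GRing.Theory Num.Theory.
Import numFieldNormedType.Exports.

Local Open Scope classical_set_scope.
Local Open Scope ring_scope.

Section BoundedOperators.
Variables (R : realType) (V W : normedModType R).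

Definition bounded_op : {pred V -> W} :=
  fun T => `[< linear T /\ continuous T >].

Lemma bounded_op_submod_closed : submod_closed bounded_op.
Proof.
split=> [|a S T].
  apply/asboolP; split; first by move=> a x y /=; rewrite scaler0 addr0.
  exact: cst_continuous.
move=> /asboolP[lS cS] /asboolP[lT cT]; apply/asboolP; split.
  move=> b x y; rewrite /= !fctE lS lT !scalerDr !scalerA (mulrC b).
  by rewrite -!addrA; congr (_ + _); rewrite addrCA.
move=> x; apply: (@cvgD R W V (nbhs x) _ (a \*: S) T); last exact: cT.
by apply: cvgZ => //; [exact: cvg_cst|exact: cS].
Qed.

HB.instance Definition _ :=
  GRing.isSubmodClosed.Build R (V -> W) bounded_op bounded_op_submod_closed.

Record blin := Blin { blin_fun :> V -> W ; _ : blin_fun \in bounded_op }.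

HB.instance Definition _ := [isSub for blin_fun].
HB.instance Definition _ := [Choice of blin by <:].
HB.instance Definition _ := [SubChoice_isSubLmodule of blin by <:].

Lemma blin_is_linear (T : blin) : linear T.
Proof. by case: T => T /= /asboolP[]. Qed.

HB.instance Definition _ (T : blin) :=
  GRing.isLinear.Build R V W _ (blin_fun T) (blin_is_linear T).

Lemma blin_continuous (T : blin) : continuous T.
Proof. by case: T => T /= /asboolP[]. Qed.

Lemma blin_ext (S T : blin) : S =1 T -> S = T.
Proof. by move=> ST; apply/val_inj/funext. Qed.

Definition opnorm (T : blin) : R :=
  sup [set `|T x| | x in [set x : V | `|x| <= 1]].

Lemma opnorm_has_sup (T : blin) :
  has_sup [set `|T x| | x in [set x : V | `|x| <= 1]].
Proof.
split; first by exists `|T 0|, 0 => //=; rewrite normr0.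
have /bounded_funP/(_ 1)[M TM] :=
  continuous_linear_bounded 0 (@blin_continuous T 0).
by exists M => _ [x x1 <-]; exact: TM.
Qed.

Lemma opnorm_ge (T : blin) (x : V) : `|x| <= 1 -> `|T x| <= opnorm T.
Proof.
by move=> x1; apply: sup_upper_bound; [exact: opnorm_has_sup|exists x].
Qed.

Lemma opnorm_le (T : blin) (M : R) :
  (forall x, `|x| <= 1 -> `|T x| <= M) -> opnorm T <= M.
Proof.
move=> TM; apply: ge_sup; first by case: (opnorm_has_sup T).
by move=> _ [x x1 <-]; exact: TM.
Qed.

Lemma opnormP (T : blin) (x : V) : `|T x| <= opnorm T * `|x|.
Proof.
have [->|x0] := eqVneq x 0; first by rewrite linear0 !normr0 mulr0.
have nx : 0 < `|x| by rewrite normr_gt0.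
rewrite -ler_pdivrMr// mulrC -[X in X * _]ger0_norm ?invr_ge0//.
rewrite -normrZ -linearZ; apply: opnorm_ge.
by rewrite normrZ ger0_norm ?invr_ge0// mulVf// gt_eqF.
Qed.

Lemma opnorm_ge0 (T : blin) : 0 <= opnorm T.
Proof. by rewrite (le_trans _ (@opnorm_ge T 0 _)) ?normr0. Qed.

Lemma ler_opnormD (S T : blin) : opnorm (S + T) <= opnorm S + opnorm T.
Proof.
apply: opnorm_le => x x1.
by rewrite (le_trans (ler_normD (S x) (T x)))// lerD// opnorm_ge.
Qed.

Lemma opnormZ (a : R) (T : blin) : opnorm (a *: T) = `|a| * opnorm T.
Proof.
have le b (S : blin) : opnorm (b *: S) <= `|b| * opnorm S.
  apply: opnorm_le => x x1.
  by rewrite [leLHS](normrZ b (S x)) ler_wpM2l// opnorm_ge.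
apply/eqP; rewrite eq_le le/=.
have [->|a0] := eqVneq a 0; first by rewrite normr0 mul0r opnorm_ge0.
rewrite -ler_pdivlMl ?normr_gt0// -normfV.
by rewrite (le_trans _ (le _ _))// scalerA mulVf// scale1r.
Qed.

Lemma opnorm0_eq0 (T : blin) : opnorm T = 0 -> T = 0.
Proof.
move=> T0; apply: blin_ext => x; apply/eqP.
by rewrite -normr_le0 (le_trans (opnormP T x))// T0 mul0r.
Qed.

HB.instance Definition _ :=
  Lmodule_isNormed.Build R blin ler_opnormD opnormZ opnorm0_eq0.

End BoundedOperators.

Section AlgebraicTensorProduct.
Variables (R : realType) (E F : lmodType R).

Definition pure_form (x : E) (y : F) : {bilinear E -> F -> R^o} -> R^o :=
  fun b => b x y.

Definition is_tensor : {pred {bilinear E -> F -> R^o} -> R^o} :=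
  fun u => `[< exists s : seq (E * F),
                 u = \sum_(p <- s) pure_form p.1 p.2 >].

Lemma is_tensor_submod_closed : submod_closed is_tensor.
Proof.
split=> [|a u v]; first by apply/asboolP; exists [::]; rewrite big_nil.
move=> /asboolP[s ->] /asboolP[t ->]; apply/asboolP.
exists ([seq (a *: p.1, p.2) | p <- s] ++ t).
rewrite big_cat/= big_map scaler_sumr; congr (_ + _).
by apply: eq_bigr => p _; apply/funext => b; rewrite /pure_form/= linearZl_LR.
Qed.

HB.instance Definition _ := GRing.isSubmodClosed.Build R
  ({bilinear E -> F -> R^o} -> R^o) is_tensor is_tensor_submod_closed.

(* The algebraic tensor product of E and F, realized inside the dual of the
   space of bilinear forms on E x F: the pure tensor of x and y is the
   evaluation b |-> b x y, and a tensor is a finite sum of pure tensors. As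
   bilinear forms separate the points of the algebraic tensor product, two
   finite sums are identified exactly when they represent the same tensor. *)
Record algtensor := AlgTensor {
  tensor_fun :> {bilinear E -> F -> R^o} -> R^o ;
  _ : tensor_fun \in is_tensor }.

HB.instance Definition _ := [isSub for tensor_fun].
HB.instance Definition _ := [Choice of algtensor by <:].
HB.instance Definition _ := [SubChoice_isSubLmodule of algtensor by <:].

Lemma pure_form_tensor (x : E) (y : F) : pure_form x y \in is_tensor.
Proof. by apply/asboolP; exists [:: (x, y)]; rewrite big_seq1. Qed.

Definition ptens (x : E) (y : F) : algtensor :=
  AlgTensor (pure_form_tensor x y).

End AlgebraicTensorProduct.

Section TensorForms.
Variables (R : realType) (E F : normedModType R).

Definition tens_form (x' : blin E R^o) (y' : blin F R^o) : E -> F -> R^o :=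
  fun x y => x' x * y' y.

Lemma tens_form_bilinear (x' : blin E R^o) (y' : blin F R^o) :
  bilinear_for *:%R *:%R (tens_form x' y').
Proof.
split=> [y|x] a u v; rewrite /tens_form linearP.
  by rewrite mulrDl -mulrA.
by rewrite mulrDr [X in X + _]mulrCA.
Qed.

HB.instance Definition _ (x' : blin E R^o) (y' : blin F R^o) :=
  bilinear_isBilinear.Build R E F R^o _ _ (tens_form x' y')
    (tens_form_bilinear x' y').

End TensorForms.

Section Crossnorms.
Variable R : realType.

Section OnePair.
Variables E F : completeNormedModType R.

Record is_norm (N : algtensor E F -> R) : Prop := IsNorm {
  is_normD : forall u v, N (u + v) <= N u + N v ;
  is_normZ : forall (c : R) u, N (c *: u) = `|c| * N u ;
  is_norm_eq0 : forall u, N u = 0 -> u = 0 }.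

(* The value of the functional x' (x) y' on a tensor u is [u (tens_form x' y')],
   i.e. the sum of the x' x_i * y' y_i if u is the sum of the x_i (x) y_i. *)
Record is_reasonable_crossnorm (N : algtensor E F -> R) : Prop :=
  IsReasonableCrossnorm {
    crossnorm_is_norm : is_norm N ;
    crossnorm_pure : forall x y, N (ptens x y) <= `|x| * `|y| ;
    crossnorm_dual : forall (x' : blin E R^o) (y' : blin F R^o)
        (u : algtensor E F),
      `|u (tens_form x' y')| <= `|x'| * `|y'| * N u }.

Record is_completion (N : algtensor E F -> R) (T : completeNormedModType R)
    (j : algtensor E F -> T) : Prop := IsCompletion {
  completion_linear : linear j ;
  completion_norm : forall u, `|j u| = N u ;
  completion_dense : dense (range j) }.

End OnePair.

(* A uniform crossnorm, together with its completed tensor products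
   [ctens _ E F]; the latter are determined by the norms up to a unique
   isometric isomorphism compatible with the embeddings. *)
Record uniform_crossnorm := UniformCrossnorm {
  crossnorm : forall E F : completeNormedModType R, algtensor E F -> R ;
  ctens : completeNormedModType R -> completeNormedModType R ->
    completeNormedModType R ;
  ctens_inj : forall E F : completeNormedModType R,
    algtensor E F -> ctens E F ;
  crossnorm_reasonable : forall E F, is_reasonable_crossnorm (@crossnorm E F) ;
  ctens_completion : forall E F,
    is_completion (@crossnorm E F) (@ctens_inj E F) ;
  crossnorm_uniform : forall (E1 E2 F1 F2 : completeNormedModType R)
      (T : blin E1 E2) (S : blin F1 F2),
    exists TS : blin (ctens E1 F1) (ctens E2 F2),
      (forall x y, TS (ctens_inj (ptens x y)) = ctens_inj (ptens (T x) (S y)))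
      /\ `|TS| <= `|T| * `|S| }.

Definition tens (alpha : uniform_crossnorm) (E F : completeNormedModType R)
    (x : E) (y : F) : ctens alpha E F :=
  ctens_inj alpha (ptens x y).

(* The bounded extension of T (x) S to the completions; it is unique because
   sums of pure tensors are dense. *)
Definition tens_op (alpha : uniform_crossnorm)
    (E1 E2 F1 F2 : completeNormedModType R) (T : blin E1 E2) (S : blin F1 F2) :
    blin (ctens alpha E1 F1) (ctens alpha E2 F2) :=
  projT1 (cid (crossnorm_uniform alpha T S)).

End Crossnorms.

Section Calculus.
Variable R : realType.

Definition gateaux_derivative (V W : normedModType R) (g : V -> W) (x : V)
    (T : blin V W) : Prop :=
  forall h : V, is_derive x h g (T h).

Definition CK (S S' : topologicalType) (g : S -> S') : Prop :=
  forall K : set S, compact K -> {within K, continuous g}.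

End Calculus.

(* The two readings (norm / weak topology) of the limits below. *)
Inductive cvg_mode := Strong | Weak.

Section Paths.
Variable R : realType.

Definition mode_cvg (m : cvg_mode) (V : normedModType R) (u : nat -> V) (l : V)
    : Prop :=
  match m with
  | Strong => u @ \oo --> l
  | Weak => forall v' : blin V R^o, v' (u n) @[n --> \oo] --> v' l
  end.

Section OnePath.
Variable V : normedModType R.
Implicit Types (Z : R -> V) (t : R).

(* Paths indexed by the nonnegative reals are functions on R of which only the
   values at nonnegative times are ever used. *)
Definition cadlag Z : Prop :=
  (forall t, 0 <= t -> Z @ t^'+ --> Z t) /\
  (forall t, 0 < t -> cvg (Z @ t^'-)).

Definition leftlim Z t : V := lim (Z @ t^'-).

Definition jump Z t : V := if 0 < t then Z t - leftlim Z t else 0.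

Definition incr Z t (r s : R) : V :=
  Z (Num.min s t) - Z (Num.min r t).

Definition vvariation (a b : R) Z (s : seq R) : R :=
  let z := Z \o nth b (a :: s) in \sum_(0 <= n < size s) `|z n.+1 - z n|.

Definition total_vvariation (a b : R) Z : \bar R :=
  ereal_sup [set (vvariation a b Z s)%:E | s in itv_partition a b].

Definition finite_variation Z : Prop :=
  forall t, 0 <= t -> (total_vvariation 0 t Z < +oo)%E.

End OnePath.

Section Stieltjes.
Variables V W : normedModType R.

(* A triple (c, a, b) stands for the function c 1_{]a, b]}. *)
Definition step_fun (s : seq (blin V W * R * R)) : R -> blin V W :=
  fun r => \sum_(p <- s) if p.1.2 < r <= p.2 then p.1.1 else 0.

Definition step_integral (g : R -> V) (s : seq (blin V W * R * R)) : W :=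
  \sum_(p <- s) p.1.1 (g p.2 - g p.1.2).

(* The integral over ]0, t] of an operator-valued function phi against the
   V-valued measure dg: it is defined on left-open step functions by
   linearity and extended by density in L^1(|dg|), where |dg| is the
   Lebesgue-Stieltjes measure of the variation function mu of g. *)
Definition is_stieltjes_integral (phi : R -> blin V W) (g : R -> V) (t : R)
    (I : W) : Prop :=
  exists (mu : cumulative R R) (s : nat -> seq (blin V W * R * R)),
  [/\ forall r, total_vvariation 0 (Num.max 0 r) g = (mu r)%:E,
      forall n, all (fun p => (0 <= p.1.2 <= p.2) && (p.2 <= t)) (s n),
      forall n, measurable_fun `]0, t] (fun r => `|phi r - step_fun (s n) r|),
      (\int[lebesgue_stieltjes_measure mu]_(r in `]0%R, t])
        (`|phi r - step_fun (s n) r|%R)%:E)%E @[n --> \oo] --> 0%E &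
      step_integral g (s n) @[n --> \oo] --> I].

End Stieltjes.

End Paths.

Section Partitions.
Variable R : realType.

(* The partition consisting of the intervals ]pt i, pt i.+1]. *)
Record time_partition := TimePartition {
  pt :> nat -> R ;
  pt0 : pt 0%N = 0 ;
  pt_increasing : forall i, pt i < pt i.+1 ;
  pt_cvg : pt @ \oo --> +oo }.

Definition cell (p : time_partition) (i : nat) : set R := `]p i, p i.+1].

(* For t > 0, the index of the unique element of the partition containing t. *)
Definition cell_index (p : time_partition) (t : R) : nat :=
  xget 0%N [set i | cell p i t].

Definition lower_pt (p : time_partition) (t : R) : R := p (cell_index p t).
Definition upper_pt (p : time_partition) (t : R) : R := p (cell_index p t).+1.

Section OnePath.
Variable V : normedModType R.
Implicit Types (Z : R -> V) (pi : nat -> time_partition).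

(* The sum over all elements of a partition; below all but finitely many of
   its terms vanish. *)
Definition sum_cells (F : nat -> V) : V := \big[+%R/0]_(0 <= i <oo) F i.

Definition big_jumps Z (eps : R) : set R :=
  [set t | 0 <= t /\ eps < `|jump Z t|].

Definition jump_part Z (eps : R) : R -> V :=
  fun t => \sum_(s \in [set s | 0 < s <= t] `&` big_jumps Z eps) jump Z s.

(* 0 is added to the set so that the supremum is 0 when t = 0. *)
Definition oscillation Z (p : time_partition) (t : R) : \bar R :=
  ereal_sup (0%E |` [set e | exists i u v,
    [/\ cell p i u, cell p i v, 0 <= u <= t, 0 <= v <= t &
        e = `|Z u - Z v|%:E]]).

Definition conditionC1 Z pi : Prop :=
  forall t eps, 0 <= t -> 0 < eps ->
  exists N, forall n i, (N <= n)%N ->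
    is_subset1 (cell (pi n) i `&` `[0, t] `&` big_jumps Z eps).

Definition conditionC2 Z pi : Prop :=
  forall s t, 0 <= s -> jump Z s != 0 -> s <= t ->
  incr Z t (lower_pt (pi n) s) (upper_pt (pi n) s) @[n --> \oo] --> jump Z s.

Definition conditionC3 Z pi : Prop :=
  forall t, 0 <= t ->
  limf_esup (fun eps =>
    limn_esup (fun n => oscillation (Z \- jump_part Z eps) (pi n) t)) 0^'+
  = 0%E.

Definition conditionC Z pi : Prop :=
  [/\ conditionC1 Z pi, conditionC2 Z pi & conditionC3 Z pi].

Definition approximates_from_left Z pi : Prop :=
  forall t, 0 < t -> Z (lower_pt (pi n) t) @[n --> \oo] --> leftlim Z t.

Definition finite_2variation Z pi : Prop :=
  forall t, 0 <= t -> exists C : R, forall n,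
    (\sum_(0 <= i <oo) (`|incr Z t (pi n i) (pi n i.+1)| ^+ 2)%:E <= C%:E)%E.

End OnePath.

Record has_tensor_qv (m : cvg_mode) (alpha : uniform_crossnorm R)
    (E : completeNormedModType R) (pi : nat -> time_partition) (X : R -> E)
    (Q : R -> ctens alpha E E) : Prop := HasTensorQV {
  qv_cadlag_path : cadlag X ;
  qv_cadlag : cadlag Q ;
  qv_finite_variation : finite_variation Q ;
  qv_cvg : forall t, 0 <= t ->
    mode_cvg m (fun n => sum_cells (fun i =>
      tens alpha (incr X t (pi n i) (pi n i.+1))
                 (incr X t (pi n i) (pi n i.+1)))) (Q t) ;
  qv_jump : forall t, 0 <= t -> jump Q t = tens alpha (jump X t) (jump X t) }.

(* The integral of phi along the sequence of partitions: phi is evaluated at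
   the left endpoints. *)
Definition is_ito_follmer_integral (m : cvg_mode) (E G : normedModType R)
    (pi : nat -> time_partition) (phi : R -> blin E G) (X : R -> E) (t : R)
    (y : G) : Prop :=
  mode_cvg m (fun n => sum_cells (fun i =>
    phi (pi n i) (incr X t (pi n i) (pi n i.+1)))) y.

End Partitions.

(* Main.v *)
Require Import Defs.
From HB Require Import structures.
From mathcomp Require Import all_boot all_order all_algebra sesquilinear.
From mathcomp Require Import all_classical all_reals all_analysis measurable_realfun.
From mathcomp Require Import ring lra.

Set Implicit Arguments.
Unset Strict Implicit.
Unset Printing Implicit Defensive.

Import Order.TTheory GRing.Theory Num.Theory.
Import numFieldNormedType.Exports.

Local Open Scope classical_set_scope.
Local Open Scope ring_scope.

(* Let Z = (A, X). Condition (C) says that in each cell ]r, s] of a late partition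
   the path Z is almost constant on [r, tau[ and on [tau, s] for some tag tau, the
   time of the only large jump. So a sum of increments q(Z_r, Z_s) over the cells,
   stopped at time t, is up to a vanishing error the sum over the cells with tag
   at most t; approximating psi(Z_-) uniformly by step functions, the sums of
   psi(Z_r) q(Z_r, Z_s) converge to integrals of psi(Z_-). With Taylor's formula
   this gives Y = f(Z) - f(Z_0) - (integrals against [X, X] and A) - S, where S is a
   norm limit of sums of Taylor remainders. Consequently the error
   delta Y(I) - D_x f(Z_r) delta X(I) has a bounded sum of norms over the cells.
   It also tends to 0 uniformly: its jumps vanish because Delta Y =
   D_x f(Z_-) Delta X, and Y oscillates little where Z does, because Y is constant
   wherever Z is. So the sum of the squared errors vanishes, and the quadratic sums
   of Y behave as those of D_x f(Z_r) delta X, which are again sums of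
   psi(Z_r) q(Z_r, Z_s), with psi the tensor square of D_x f. *)

(** The mesh of the partitions need not tend to 0: a cell may stay long where [Z] hardly moves. No
    estimate can therefore rest on short cells, and the increments of [Y] have to be controlled by
    the oscillation of [Z]. The formula for [Y] does not give this directly, as the integrals and
    [S] are not functions of [Z]; constancy of [Y] where [Z] is constant, combined with compactness
    in time, does. A second obstacle is the weak case, in which the quadratic sums are bounded in
    norm but need not converge in norm. The mode of convergence is therefore only carried through
    finite linear combinations of increments of these sums. All other errors are estimated in norm
    by the energy, the sum over the cells of the squared increments of [X] and the increments of
    [A], which is bounded uniformly in [n]. Subdivisions of the time interval are hidden in an
    induction: a property of intervals has to be stable under gluing and to hold on short intervals
    on either side of a point. The integrals are built in the same way, as primitives characterized
    by an inequality on every interval, and are matched with the Stieltjes definition at the end. *)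

(** * Linear identities in a module, decided coefficient by coefficient *)

Section ModuleExpressions.
Variables (R : pzRingType) (V : lmodType R).

Inductive mexp :=
  | MVar of nat | MZero | MAdd of mexp & mexp | MOpp of mexp
  | MScale of R & mexp.

Fixpoint meval (env : seq V) (e : mexp) : V :=
  match e with
  | MVar n => nth 0 env n
  | MZero => 0
  | MAdd e1 e2 => meval env e1 + meval env e2
  | MOpp e1 => - meval env e1
  | MScale k e1 => k *: meval env e1
  end.

Fixpoint mcoef (e : mexp) (i : nat) : R :=
  match e with
  | MVar n => (n == i)%:R
  | MZero => 0
  | MAdd e1 e2 => mcoef e1 i + mcoef e2 i
  | MOpp e1 => - mcoef e1 i
  | MScale k e1 => k * mcoef e1 i
  end.

(** A recursive conjunction rather than a quantified statement: for a concrete environment it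
    computes to scalar equations for [ring]. *)
Fixpoint mcoef_eq (e1 e2 : mexp) (n : nat) : Prop :=
  if n is m.+1 then mcoef e1 m = mcoef e2 m /\ mcoef_eq e1 e2 m else True.

Lemma mevalE (env : seq V) (e : mexp) :
  meval env e = \sum_(i < size env) mcoef e i *: env`_i.
Proof.
elim: e => /= [n||e1 -> e2 ->|e1 ->|k e1 ->].
- have [nl|nl] := ltnP n (size env).
    rewrite (bigD1 (Ordinal nl))//= eqxx scale1r big1 ?addr0// => i.
    by rewrite -val_eqE/= eq_sym => /negbTE ->; rewrite scale0r.
  rewrite nth_default// big1// => i _.
  case: eqP => [ni|]; last by rewrite scale0r.
  by have := ltn_ord i; rewrite -ni ltnNge nl.
- by rewrite big1// => i _; rewrite scale0r.
- by rewrite -big_split; apply: eq_bigr => i _; rewrite scalerDl.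
- by rewrite -sumrN; apply: eq_bigr => i _; rewrite scaleNr.
- by rewrite scaler_sumr; apply: eq_bigr => i _; rewrite scalerA.
Qed.

Lemma meval_eq (env : seq V) (e1 e2 : mexp) :
  mcoef_eq e1 e2 (size env) -> meval env e1 = meval env e2.
Proof.
rewrite !mevalE => H.
suff E i : (i < size env)%N -> mcoef e1 i = mcoef e2 i.
  by apply: eq_bigr => i _; rewrite E.
elim: (size env) H => [//|n IH] /= [en /IH{}IH].
by rewrite ltnS leq_eqVlt => /predU1P[->|].
Qed.

End ModuleExpressions.

(** The inner [match goal] lets the tactic [unify] run inside an expression that returns a term;
    atoms are thereby identified up to conversion. *)
Ltac mexp_same x y :=
  match goal with
  | _ => let _ := match goal with _ => unify x y end in constr:(true)
  | _ => constr:(false)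
  end.

Ltac mexp_mem x env :=
  lazymatch env with
  | nil => constr:(false)
  | cons ?y ?l => lazymatch mexp_same x y with
                  | true => constr:(true)
                  | false => mexp_mem x l
                  end
  end.

Ltac mexp_env t env :=
  lazymatch t with
  | (?a + ?b)%R => let env1 := mexp_env a env in mexp_env b env1
  | (- ?a)%R => mexp_env a env
  | (_ *: ?a)%R => mexp_env a env
  | 0%R => env
  | _ => lazymatch mexp_mem t env with
         | true => env
         | false => constr:(cons t env)
         end
  end.

Ltac mexp_index x env :=
  lazymatch env with
  | cons ?y ?l => lazymatch mexp_same x y with
                  | true => constr:(0%N)
                  | false => let n := mexp_index x l in constr:(S n)
                  end
  end.

Ltac mexp_reify R t env :=
  lazymatch t with
  | (?a + ?b)%R => let ea := mexp_reify R a env in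
                   let eb := mexp_reify R b env in
                   constr:(@MAdd R ea eb)
  | (- ?a)%R => let ea := mexp_reify R a env in constr:(@MOpp R ea)
  | (?k *: ?a)%R => let ea := mexp_reify R a env in constr:(@MScale R k ea)
  | 0%R => constr:(@MZero R)
  | _ => let n := mexp_index t env in constr:(@MVar R n)
  end.

(* [module R V] proves an equation between linear combinations in the
   [R]-module [V] by comparing the coefficients of each atom with [ring]. *)
Ltac module R V :=
  lazymatch goal with
  | |- ?a = ?b =>
    let env0 := constr:(@nil V) in
    let env1 := mexp_env a env0 in
    let env := mexp_env b env1 in
    let ea := mexp_reify R a env in
    let eb := mexp_reify R b env in
    refine (@meval_eq R V env ea eb _);
    cbv beta iota delta [mcoef_eq mcoef size]; rewrite ?eqxx /=;
    repeat split; ring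
  end.

(** * Interval induction, mean values and separating functionals *)

Section IntervalInduction.
Variable R : realType.
Implicit Types a b c : R.

Lemma near_right_itv a (P : R -> Prop) : (\forall x \near a^'+, P x) ->
  \forall c \near a^'+, forall x, a < x <= c -> P x.
Proof.
move=> /nbhs_ballP[e /= e0 aP]; apply/nbhs_ballP; exists e => //= c.
rewrite -ball_normE /= => ace ac x /andP[ax xc]; apply: aP => //=.
rewrite -ball_normE /=; move: ace.
by rewrite ltr0_norm ?subr_lt0// ltr0_norm ?subr_lt0//; lra.
Qed.

Lemma near_left_itv a (P : R -> Prop) : (\forall x \near a^'-, P x) ->
  \forall c \near a^'-, forall x, c <= x < a -> P x.
Proof.
move=> /nbhs_ballP[e /= e0 aP]; apply/nbhs_ballP; exists e => //= c.
rewrite -ball_normE /= => ace ac x /andP[ax xc]; apply: aP => //=.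
rewrite -ball_normE /=; move: ace.
by rewrite gtr0_norm ?subr_gt0// gtr0_norm ?subr_gt0//; lra.
Qed.

(** The supremum of the endpoints reachable from [lo] is itself reached, by a short interval on its
    left, and a short interval on its right would pass it, so it is [hi]. One-sided hypotheses suit
    cadlag paths, which are nearly constant on each side of a point but not across it. *)
Lemma interval_ind (P : R -> R -> Prop) (lo hi : R) : lo <= hi ->
  (forall a, P a a) ->
  (forall a b c, lo <= a -> a <= b -> b <= c -> c <= hi ->
     P a b -> P b c -> P a c) ->
  (forall a, lo <= a -> a < hi -> \forall c \near a^'+, P a c) ->
  (forall b, lo < b -> b <= hi -> \forall c \near b^'-, P c b) ->
  P lo hi.
Proof.
move=> lohi P0 PD Pr Pl.
pose S := [set x | lo <= x <= hi /\ P lo x].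
have Slo : S lo by split; rewrite ?lexx.
have Sub : ubound S hi by move=> x [/andP[]].
have hS : has_sup S := conj (ex_intro _ lo Slo) (ex_intro _ hi Sub).
have los : lo <= sup S by exact: (sup_upper_bound hS).
have shi : sup S <= hi by apply: ge_sup => //; exists lo.
have Ps : P lo (sup S).
  move: los; rewrite le_eqVlt => /predU1P[<-//|los].
  have nP : \forall x \near (sup S)^'-, lo < x /\ P x (sup S).
    by near do split; [exact: nbhs_left_gt|exact: Pl].
  have [c [/= cs cP]] := filter_ex (filterI (nbhs_left_lt _) (near_left_itv nP)).
  have d0 : 0 < sup S - c by rewrite subr_gt0.
  have [x Sx] := sup_adherent d0 hS; rewrite subKr => cx.
  have xs : x <= sup S by exact: (sup_upper_bound hS).
  move: xs; rewrite le_eqVlt => /predU1P[<-|xs]; first by case: Sx.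
  have /cP[lox Pxs] : c <= x < sup S by rewrite (ltW cx).
  by apply: (PD _ x); [|exact: ltW|exact: ltW| |case: Sx|exact: Pxs].
move: shi; rewrite le_eqVlt => /predU1P[<-//|shi].
near (sup S)^'+ => c.
have sc : sup S < c by near: c; exact: nbhs_right_gt.
have chi : c <= hi by near: c; exact: nbhs_right_le.
suff Sc : S c by have := sup_upper_bound hS Sc; rewrite leNgt sc.
split; first by rewrite chi (le_trans los (ltW sc)).
apply: (PD _ (sup S)) => //.
by near: c; exact: Pr.
Unshelve. all: by end_near. Qed.

End IntervalInduction.

Section MeanValue.
Variable R : realType.

Lemma ler_addgt0_scale (x y k : R) : (forall e, 0 < e -> x <= y + e * k) ->
  x <= y.
Proof.
move=> xy; apply/ler_addgt0Pr => e e0.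
have k0 : 0 < `|k| + 1 by rewrite ltr_wpDl.
rewrite (le_trans (xy _ (divr_gt0 e0 k0)))// lerD2l -mulrA ger_pMr//.
by rewrite mulrC ler_pdivrMr// mul1r (le_trans (ler_norm k))// lerDl.
Qed.

Lemma is_derive_expansion (V W : normedModType R) (g : V -> W) x v d :
  is_derive x v g d -> forall e : R, 0 < e ->
  \forall t \near (0 : R), `|g (x + t *: v) - g x - t *: d| <= e * `|t|.
Proof.
move=> [dg <-] e e0.
have /cvgrPdist_le/(_ e e0) := dg.
move=> /nbhs_ballP[r /= r0 H]; apply/nbhs_ballP; exists r => //= t rt.
have [->|t0] := eqVneq t 0.
  by rewrite !scale0r addr0 subrr sub0r normrN !normr0 mulr0.
have := H t rt t0; rewrite /derive /= => {}H.
rewrite -[leLHS](mulVKf (_ : `|t| != 0)) ?normr_eq0//.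
rewrite mulrC ler_pM2r ?normr_gt0// -normfV -normrZ scalerBr scalerA.
rewrite mulVf// scale1r distrC; move: H; rewrite (addrC (t *: v)).
by [].
Qed.

(** Near each point the increment of [phi] is at most [M + e] times the length, and this bound adds
    up over adjacent intervals. Pointwise derivatives along a segment are all that Gateaux
    differentiability provides. *)
Lemma mean_value_bound (W : normedModType R) (phi dphi : R -> W) (M : R) :
  (forall s : R, 0 <= s <= 1 -> forall e : R, 0 < e ->
     \forall t \near (0 : R),
       `|phi (s + t) - phi s - t *: dphi s| <= e * `|t|) ->
  (forall s : R, 0 <= s <= 1 -> `|dphi s| <= M) ->
  `|phi 1 - phi 0| <= M.
Proof.
move=> dp pM.
suff H (e : R) : 0 < e -> `|phi 1 - phi 0| <= (M + e) * (1 - 0).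
  by apply/ler_addgt0Pr => e /H; rewrite subr0 mulr1.
move=> e0.
have loc (s : R) : 0 <= s <= 1 -> \forall x \near s,
    `|phi x - phi s| <= (M + e) * `|x - s|.
  move=> s01; have /nbhs_ballP[r /= r0 H] := dp s s01 _ e0.
  apply/nbhs_ballP; exists r => //= x; rewrite -ball_normE/= => xr.
  have {}H : `|phi x - phi s - (x - s) *: dphi s| <= e * `|x - s|.
    have xr' : ball 0 r (x - s) by rewrite -ball_normE/= sub0r opprB.
    by have := H _ xr'; rewrite [s + _]addrC subrK.
  have -> : phi x - phi s =
      (x - s) *: dphi s + (phi x - phi s - (x - s) *: dphi s) by module R W.
  rewrite (le_trans (ler_normD _ _))// mulrDl lerD//.
    by rewrite normrZ [leRHS]mulrC ler_wpM2l// pM.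
apply: (@interval_ind R (fun a b => `|phi b - phi a| <= (M + e) * (b - a))).
- exact: ler01.
- by move=> a; rewrite !subrr normr0 mulr0.
- move=> a b c _ _ _ _ ab bc.
  rewrite -[phi c - _](subrKA (phi b)) (le_trans (ler_normD _ _))//.
  by rewrite -(subrKA b c) mulrDr lerD.
- move=> a a0 a1; have := loc a; rewrite a0 ltW// => /(_ isT) H.
  near=> c; rewrite -[X in _ * X]gtr0_norm; first by near: c; exact: cvg_within.
  by rewrite subr_gt0; near: c; exact: nbhs_right_gt.
- move=> b b0 b1; have := loc b; rewrite b1 ltW// => /(_ isT) H.
  near=> c; rewrite -[X in _ * X]gtr0_norm; last first.
    by rewrite subr_gt0; near: c; exact: nbhs_left_lt.
  by rewrite distrC (distrC b); near: c; exact: cvg_within.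
Unshelve. all: by end_near. Qed.

Lemma gateaux_mean_value (V W : normedModType R) (g : V -> W)
    (T : V -> blin V W) (x h : V) (c : W) (M : R) :
  (forall y, gateaux_derivative g y (T y)) ->
  (forall s : R, 0 <= s <= 1 -> `|T (x + s *: h) h - c| <= M) ->
  `|g (x + h) - g x - c| <= M.
Proof.
move=> gT TM; pose phi s := g (x + s *: h) - s *: c.
have -> : g (x + h) - g x - c = phi 1 - phi 0.
  by rewrite /phi !scale1r !scale0r addr0 subr0 addrAC.
apply: (mean_value_bound (dphi := fun s => T (x + s *: h) h - c)) => // s _ e e0.
have := is_derive_expansion (gT (x + s *: h) h) e0; apply: filterS => t.
apply: le_trans; rewrite le_eqVlt; apply/orP; left; apply/eqP; congr `|_|.
have -> : x + s *: h + t *: h = x + (s + t) *: h by module R V.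
by rewrite /phi /=; module R W.
Qed.

End MeanValue.

Section HahnBanach.
Variables (R : realType) (V : normedModType R).

(** Partial functionals are represented by their graphs, which Zorn's lemma orders by inclusion.
    Single-valuedness follows from domination: the difference of two values over the same vector is
    a value over 0. *)
Definition dominated_graph (S : set (V * R)) : Prop :=
  (forall k p q, S p -> S q -> S (k *: p.1 + q.1, k * p.2 + q.2)) /\
  (forall p, S p -> p.2 <= `|p.1|).

(** The value [c] at [x] has to lie between all [p.2 - |p.1 - x|] and all [|q.1 + x| - q.2], which
    the supremum of the former does; rescaling reduces the other multiples of [x] to these two
    cases. *)
Lemma dominated_graph_ext (S : set (V * R)) (x : V) : dominated_graph S ->
  S (0, 0) -> exists c : R, dominated_graph
    [set p | exists q l, S q /\ p = (q.1 + l *: x, q.2 + l * c)].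
Proof.
move=> [lS dS] S0.
have le p q : S p -> S q -> p.2 - `|p.1 - x| <= `|q.1 + x| - q.2.
  move=> Sp Sq; have /dS/= := lS 1 _ _ Sp Sq; rewrite scale1r mul1r => pq.
  rewrite lerBlDr addrAC lerBrDr (le_trans pq)//.
  have -> : p.1 + q.1 = (q.1 + x) + (p.1 - x) by module R V.
  exact: ler_normD.
pose U := [set p.2 - `|p.1 - x| | p in S].
have hU : has_sup U.
  split; first by exists (0 - `|0 - x|), (0, 0).
  by exists (`|0 + x| - 0) => _ [p Sp <-]; exact: (le _ (0, 0)).
have Uc p : S p -> p.2 - `|p.1 - x| <= sup U.
  by move=> Sp; apply: sup_upper_bound => //; exists p.
have cU q : S q -> sup U <= `|q.1 + x| - q.2.
  by move=> Sq; apply: ge_sup; [exact: hU.1|move=> _ [p Sp <-]; exact: le].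
have S1 k p : S p -> S (k *: p.1, k * p.2).
  by move=> Sp; have /= := lS k _ _ Sp S0; rewrite !addr0.
exists (sup U); split.
  move=> k _ _ [p [l [Sp ->]]] [q [m [Sq ->]]] /=.
  exists (k *: p.1 + q.1, k * p.2 + q.2), (k * l + m); split; first exact: lS.
  by congr (_, _) => /=; [module R V|ring].
move=> _ [p [l [Sp ->]]] /=.
have [l0|l0|->] := ltrgt0P l.
- have E : `|p.1 + l *: x| = l * `|l^-1 *: p.1 + x|.
    rewrite -[X in X * _](gtr0_norm l0) -normrZ scalerDr scalerA.
    by rewrite mulfV ?gt_eqF// scale1r.
  have := ler_wpM2l (ltW l0) (cU _ (S1 l^-1 _ Sp)).
  by rewrite /= mulrBr -E mulVKf ?gt_eqF//; lra.
- have m0 : 0 < - l by rewrite oppr_gt0.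
  have E : `|p.1 + l *: x| = - l * `|(- l)^-1 *: p.1 - x|.
    rewrite -[X in X * _](gtr0_norm m0) -normrZ scalerBr scalerA.
    by rewrite mulfV ?gt_eqF// scale1r scaleNr opprK.
  have := ler_wpM2l (ltW m0) (Uc _ (S1 (- l)^-1 _ Sp)).
  by rewrite /= mulrBr -E mulVKf ?gt_eqF//; lra.
- by rewrite scale0r mul0r !addr0; exact: dS.
Qed.

(* A maximal dominated graph containing [(h, |h|)] is the graph of a functional. *)
Lemma norming_functional (h : V) :
  exists2 v' : blin V R^o, v' h = `|h| & forall x, `|v' x| <= `|x|.
Proof.
(* The union of the empty chain is empty, so the empty graph has to satisfy [P]; the point over [h]
   is therefore asked of nonempty graphs only. *)
pose P S := dominated_graph S /\ (S !=set0 -> S (h, `|h|)).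
have [|A [[[lA dA] Ah] Amax]] := @Zorn_bigcup _ P.
  move=> F FP Ftot; split; [split|].
  - move=> k p q [S FS Sp] [T FT Tq].
    have [ST|TS] := Ftot _ _ FS FT.
      by exists T => //; apply: (FP _ FT).1.1 => //; exact: ST.
    by exists S => //; apply: (FP _ FS).1.1 => //; exact: TS.
  - by move=> p [S FS Sp]; exact: (FP _ FS).1.2.
  - by move=> [p [S FS Sp]]; exists S => //; apply: (FP _ FS).2; exists p.
have {}Ah : A (h, `|h|).
  apply: contrapT => nAh.
  have A0 : A = set0.
    by apply: contrapT => /eqP/set0P/Ah.
  apply: (Amax [set p | exists l : R, p = (l *: h, l * `|h|)]).
    rewrite A0; split; first exact: sub0set.
    by move=> /(_ (1 *: h, 1 * `|h|)); apply; exists 1.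
  split; last by move=> _; exists 1; rewrite scale1r mul1r.
  split; last by move=> _ [l ->] /=; rewrite normrZ ler_wpM2r// ler_norm.
  move=> k _ _ [l ->] [m ->]; exists (k * l + m).
  by congr (_, _) => /=; [module R V|ring].
have A0 : A (0, 0).
  have := lA (-1) _ _ Ah Ah; congr A.
  by congr (_, _) => /=; [module R V|ring].
have total x : exists r : R, A (x, r).
  apply: contrapT => nx.
  have [c Bc] := dominated_graph_ext x (conj lA dA) A0.
  apply: (Amax _ _ (conj Bc _)); last first.
    by move=> _; exists (h, `|h|), 0; rewrite scale0r mul0r !addr0.
  split => [p Ap|/(_ (x, c)) AB].
    by exists p, 0; rewrite scale0r mul0r !addr0 -surjective_pairing.
  apply: nx; exists c; apply: AB; exists (0, 0), 1.
  by rewrite scale1r mul1r !add0r.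
have /choice[g Ag] := total.
have uniq x r s : A (x, r) -> A (x, s) -> r = s.
  move=> Ar As; apply/eqP; rewrite eq_le.
  have /dA := lA (-1) _ _ Ar As; have /dA := lA (-1) _ _ As Ar.
  by rewrite /= scaleN1r addNr normr0 => *; apply/andP; split; lra.
have lin : linear (g : V -> R^o).
  by move=> k x y; apply: (uniq (k *: x + y)) => //; exact: lA (Ag x) (Ag y).
have gle x : `|g x| <= `|x|.
  rewrite ler_norml (dA _ (Ag x)) andbT lerNl.
  have := dA _ (lA (-1) _ _ (Ag x) A0).
  by rewrite /= !addr0 scaleN1r normrN mulN1r.
have cg : continuous (g : V -> R^o).
  move=> x; apply/cvgrPdist_le => e e0.
  have /cvgrPdist_le/(_ e e0) : id @ x --> x by exact: cvg_id.
  apply: filterS => y; apply: le_trans.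
  have -> : g x - g y = g (x - y).
    by have := lin (-1) y x; rewrite !scaleN1r ![- _ + _]addrC => ->.
  exact: gle.
have gb : (g : V -> R^o) \in @bounded_op R V R^o by apply/asboolP.
by exists (Blin gb) => //=; exact: uniq (Ag h) Ah.
Qed.

(** This makes weak limits unique. *)
Lemma functionals_separate (x y : V) :
  (forall v' : blin V R^o, v' x = v' y) -> x = y.
Proof.
move=> xy; apply/eqP; rewrite -subr_eq0 -normr_eq0.
have [v' <- _] := norming_functional (x - y).
have -> : v' (x - y) = v' x - v' y by exact: linearB.
by rewrite xy subrr.
Qed.

End HahnBanach.

(** * Cadlag paths *)

Section CadlagPaths.
Variables (R : realType) (V : normedModType R).
Implicit Types Z : R -> V.

Lemma cadlag_near_right Z a e : cadlag Z -> 0 <= a -> 0 < e ->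
  \forall c \near a^'+, forall x, a <= x <= c -> `|Z x - Z a| <= e.
Proof.
move=> [rZ _] a0 e0; have /cvgrPdist_le/(_ e e0)/near_right_itv := rZ a a0.
apply: filterS => c H x /andP[]; rewrite le_eqVlt => /predU1P[<- _|ax xc].
  by rewrite subrr normr0 ltW.
by rewrite distrC H// ax.
Qed.

Lemma cadlag_near_left Z b e : cadlag Z -> 0 < b -> 0 < e ->
  \forall c \near b^'-, forall x, c <= x < b -> `|Z x - leftlim Z b| <= e.
Proof.
move=> [_ lZ] b0 e0; have /cvgrPdist_le/(_ e e0)/near_left_itv := lZ b b0.
by apply: filterS => c H x xb; rewrite distrC H.
Qed.

Lemma leftlim_unique Z b l :
  (forall e, 0 < e -> \forall x \near b^'-, `|Z x - l| <= e) -> leftlim Z b = l.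
Proof.
move=> H; apply/cvg_lim => //; apply/cvgrPdist_le => e /H.
by apply: filterS => x; rewrite distrC.
Qed.

Lemma leftlim_dist_le Z a b w e : cadlag Z -> 0 < b -> a < b ->
  (forall x, a <= x < b -> `|Z x - w| <= e) -> `|leftlim Z b - w| <= e.
Proof.
move=> cZ b0 ab H; apply/ler_addgt0Pr => d d0.
near b^'- => c.
have cb : c < b by near: c; exact: nbhs_left_lt.
have ac : a <= c by near: c; exact: nbhs_left_ge.
rewrite -[_ - w](subrKA (Z c)) (le_trans (ler_normD _ _))// addrC lerD//.
  by apply: H; rewrite ac.
rewrite distrC.
suff : forall x, c <= x < b -> `|Z x - leftlim Z b| <= d by apply; rewrite lexx.
by near: c; exact: cadlag_near_left.
Unshelve. all: by end_near. Qed.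

(* The left limits are added to make the range of the path compact. *)
Definition path_range Z (a b : R) : set V :=
  [set z | (exists2 u, a <= u <= b & z = Z u) \/
           (exists2 u, a < u <= b & z = leftlim Z u)].

(** The covering form of compactness is stable under gluing intervals, and on a short one-sided
    interval all values and left limits are close to at most two points of the range. *)
Lemma compact_path_range Z T : cadlag Z -> 0 <= T -> compact (path_range Z 0 T).
Proof.
move=> cZ T0; apply/compact_near_coveringP => I F P FF loc.
pose Q (a b : R) := \near F, path_range Z a b `<=` P F.
have ballP z : path_range Z 0 T z -> exists2 e, 0 < e &
    \near F, forall w, `|w - z| <= e -> P F w.
  move=> /loc [[U W] /= [/nbhs_ballP[e /= e0 eU] FW] UW].
  exists (e / 2); first by rewrite divr_gt0.
  apply: filterS FW => i Wi w wz; apply: (UW (w, i)); split => //=.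
  apply: eU; rewrite -ball_normE /= distrC (le_lt_trans wz)//.
  by rewrite ltr_pdivrMr// ltr_pMr// ltr1n.
pose Q' a b := 0 <= a -> b <= T -> Q a b.
suff H : Q' 0 T by exact: H.
apply: interval_ind => //; rewrite /Q'.
- move=> a a0 aT; have [|e e0] := ballP (Z a).
    by left; exists a; rewrite ?a0.
  apply: filterS => i H z [[u ua ->]|[u /andP[au ua]]].
    by apply: H; rewrite -(le_anti ua) subrr normr0 ltW.
  by have := lt_le_trans au ua; rewrite ltxx.
- move=> a b c a0 ab bc cT Qab Qbc _ _.
  apply: filterS (filterI (Qab a0 (le_trans bc cT)) (Qbc (le_trans a0 ab) cT)).
  move=> i [H1 H2] z [[u /andP[au uc] ->]|[u /andP[au uc] ->]].
    have [ub|bu] := leP u b; first by apply: H1; left; exists u; rewrite ?au.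
    by apply: H2; left; exists u; rewrite ?(ltW bu).
  have [ub|bu] := leP u b; first by apply: H1; right; exists u; rewrite ?au.
  by apply: H2; right; exists u; rewrite ?bu.
- move=> a a0 aT; have [|e e0 FP] := ballP (Z a).
    by left; exists a; rewrite ?a0 ?ltW.
  have := cadlag_near_right cZ a0 e0; apply: filterS => c H _ _.
  apply: filterS FP => i + z [[u uac ->]|[u /andP[au uc] ->]]; apply.
    exact: H.
  apply: (@leftlim_dist_le _ a) => //; first exact: le_lt_trans au.
  by move=> x /andP[ax xu]; rewrite H// ax (le_trans (ltW xu)).
- move=> b b0 bT; have [|e e0 FP] := ballP (leftlim Z b).
    by right; exists b; rewrite ?b0.
  have [|d d0 FP'] := ballP (Z b); first by left; exists b; rewrite ?(ltW b0).
  have := cadlag_near_left cZ b0 e0; apply: filterS => c H c0 _.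
  apply: filterS (filterI FP FP') => i [H1 H2].
  have H1' u : c <= u < b -> P i (Z u) by move=> /H/H1.
  move=> z [[u /andP[cu + ->]]|[u /andP[cu + ->]]]; rewrite le_eqVlt => /predU1P[->|ub].
  + by apply: H2; rewrite subrr normr0 ltW.
  + by apply: H1'; rewrite cu.
  + by apply: H1; rewrite subrr normr0 ltW.
  + apply: H1; apply: (@leftlim_dist_le _ c) => //; first exact: le_lt_trans cu.
    by move=> x /andP[cx xu]; rewrite H// cx (lt_trans xu).
Qed.

End CadlagPaths.

Section CompactModulus.
Variables (R : realType) (S V : normedModType R).

Lemma compact_modulus (K : set S) (g : S -> V) (e : R) : compact K ->
  {within K, continuous g} -> 0 < e ->
  exists2 d : R, 0 < d &
    forall z w, K z -> K w -> `|z - w| <= d -> `|g z - g w| <= e.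
Proof.
move=> cK cg e0.
suff : \forall d \near (0 : R)^'+, K `<=` [set z | forall w, K z -> K w ->
    `|z - w| <= d -> `|g z - g w| <= e].
  move=> H; near (0 : R)^'+ => d; exists d; first by near: d; exact: nbhs_right_gt.
  move=> z w Kz; suff : K `<=` [set z | forall w, K z -> K w ->
    `|z - w| <= d -> `|g z - g w| <= e] by move=> /(_ z Kz w Kz).
  by near: d.
move/compact_near_coveringP: cK; apply => z Kz.
have e2 : 0 < e / 2 by rewrite divr_gt0.
move/subspace_continuousP: cg => /(_ z Kz)/cvgrPdist_le/(_ _ e2).
move=> /nbhs_ballP[r /= r0 H].
have r2 : 0 < r / 2 by rewrite divr_gt0.
exists (ball z (r / 2), [set d | d < r / 2]) => /=.
  by split; [exact: nbhsx_ballx|exact: nbhs_right_lt].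
move=> -[x d] /= [zx dr] w Kx Kw xw.
have zw : `|z - w| < r.
  rewrite -[_ - w](subrKA x) (le_lt_trans (ler_normD _ _))// [ltRHS]splitr.
  by rewrite ltrD// ?(le_lt_trans xw)//; move: zx; rewrite -ball_normE.
have xz : ball z r x.
  by apply: le_ball zx; rewrite ler_pdivrMr// ler_pMr// ler1n.
rewrite -[_ - g w](subrKA (g z)) (le_trans (ler_normD _ _))// [leRHS]splitr.
by rewrite lerD//; [rewrite distrC|]; apply: H => //; rewrite -ball_normE.
Unshelve. all: by end_near. Qed.

Lemma compact_image_bounded (K : set S) (g : S -> V) : compact K ->
  {within K, continuous g} ->
  exists2 M : R, 0 < M & forall z, K z -> `|g z| <= M.
Proof.
move=> cK cg; have /compact_bounded[M [_ H]] := continuous_compact cg cK.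
exists (`|M| + 1) => [|z Kz]; first by rewrite ltr_wpDl.
apply: (H (`|M| + 1)); first by rewrite (le_lt_trans (ler_norm M))// ltrDl.
by exists z.
Qed.

End CompactModulus.

Section DominatedModulus.
Variables (R : realType) (V V' : normedModType R).

Definition osc_le (U : normedModType R) (Z : R -> U) (u v d : R) : Prop :=
  forall x y, u <= x <= v -> u <= y <= v -> `|Z x - Z y| <= d.

(* On a short interval either [Z] is constant, and then so is [W], or [Z]
   oscillates by a definite amount; gluing finitely many short intervals, an
   interval on which [Z] oscillates little thus meets only two pieces on which
   [W] may vary. *)
Lemma dominated_modulus (Z : R -> V) (W : R -> V') (T e : R) :
  0 <= T -> 0 < e -> cadlag Z -> cadlag W ->
  (forall a b, 0 <= a -> a <= b -> (forall u, a <= u <= b -> Z u = Z a) ->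
    W a = W b) ->
  (forall b, 0 < b -> leftlim Z b = Z b -> leftlim W b = W b) ->
  exists2 d : R, 0 < d & forall u v, 0 <= u -> u <= v -> v <= T ->
    osc_le Z u v d -> `|W u - W v| <= e.
Proof.
move=> T0 e0 cZ cW Wconst Wjump.
(* These clauses are stable under gluing at [b]: an interval across [b] splits into two that touch
   [b], each allowed [e / 2]. If it also starts at [a], its first part is all of [[a, b]] and
   contributes 0, so that [e / 2] remains; likewise at the other end. *)
pose P a b := 0 <= a -> exists2 d, 0 < d & forall u v,
  a <= u -> u <= v -> v <= b -> osc_le Z u v d ->
  [/\ `|W u - W v| <= e, (u = a \/ v = b) -> `|W u - W v| <= e / 2 &
      u = a -> v = b -> W u = W v].
have e2 : 0 < e / 2 by rewrite divr_gt0.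
have e4 : 0 < e / 2 / 2 by rewrite divr_gt0.
have e2e : e / 2 <= e by rewrite ler_pdivrMr// ler_pMr// ler1n.
have base a b : a <= b ->
  (forall u v, a <= u <= b -> a <= v <= b -> `|W u - W v| <= e / 2) -> P a b.
  move=> ab H a0.
  have le u v : a <= u -> u <= v -> v <= b -> `|W u - W v| <= e / 2.
    by move=> au uv vb; apply: H; apply/andP; split=> //;
      [exact: le_trans vb|exact: le_trans uv].
  (* If [Z] is constant, so [W] has equal endpoint values; otherwise [d] is half of some nonzero
     [|Z w - Z a|], so that all of [[a, b]] never satisfies [osc_le] and the last clause is void. *)
  have [Zc|] := pselect (forall u, a <= u <= b -> Z u = Z a).
    exists 1 => // u v au uv vb _; split=> [|_|-> ->]; last exact: Wconst.
      by apply: le_trans e2e; exact: le.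
    exact: le.
  move=> /existsNP[w /not_implyP[wab /eqP]]; rewrite -subr_eq0 -normr_gt0 => Zw.
  exists (`|Z w - Z a| / 2); first by rewrite divr_gt0.
  move=> u v au uv vb ouv; split=> [|_|ua vb']; last 1 first.
  - have := ouv w a; rewrite ua vb' lexx ab wab => /(_ isT isT).
    by rewrite leNgt ltr_pdivrMr// ltr_pMr// ltr1n.
  - by rewrite (le_trans _ e2e)// le.
  - exact: le.
suff : P 0 T.
  move=> /(_ (lexx _))[d d0 H]; exists d => // u v u0 uv vT o.
  by have [] := H u v u0 uv vT o.
apply: interval_ind => //.
- move=> a _; exists 1 => // u v au uv va _.
  have -> : u = v by apply/le_anti; rewrite uv (le_trans va).
  by rewrite subrr normr0 !ltW.
- move=> a b c _ ab bc _ Pab Pbc a0.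
  have [d d0 H1] := Pab a0; have [d' d0' H2] := Pbc (le_trans a0 ab).
  exists (Num.min d d'); first by rewrite lt_min d0.
  move=> u v au uv vc o.
  have o1 : osc_le Z u v d.
    by move=> x y xu yu; rewrite (le_trans (o _ _ xu yu))// ge_min lexx.
  have o2 : osc_le Z u v d'.
    by move=> x y xu yu; rewrite (le_trans (o _ _ xu yu))// ge_min lexx orbT.
  have [vb|bv] := leP v b.
    have [h1 h2 h3] := H1 u v au uv vb o1; split=> //.
      move=> [ua|vc']; first by apply: h2; left.
      by apply: h2; right; apply/le_anti; rewrite vb vc' bc.
    by move=> ua vc'; apply: h3 => //; apply/le_anti; rewrite vb vc' bc.
  have [bu|ub] := leP b u.
    have [h1 h2 h3] := H2 u v bu uv vc o2; split=> //.
      move=> [ua|vc']; last by apply: h2; right.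
      by apply: h2; left; apply/le_anti; rewrite bu ua ab.
    by move=> ua vc'; apply: h3 => //; apply/le_anti; rewrite bu ua ab.
  have o1' : osc_le Z u b d.
    by move=> x y /andP[ux xb] /andP[uy yb]; apply: o1; rewrite ?ux ?uy /=;
      exact: le_trans (ltW bv).
  have o2' : osc_le Z b v d'.
    by move=> x y /andP[bx xv] /andP[by' yv]; apply: o2; rewrite ?xv ?yv andbT;
      exact: le_trans (ltW ub) _.
  have [_ h2 h3] := H1 u b au (ltW ub) (lexx _) o1'.
  have [_ h2' h3'] := H2 b v (lexx _) (ltW bv) vc o2'.
  have E : `|W u - W v| <= `|W u - W b| + `|W b - W v|.
    by rewrite -[in leLHS](subrKA (W b)) ler_normD.
  split=> [|[ua|vc']|ua vc'].
  + by rewrite (le_trans E)// [leRHS]splitr lerD//; [apply: h2; right|apply: h2'; left].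
  + by rewrite (h3 ua erefl); apply: h2'; left.
  + by rewrite -(h3' erefl vc'); apply: h2; right.
  + by rewrite (h3 ua erefl) (h3' erefl vc').
- move=> a a0 _; near=> c; apply: base => [|u v uac vac].
    by near: c; exact: nbhs_right_ge.
  have H : forall x, a <= x <= c -> `|W x - W a| <= e / 2 / 2.
    by near: c; exact: cadlag_near_right.
  rewrite -[_ - W v](subrKA (W a)) (le_trans (ler_normD _ _))// [leRHS]splitr.
  by rewrite lerD// ?(distrC (W a)) H.
- move=> b b0 _; near=> c.
  have cb : c < b by near: c; exact: nbhs_left_lt.
  have H : forall x, c <= x < b -> `|W x - leftlim W b| <= e / 2 / 2.
    by near: c; exact: cadlag_near_left.
  have HH x y : c <= x < b -> c <= y < b -> `|W x - W y| <= e / 2.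
    move=> xcb ycb; rewrite -[_ - W y](subrKA (leftlim W b)).
    by rewrite (le_trans (ler_normD _ _))// [leRHS]splitr lerD// ?(distrC _ (W y)) H.
  have [Zb|] := eqVneq (leftlim Z b) (Z b).
    apply: base => [|u v]; first exact: ltW.
    have Hb x : c <= x < b -> `|W x - W b| <= e / 2.
      move=> /H; rewrite -(Wjump b b0 Zb) => /le_trans; apply.
      by rewrite ler_pdivrMr// ler_pMr// ler1n.
    move=> /andP[cu +] /andP[cv +].
    rewrite le_eqVlt => /predU1P[->|ub]; rewrite le_eqVlt => /predU1P[->|vb].
    + by rewrite subrr normr0 ltW.
    + by rewrite distrC Hb ?cv.
    + by rewrite Hb ?cu.
    + by rewrite HH ?cu ?cv.
  (* Here [Z] jumps at [b], and [W] may jump too; taking half the jump for [d] excludes every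
     interval [[u, b]] with [u < b]. *)
  rewrite -subr_eq0 -normr_gt0 => jb c0.
  exists (`|leftlim Z b - Z b| / 2); first by rewrite divr_gt0.
  move=> u v cu uv; rewrite le_eqVlt => /predU1P[vb|vb] o; last first.
    have uvH : `|W u - W v| <= e / 2.
      by apply: HH; rewrite ?cu ?(le_lt_trans uv)// (le_trans cu).
    split=> //; first exact: (le_trans uvH).
    by move=> _ vb'; move: vb; rewrite vb' ltxx.
  move: uv; rewrite le_eqVlt => /predU1P[->|uv].
    by rewrite subrr normr0 !ltW.
  have := @leftlim_dist_le _ _ Z u b (Z b) (`|leftlim Z b - Z b| / 2) cZ b0.
  rewrite -{1}vb => /(_ uv) K.
  have : `|leftlim Z b - Z b| <= `|leftlim Z b - Z b| / 2.
    apply: K => x /andP[ux xb]; apply: o; rewrite ?vb ?lexx ?andbT ?ux ?ltW//.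
    by rewrite -vb.
  by rewrite leNgt ltr_pdivrMr// ltr_pMr// ltr1n.
Unshelve. all: by end_near. Qed.

End DominatedModulus.

(** * Integrals against paths of finite variation *)

Section BoundedOperatorFacts.
Variables (R : realType) (V W : normedModType R).

Lemma blin_normP (T : blin V W) (x : V) : `|T x| <= `|T| * `|x|.
Proof. exact: opnormP. Qed.

Lemma blin_norm_le (T : blin V W) (M : R) : 0 <= M ->
  (forall x, `|T x| <= M * `|x|) -> `|T| <= M.
Proof.
move=> M0 TM; apply: opnorm_le => x x1.
by rewrite (le_trans (TM x))// ler_piMr.
Qed.

Lemma blinD (T S : blin V W) x : (T + S) x = T x + S x. Proof. by []. Qed.
Lemma blinB (T S : blin V W) x : (T - S) x = T x - S x. Proof. by []. Qed.
Lemma blinZ k (T : blin V W) x : (k *: T) x = k *: T x. Proof. by []. Qed.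

End BoundedOperatorFacts.

Section SequenceLimits.
Variables (R : realType) (W : normedModType R).

Lemma lim_dist_le (u : nat -> W) (l y : W) (M : R) : u @ \oo --> l ->
  (forall e, 0 < e -> \forall n \near \oo, `|u n - y| <= M + e) ->
  `|l - y| <= M.
Proof.
move=> ul H; apply/ler_addgt0Pr => e e0.
have e2 : 0 < e / 2 by rewrite divr_gt0.
have /cvgrPdist_le/(_ _ e2) ul' := ul.
have [n [/= h1 h2]] := filter_ex (filterI ul' (H _ e2)).
rewrite -[l - y](subrKA (u n)) (le_trans (ler_normD _ _))//.
by rewrite [e in leRHS]splitr addrA addrC lerD.
Qed.

End SequenceLimits.

Lemma cauchy_seq_cvg (R : realType) (W : completeNormedModType R) (u : nat -> W) :
  (forall e, 0 < e -> exists x, \forall n \near \oo, `|u n - x| <= e) ->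
  cvg (u @ \oo).
Proof.
move=> H; apply/cauchy_cvgP/cauchy_exP => e e0.
have [|x Hx] := H (e / 2); first by rewrite divr_gt0.
exists x; rewrite /nbhs /=; apply: filterS Hx => n nx.
rewrite /= -ball_normE /= distrC (le_lt_trans nx)//.
by rewrite ltr_pdivrMr// ltr_pMr// ltr1n.
Qed.

Section LocalIntegral.
Variables (R : realType) (V W : normedModType R).
Variables (psi : R -> blin V W) (g : R -> V) (mu : R -> R).

Definition regulated : Prop :=
  (forall a e, 0 <= a -> 0 < e -> \forall c \near a^'+,
     forall x y, a <= x < c -> a <= y < c -> `|psi x - psi y| <= e) /\
  (forall b e, 0 < b -> 0 < e -> \forall c \near b^'-,
     forall x y, c <= x < b -> c <= y < b -> `|psi x - psi y| <= e).

Definition dominates : Prop :=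
  forall u v, 0 <= u -> u <= v -> `|g v - g u| <= mu v - mu u.

(* Characterizes the primitive of [psi(t-) dg(t)] up to a constant, for [g] of
   variation dominated by [mu]. *)
Definition local_integral (J : R -> W) : Prop :=
  forall u v B e, 0 <= u -> u <= v -> (forall x, u <= x < v -> `|psi x - B| <= e) ->
  `|J v - J u - B (g v - g u)| <= e * (mu v - mu u).

End LocalIntegral.

Section LocalIntegralExistence.
Variables (R : realType) (V : normedModType R) (W : completeNormedModType R).
Variables (psi : R -> blin V W) (g : R -> V) (mu : R -> R).

(** The inequality of [local_integral] on [[a, b]], with the rate [e] raised by [eps]; this slack
    allows the integrand to be frozen on each of finitely many pieces. *)
Let approx (eps : R) (J : R -> W) (a b : R) : Prop :=
  forall u v B e, a <= u -> u <= v -> v <= b ->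
  (forall x, u <= x < v -> `|psi x - B| <= e) ->
  `|J v - J u - B (g v - g u)| <= (e + eps) * (mu v - mu u).

Hypotheses (psi_reg : regulated psi) (gmu : dominates g mu).

Let approx_ex (eps T : R) : 0 <= T -> 0 < eps -> exists J, approx eps J 0 T.
Proof.
move=> T0 eps0.
pose P a b := 0 <= a -> exists J, approx eps J a b.
have base a b : a < b ->
    (forall x y, a <= x < b -> a <= y < b -> `|psi x - psi y| <= eps) -> P a b.
  move=> ab H a0; exists (fun x => psi a (g x)) => u v B e au uv vb HB.
  move: uv; rewrite le_eqVlt => /predU1P[->|uv].
    by rewrite !subrr linear0 subr0 normr0 mulr0.
  have -> : psi a (g v) - psi a (g u) - B (g v - g u) = (psi a - B) (g v - g u).
    by rewrite blinB !linearB.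
  rewrite (le_trans (blin_normP _ _))//; apply: ler_pM => //; last first.
    by apply: gmu; [exact: le_trans au|exact: ltW].
  rewrite -[psi a - B](subrKA (psi u)) (le_trans (ler_normD _ _))// addrC lerD//.
    by rewrite HB ?lexx.
  by apply: H; rewrite ?lexx ?ab ?au// (lt_le_trans uv).
suff : P 0 T by apply.
apply: interval_ind => //.
- move=> a _; exists (fun=> 0) => u v B e au uv va _.
  have -> : u = v by apply/le_anti; rewrite uv (le_trans va).
  by rewrite !subrr linear0 subr0 normr0 mulr0.
- move=> a b c _ ab bc _ Pab Pbc a0.
  have [J HJ] := Pab a0; have [J' HJ'] := Pbc (le_trans a0 ab).
  exists (fun x => if x <= b then J x else J b + J' x - J' b) => u v B e au uv vc HB.
  have [vb|bv] := leP v b; first by rewrite (le_trans uv vb); exact: HJ.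
  have [ub|bu] := leP u b; last first.
    have -> : J b + J' v - J' b - (J b + J' u - J' b) = J' v - J' u.
      by module R W.
    by apply: HJ' => //; exact: ltW.
  have -> : J b + J' v - J' b - J u - B (g v - g u) =
      (J b - J u - B (g b - g u)) + (J' v - J' b - B (g v - g b)).
    by rewrite !linearB; module R W.
  rewrite (le_trans (ler_normD _ _))//.
  have -> : (e + eps) * (mu v - mu u) =
      (e + eps) * (mu b - mu u) + (e + eps) * (mu v - mu b) by ring.
  rewrite lerD//.
    apply: HJ => // x /andP[ux xb]; apply: HB.
    by rewrite ux (lt_trans xb bv).
  apply: HJ' => //; first exact: ltW.
  move=> x /andP[bx xv]; apply: HB.
  by rewrite xv (le_trans ub bx).
- move=> a a0 _; near=> c; apply: base; first by near: c; exact: nbhs_right_gt.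
  by near: c; exact: psi_reg.1.
- move=> b b0 _; near=> c; apply: base; first by near: c; exact: nbhs_left_lt.
  by near: c; exact: psi_reg.2.
Unshelve. all: by end_near. Qed.

(** On a short interval both increments are close to [psi a (g b - g a)]. The errors are
    proportional to increments of [mu], hence add up to a bound independent of the number of
    pieces. *)
Let approx_dist (eps eps' T : R) J J' : 0 <= T -> 0 < eps -> 0 < eps' ->
  approx eps J 0 T -> approx eps' J' 0 T ->
  `|(J T - J 0) - (J' T - J' 0)| <= 2 * (eps + eps') * (mu T - mu 0).
Proof.
move=> T0 e0 e0' HJ HJ'.
pose P a b := 0 <= a -> b <= T ->
  `|(J b - J a) - (J' b - J' a)| <= 2 * (eps + eps') * (mu b - mu a).
have base a b : a < b -> (forall x y, a <= x < b -> a <= y < b ->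
    `|psi x - psi y| <= Num.min eps eps') -> P a b.
  move=> ab H a0 bT.
  have Hx x : a <= x < b -> `|psi x - psi a| <= Num.min eps eps'.
    by move=> xab; apply: H; rewrite ?lexx.
  have h1 : `|J b - J a - psi a (g b - g a)| <= (eps + eps) * (mu b - mu a).
    apply: HJ; rewrite ?(ltW ab)// => x /Hx /le_trans; apply.
    by rewrite ge_min lexx.
  have h2 : `|J' b - J' a - psi a (g b - g a)| <= (eps' + eps') * (mu b - mu a).
    apply: HJ'; rewrite ?(ltW ab)// => x /Hx /le_trans; apply.
    by rewrite ge_min lexx orbT.
  have -> : (J b - J a) - (J' b - J' a) = (J b - J a - psi a (g b - g a)) -
      (J' b - J' a - psi a (g b - g a)) by module R W.
  rewrite (le_trans (ler_normB _ _))// (le_trans (lerD h1 h2))// -mulrDl.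
  by rewrite le_eqVlt; apply/orP; left; apply/eqP; ring.
suff : P 0 T by apply.
apply: interval_ind => //.
- by move=> a _ _; rewrite !subrr normr0 mulr0.
- move=> a b c _ ab bc _ Pab Pbc a0 cT.
  have -> : (J c - J a) - (J' c - J' a) =
    ((J b - J a) - (J' b - J' a)) + ((J c - J b) - (J' c - J' b)) by module R W.
  rewrite (le_trans (ler_normD _ _))//.
  have -> : 2 * (eps + eps') * (mu c - mu a) = 2 * (eps + eps') * (mu b - mu a)
    + 2 * (eps + eps') * (mu c - mu b) by ring.
  by rewrite lerD// ?Pab ?Pbc// (le_trans bc, le_trans a0).
- move=> a a0 _; near=> c; apply: base; first by near: c; exact: nbhs_right_gt.
  by near: c; apply: psi_reg.1 => //; rewrite lt_min e0.
- move=> b b0 _; near=> c; apply: base; first by near: c; exact: nbhs_left_lt.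
  by near: c; apply: psi_reg.2 => //; rewrite lt_min e0.
Unshelve. all: by end_near. Qed.

(** Approximate primitives with slack [1 / (k + 1)] on [[0, k + 1]], one sequence for all times, are
    Cauchy at each time once normalized at 0, and the inequality passes to the limit. *)
Lemma local_integral_ex : exists J, J 0 = 0 /\ local_integral psi g mu J.
Proof.
have /choice[J HJ] k : exists J, approx k.+1%:R^-1 J 0 k.+1%:R.
  by apply: approx_ex => //; rewrite invr_gt0.
have mu_ge u v : 0 <= u -> u <= v -> 0 <= mu v - mu u.
  by move=> u0 uv; rewrite (le_trans _ (gmu u0 uv)).
have approxW k eps T : k.+1%:R^-1 <= eps -> 0 <= T -> T <= k.+1%:R -> approx eps (J k) 0 T.
  move=> ke T0 Tk u v B e u0 uv vT HB.
  rewrite (le_trans (HJ k u v B e u0 uv (le_trans vT Tk) HB))//.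
  by rewrite ler_wpM2r ?mu_ge// lerD2l.
have large (eps T : R) : 0 < eps -> \forall k \near \oo, k.+1%:R^-1 <= eps /\ T <= k.+1%:R.
  move=> eps0; near=> k.
  have k1 : eps^-1 + `|T| <= k.+1%:R.
    rewrite (@le_trans _ _ k%:R) ?ler_nat//; near: k.
    exact: nbhs_infty_ger.
  split; last by rewrite (le_trans (ler_norm T))// (le_trans _ k1)// lerDr invr_ge0 ltW.
  by rewrite -[leRHS]invrK lef_pV2 ?posrE ?invr_gt0// (le_trans _ k1)// lerDl.
have cJ t : 0 <= t -> cvg ((fun k => J k t - J k 0) @ \oo).
  move=> t0; apply: cauchy_seq_cvg => e e0.
  have m0 : 0 < mu t - mu 0 + 1 by rewrite ltr_wpDl// mu_ge.
  pose eps := e / 4 / (mu t - mu 0 + 1).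
  have eps0 : 0 < eps by rewrite !divr_gt0.
  have [N _ HN] := large eps t eps0.
  exists (J N t - J N 0), N => // k /= Nk.
  have [N1 N2] := HN N (leqnn N); have [k1 k2] := HN k Nk.
  rewrite (le_trans (approx_dist t0 eps0 eps0 (approxW _ _ _ k1 t0 k2)
    (approxW _ _ _ N1 t0 N2)))//.
  have -> : 2 * (eps + eps) * (mu t - mu 0) =
      e * ((mu t - mu 0) / (mu t - mu 0 + 1)).
    by rewrite /eps; field; rewrite gt_eqF.
  apply: ler_piMr; first exact: ltW.
  by rewrite ler_pdivrMr// mul1r lerDl.
exists (fun t => lim ((fun k => J k t - J k 0) @ \oo)); split.
  by rewrite (_ : (fun _ => _) = cst 0) ?lim_cst//; apply/funext => k; rewrite subrr.
move=> u v B e u0 uv HB.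
have v0 := le_trans u0 uv.
apply: (@lim_dist_le _ _ (fun k => (J k v - J k 0) - (J k u - J k 0))).
  by apply: cvgB; exact: cJ.
move=> d d0; have m0 : 0 < mu v - mu u + 1 by rewrite ltr_wpDl// mu_ge.
have := large (d / (mu v - mu u + 1)) v (divr_gt0 d0 m0).
apply: filterS => k [k1 k2].
have -> : J k v - J k 0 - (J k u - J k 0) - B (g v - g u) =
  J k v - J k u - B (g v - g u) by module R W.
rewrite (le_trans (approxW _ _ _ k1 v0 k2 u v B e u0 uv (lexx _) HB))//.
rewrite mulrDl lerD2l mulrAC ler_pdivrMr// ler_pM2l//.
by rewrite lerDl.
Unshelve. all: by end_near. Qed.

End LocalIntegralExistence.

Section CadlagCalculus.
Variable R : realType.

Lemma cadlag_intro (V : normedModType R) (Z l : R -> V) :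
  (forall a e, 0 <= a -> 0 < e -> \forall x \near a^'+, `|Z x - Z a| <= e) ->
  (forall b e, 0 < b -> 0 < e -> \forall x \near b^'-, `|Z x - l b| <= e) ->
  cadlag Z /\ forall b, 0 < b -> leftlim Z b = l b.
Proof.
move=> rZ lZ; split; last by move=> b b0; apply: leftlim_unique => e; exact: lZ.
split=> [a a0|b b0].
  apply/cvgrPdist_le => e e0; have := rZ a e a0 e0.
  by apply: filterS => x; rewrite distrC.
apply/cvg_ex; exists (l b); apply/cvgrPdist_le => e e0; have := lZ b e b0 e0.
by apply: filterS => x; rewrite distrC.
Qed.

Lemma cadlag_bounded (V : normedModType R) (Z : R -> V) T : cadlag Z -> 0 <= T ->
  exists2 M : R, 0 < M & forall z, path_range Z 0 T z -> `|z| <= M.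
Proof.
move=> cZ T0; apply: (@compact_image_bounded _ _ _ _ id).
  exact: compact_path_range.
by apply: continuous_subspaceT => x; exact: cvg_id.
Qed.

Definition modulus_on (U V : normedModType R) (K : set U) (g : U -> V) : Prop :=
  forall e : R, 0 < e -> exists2 d : R, 0 < d &
    forall z w, K z -> K w -> `|z - w| <= d -> `|g z - g w| <= e.

Lemma path_range_val (V : normedModType R) (Z : R -> V) T u :
  0 <= u <= T -> path_range Z 0 T (Z u).
Proof. by move=> uT; left; exists u. Qed.

Lemma path_range_leftlim (V : normedModType R) (Z : R -> V) T u :
  0 < u <= T -> path_range Z 0 T (leftlim Z u).
Proof. by move=> uT; right; exists u. Qed.

Lemma cadlag_comp (U V : normedModType R) (Z : R -> U) (g : U -> V) :
  cadlag Z -> (forall T, 0 <= T -> modulus_on (path_range Z 0 T) g) ->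
  cadlag (g \o Z) /\ forall b, 0 < b -> leftlim (g \o Z) b = g (leftlim Z b).
Proof.
move=> cZ mg; apply: cadlag_intro => [a e a0 e0|b e b0 e0].
  have a10 : 0 <= a + 1 by rewrite addr_ge0 ?ler01.
  have [d d0 H] := mg _ a10 e e0.
  near=> x; have ax : a < x by near: x; exact: nbhs_right_gt.
  apply: H.
  - apply: path_range_val; rewrite (le_trans a0 (ltW ax)) /=.
    by near: x; apply: nbhs_right_le; rewrite ltrDl ltr01.
  - by apply: path_range_val; rewrite a0 lerDl ler01.
  - have : forall y, a <= y <= x -> `|Z y - Z a| <= d.
      by near: x; exact: cadlag_near_right.
    by apply; rewrite (ltW ax) lexx.
have [d d0 H] := mg _ (ltW b0) e e0.
near=> x; have xb : x < b by near: x; exact: nbhs_left_lt.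
apply: H.
- apply: path_range_val; rewrite (ltW xb) andbT.
  by near: x; exact: nbhs_left_ge.
- by apply: path_range_leftlim; rewrite b0 lexx.
- have : forall y, x <= y < b -> `|Z y - leftlim Z b| <= d.
    by near: x; exact: cadlag_near_left.
  by apply; rewrite lexx.
Unshelve. all: by end_near. Qed.

Lemma cadlag_regulated (V W : normedModType R) (psi : R -> blin V W) :
  cadlag psi -> regulated psi.
Proof.
move=> cp; split=> [a e a0 e0|b e b0 e0].
  have := cadlag_near_right cp a0 (divr_gt0 e0 (ltr0Sn R 1)).
  apply: filterS => c H x y /andP[ax xc] /andP[ay yc].
  rewrite -[_ - psi y](subrKA (psi a)) (le_trans (ler_normD _ _))// [leRHS]splitr.
  by rewrite lerD// ?(distrC (psi a)) H// ?ax ?ay ltW.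
have := cadlag_near_left cp b0 (divr_gt0 e0 (ltr0Sn R 1)).
apply: filterS => c H x y xb yb.
rewrite -[_ - psi y](subrKA (leftlim psi b)) (le_trans (ler_normD _ _))//.
by rewrite [leRHS]splitr lerD// ?(distrC _ (psi y)) H.
Qed.

Section LocalIntegralPaths.
Variables (V W : normedModType R) (psi : R -> blin V W) (g : R -> V).
Variables (mu : R -> R) (J : R -> W).
Hypotheses (cpsi : cadlag psi) (cg : cadlag g) (gmu : dominates g mu).
Hypothesis JP : local_integral psi g mu J.

Let mu_ge u v : 0 <= u -> u <= v -> 0 <= mu v - mu u.
Proof. by move=> u0 uv; rewrite (le_trans _ (gmu u0 uv)). Qed.

Lemma local_integral_dist (M T : R) u v :
  (forall x, 0 <= x <= T -> `|psi x| <= M) -> 0 <= u -> u <= v -> v <= T ->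
  `|J v - J u| <= M * (mu v - mu u).
Proof.
move=> HM u0 uv vT; have := @JP u v 0 M u0 uv; rewrite subr0; apply.
move=> x /andP[ux xv]; rewrite subr0 HM// (le_trans u0 ux)/=.
exact: le_trans (ltW xv) vT.
Qed.

(** Freezing the integrand at [psi a] after [a], and at its left limit before [b], leaves an error
    which is a small oscillation of [psi] times a bounded increment of [mu]. *)
Lemma local_integral_cadlag : cadlag J /\ forall b, 0 < b ->
  leftlim J b = J b - leftlim psi b (g b - leftlim g b).
Proof.
apply: (@cadlag_intro _ _ (fun b => J b - leftlim psi b (g b - leftlim g b))).
  move=> a e a0 e0.
  pose k := `|psi a| + (mu (a + 1) - mu a) + 1.
  have ma : 0 <= mu (a + 1) - mu a by rewrite mu_ge// lerDl ler01.
  have k0 : 0 < k by rewrite ltr_wpDl// addr_ge0.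
  have ek : 0 < e / k by rewrite divr_gt0.
  near=> x.
  have ax : a <= x by near: x; exact: nbhs_right_ge.
  have xa1 : x <= a + 1 by near: x; apply: nbhs_right_le; rewrite ltrDl ltr01.
  have Hp : forall y, a <= y <= x -> `|psi y - psi a| <= e / k.
    by near: x; exact: cadlag_near_right.
  have Hg : forall y, a <= y <= x -> `|g y - g a| <= e / k.
    by near: x; exact: cadlag_near_right.
  have := @JP a x (psi a) (e / k) a0 ax.
  move=> /(_ (fun y H => Hp y (andb_true_intro (conj (andP H).1 (ltW (andP H).2))))) H.
  have -> : J x - J a = J x - J a - psi a (g x - g a) + psi a (g x - g a).
    by module R W.
  rewrite (le_trans (ler_normD _ _))// (le_trans (lerD H (blin_normP _ _)))//.
  have h1 : e / k * (mu x - mu a) <= e / k * (mu (a + 1) - mu a).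
    rewrite ler_pM2l// lerD2r -subr_ge0 mu_ge//; exact: le_trans ax.
  have h2 : `|psi a| * `|g x - g a| <= `|psi a| * (e / k).
    by rewrite ler_wpM2l// Hg// ax lexx.
  rewrite (le_trans (lerD h1 h2))// [X in _ + X]mulrC -mulrDr mulrAC.
  by rewrite ler_pdivrMr// ler_pM2l// addrC /k lerDl.
move=> b e b0 e0.
pose k := `|leftlim psi b| + (mu b - mu 0) + 1.
have mb : 0 <= mu b - mu 0 by rewrite mu_ge// ltW.
have k0 : 0 < k by rewrite ltr_wpDl// addr_ge0.
have ek : 0 < e / k by rewrite divr_gt0.
near=> x.
have x0 : 0 <= x by near: x; exact: nbhs_left_ge.
have xb : x < b by near: x; exact: nbhs_left_lt.
have Hp : forall y, x <= y < b -> `|psi y - leftlim psi b| <= e / k.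
  by near: x; exact: cadlag_near_left.
have Hg : forall y, x <= y < b -> `|g y - leftlim g b| <= e / k.
  by near: x; exact: cadlag_near_left.
have H := JP x0 (ltW xb) Hp.
have -> : J x - (J b - leftlim psi b (g b - leftlim g b)) =
    - (J b - J x - leftlim psi b (g b - g x)) +
    leftlim psi b (g x - leftlim g b).
  have LB y z : leftlim psi b (y - z) = leftlim psi b y - leftlim psi b z.
    exact: linearB.
  by rewrite !LB; module R W.
rewrite (le_trans (ler_normD _ _))// normrN (le_trans (lerD H (blin_normP _ _)))//.
have h1 : e / k * (mu b - mu x) <= e / k * (mu b - mu 0).
  by rewrite ler_pM2l// lerD2l lerN2 -subr_ge0 mu_ge.
have h2 : `|leftlim psi b| * `|g x - leftlim g b| <= `|leftlim psi b| * (e / k).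
  by rewrite ler_wpM2l// Hg// xb lexx.
rewrite (le_trans (lerD h1 h2))// [X in _ + X]mulrC -mulrDr mulrAC.
by rewrite ler_pdivrMr// ler_pM2l// addrC /k lerDl.
Unshelve. all: by end_near. Qed.

End LocalIntegralPaths.

End CadlagCalculus.

(** * The variation function of a path *)

Section VariationFunction.
Variables (R : realType) (V : normedModType R) (g : R -> V).

Fixpoint vsum (a : R) (s : seq R) : R :=
  if s is x :: s' then `|g x - g a| + vsum x s' else 0.

Lemma vvariationE a b s : vvariation a b g s = vsum a s.
Proof.
elim: s a => [|x s IH] a; first by rewrite /vvariation big_geq.
rewrite /= -IH /vvariation /= big_nat_recl//=.
Qed.

Lemma vsum_cat a s t : vsum a (s ++ t) = vsum a s + vsum (last a s) t.
Proof. by elim: s a => [|x s IH] a /=; rewrite ?add0r// IH addrA. Qed.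

(* Inserting [a] and a nearby [b > a] in a partition: the increment over [[a, b]]
   is small by right-continuity, which makes the variation right-continuous. *)
Lemma vsum_split x s a c : path <%R x s -> last x s = c -> x <= a -> a < c ->
  exists2 y, a < y & forall b, a < b -> b < y -> exists s1 s2,
    [/\ itv_partition x a s1, itv_partition b c s2 &
        vsum x s <= vsum x s1 + `|g b - g a| + vsum b s2].
Proof.
elim: s x => [|z s IH] x /=; first by move=> _ -> ca /(le_lt_trans ca); rewrite ltxx.
move=> /andP[xz zs] lzs xa ac; have [za|az] := leP z a.
  have [y ay H] := IH z zs lzs za ac; exists y => // b ab yb.
  have [s1 [s2 [p1 p2 le12]]] := H b ab yb; exists (z :: s1), s2; split=> //.
    by case: p1 => p1 l1; split=> //=; rewrite xz.
  by rewrite /= -!addrA lerD2l !addrA.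
exists z => // b ab bz.
exists (if x == a then [::] else [:: a]), (z :: s); split.
- case: eqVneq => [->|xna]; first by split.
  by split=> //=; rewrite andbT lt_neqAle xna.
- by split=> //=; rewrite ?bz ?lzs.
- have -> : vsum x (if x == a then [::] else [:: a]) = `|g a - g x|.
    by case: eqVneq => [->|_] /=; rewrite ?subrr ?normr0 ?addr0.
  rewrite /= addrA lerD2r.
  have -> : g z - g x = (g a - g x) + (g b - g a) + (g z - g b) by module R V.
  by rewrite (le_trans (ler_normD _ _))// lerD2r ler_normD.
Qed.

Hypothesis gfv : finite_variation g.

Definition varfun (t : R) : R := fine (total_vvariation 0 t g).

Lemma itv_partition_ex (t : R) : 0 <= t -> exists s, itv_partition 0 t s.
Proof.
rewrite le_eqVlt => /predU1P[<-|t0]; first by exists [::]; split.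
by exists [:: t]; exact: itv_partition1.
Qed.

Lemma varfunE (t : R) : 0 <= t -> total_vvariation 0 t g = (varfun t)%:E.
Proof.
move=> t0; rewrite fineK// fin_numE; apply/andP; split; last first.
  by rewrite -ltey; exact: gfv.
have [s ps] := itv_partition_ex t0.
rewrite -ltNye (@lt_le_trans _ _ (vvariation 0 t g s)%:E) ?ltNyr//.
by apply: ereal_sup_ubound; exists s.
Qed.

Lemma vsum_le_varfun t s : itv_partition 0 t s -> vsum 0 s <= varfun t.
Proof.
move=> ps; rewrite -lee_fin -varfunE; last exact: itv_partition_le ps.
by apply: ereal_sup_ubound; exists s => //; rewrite vvariationE.
Qed.

Lemma varfun_le (t M : R) : 0 <= t ->
  (forall s, itv_partition 0 t s -> vsum 0 s <= M) -> varfun t <= M.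
Proof.
move=> t0 H; rewrite -lee_fin -varfunE//.
apply: ge_ereal_sup => _ [s ps <-]; rewrite lee_fin vvariationE.
exact: H.
Qed.

Lemma varfun_approx (t e : R) : 0 <= t -> 0 < e ->
  exists2 s, itv_partition 0 t s & varfun t - e <= vsum 0 s.
Proof.
move=> t0 e0; apply: contrapT => H.
have : varfun t <= varfun t - e.
  apply: varfun_le => // s ps; rewrite leNgt; apply/negP => lts.
  by apply: H; exists s => //; exact: ltW.
by rewrite leNgt ltrBlDr ltrDl e0.
Qed.

Lemma varfun_add (u v : R) s : 0 <= u -> itv_partition u v s ->
  varfun u + vsum u s <= varfun v.
Proof.
move=> u0 ps; rewrite -lerBrDr; apply: varfun_le => // s0 ps0.
rewrite lerBrDr; have := vsum_cat 0 s0 s.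
have -> : last 0 s0 = u by case: ps0 => _ /eqP.
by move=> <-; apply: vsum_le_varfun; exact: itv_partition_cat ps0 ps.
Qed.

Lemma varfun_dominates : dominates g varfun.
Proof.
move=> u v u0; rewrite le_eqVlt => /predU1P[->|uv].
  by rewrite !subrr normr0.
rewrite lerBrDl; have := varfun_add u0 (itv_partition1 uv).
by rewrite /= addr0.
Qed.

Lemma varfun_nondecreasing (u v : R) : 0 <= u -> u <= v -> varfun u <= varfun v.
Proof.
by move=> u0 uv; rewrite -subr_ge0 (le_trans _ (varfun_dominates u0 uv)).
Qed.

(** A partition of [[0, a + 1]] attaining the variation up to [e / 2] is cut at [a] and [b]. Its
    outer parts are bounded by the variations over [[0, a]] and [[b, a + 1]], and the middle
    increment is at most [e / 2]. *)
Lemma varfun_right (a e : R) : cadlag g -> 0 <= a -> 0 < e ->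
  \forall b \near a^'+, varfun b - varfun a <= e.
Proof.
move=> cg a0 e0; have e2 : 0 < e / 2 by rewrite divr_gt0.
have ac : a < a + 1 by rewrite ltrDl.
have [s [ps /eqP ls] lts] := varfun_approx (le_trans a0 (ltW ac)) e2.
have [y ay H] := vsum_split ps ls a0 ac.
near=> b.
have ab : a < b by near: b; exact: nbhs_right_gt.
have yb : b < y by near: b; exact: nbhs_right_lt.
have gab : forall x, a <= x <= b -> `|g x - g a| <= e / 2.
  by near: b; exact: cadlag_near_right.
have [s1 [s2 [p1 p2 le12]]] := H b ab yb.
have h1 := vsum_le_varfun p1.
have h2 := varfun_add (le_trans a0 (ltW ab)) p2.
have h3 : `|g b - g a| <= e / 2 by rewrite gab// (ltW ab) lexx.
by lra.
Unshelve. all: by end_near. Qed.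

Lemma varfun_cumulative : cadlag g ->
  exists mu : cumulative R R,
    forall r, total_vvariation 0 (Num.max 0 r) g = (mu r)%:E.
Proof.
move=> cg; pose f r := varfun (Num.max 0 r).
have max0 (r : R) : 0 <= Num.max 0 r by rewrite le_max lexx.
have nd : nondecreasing f.
  move=> x y xy; apply: varfun_nondecreasing => //.
  by rewrite ge_max le_max lexx /= le_max xy orbT.
have rc : right_continuous f.
  move=> x; apply/cvgrPdist_le => e e0.
  have [x0|x0] := ltP x 0.
    near=> y; have y0 : y < 0 by near: y; exact: nbhs_right_lt.
    by rewrite /f (max_l (ltW x0)) (max_l (ltW y0)) subrr normr0 ltW.
  have := varfun_right cg x0 e0; move=> H; near=> y.
  have xy : x < y by near: y; exact: nbhs_right_gt.
  rewrite /f !max_r// ?(le_trans x0 (ltW xy))// distrC ger0_norm.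
    by near: y.
  by rewrite subr_ge0 varfun_nondecreasing// ltW.
pose m := isCumulative.Build R _ R f nd rc.
by exists (HB.pack_for (cumulative R R) f m) => r /=; rewrite varfunE.
Unshelve. all: by end_near. Qed.

End VariationFunction.

Lemma dominates_finite_variation (R : realType) (V : normedModType R)
    (g : R -> V) (mu : R -> R) (M : R -> R) :
  (forall T u v, 0 <= u -> u <= v -> v <= T -> `|g v - g u| <= M T * (mu v - mu u)) ->
  finite_variation g.
Proof.
move=> H t t0; apply: (@le_lt_trans _ _ (M t * (mu t - mu 0))%:E); last exact: ltry.
apply: ge_ereal_sup => _ [s ps <-]; rewrite lee_fin vvariationE.
case: ps => ps /eqP ls.
have K x s' : 0 <= x -> path <%R x s' -> last x s' = t ->
    vsum g x s' <= M t * (mu t - mu x).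
  elim: s' x => [|z s' IH] x x0 /=; first by move=> _ ->; rewrite subrr mulr0.
  move=> /andP[xz zs] lz.
  have pz : itv_partition z t s' by split; rewrite ?lz.
  have zt := itv_partition_le pz.
  have -> : M t * (mu t - mu x) = M t * (mu z - mu x) + M t * (mu t - mu z) by ring.
  rewrite lerD//; first by rewrite H// ltW.
  by apply: IH => //; exact: le_trans x0 (ltW xz).
exact: K.
Qed.

(** * Sums over the cells of a partition *)

Section Tags.
Variables (R : realType) (U : normedModType R).
Implicit Types (p : time_partition R) (Z : R -> U) (T : R).

Lemma pt_lt p i j : (i < j)%N -> p i < p j.
Proof.
elim: j => // j IH; rewrite ltnS leq_eqVlt => /predU1P[->|/IH ij].
  exact: pt_increasing.
exact: lt_trans ij (pt_increasing p j).
Qed.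

Lemma pt_le p i j : (i <= j)%N -> p i <= p j.
Proof. by rewrite leq_eqVlt => /predU1P[->//|/pt_lt/ltW]. Qed.

Lemma pt_ge0 p i : 0 <= p i.
Proof. by rewrite -(pt0 p) pt_le. Qed.

Lemma ncells_ex p T : exists N, T <= p N /\ forall i, (i < N)%N -> p i < T.
Proof.
have [n Tn] : exists n, T <= p n.
  by have /cvgryPge/(_ T)/filter_ex[n Tn] := pt_cvg p; exists n.
have ex : exists n, T <= p n by exists n.
case: (ex_minnP ex) => N TN minN; exists N; split=> // i iN.
by rewrite ltNge; apply/negP => /minN; rewrite leqNgt iN.
Qed.

(** The cells with index below [ncells p T] are exactly those that start before [T]. *)
Definition ncells p T : nat := projT1 (cid (ncells_ex p T)).

Lemma ncells_ge p T : T <= p (ncells p T).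
Proof. by rewrite /ncells; case: cid => N /= []. Qed.

Lemma ncells_lt p T i : (i < ncells p T)%N -> p i < T.
Proof. by rewrite /ncells; case: cid => N /= [] _; exact. Qed.

Lemma sum_cellsE (V : normedModType R) (F : nat -> V) N :
  (forall i, (N <= i)%N -> F i = 0) -> sum_cells F = \sum_(i < N) F i.
Proof.
move=> F0; rewrite /sum_cells; apply/cvg_lim => //.
apply: (@cvg_near_cst _ _ _ _ _ eventually_filter).
near=> n; have Nn : (N <= n)%N by near: n; exact: nbhs_infty_ge.
rewrite (big_cat_nat _ Nn)//= big_mkord.
have -> : \sum_(N <= i < n) F i = 0.
  by rewrite big_nat_cond big1// => i /andP[/andP[Ni _] _]; exact: F0.
by rewrite addr0.
Unshelve. all: by end_near. Qed.

(* [tau i] is the time of the large jump in the [i]-th cell, if there is one. *)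
Definition tagged Z p T (eta : R) (tau : nat -> R) : Prop :=
  forall i, p i < T ->
  [/\ p i < tau i <= Num.min (p i.+1) T,
      forall u v, p i <= u < tau i -> p i <= v < tau i -> `|Z u - Z v| <= eta &
      forall u v, tau i <= u <= Num.min (p i.+1) T ->
        tau i <= v <= Num.min (p i.+1) T -> `|Z u - Z v| <= eta].

Lemma tagged_weaken Z p T (eta eta' : R) tau : eta <= eta' ->
  tagged Z p T eta tau -> tagged Z p T eta' tau.
Proof.
move=> ed tg i iT; have [h1 h2 h3] := tg i iT; split=> // u v hu hv.
  exact: le_trans (h2 u v hu hv) ed.
exact: le_trans (h3 u v hu hv) ed.
Qed.

Lemma esup_lt_eventually (I : topologicalType) (F : set_system I) (FF : Filter F)
    (f : I -> \bar R) (y : \bar R) :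
  (limf_esup f F < y)%E -> \forall x \near F, (f x < y)%E.
Proof.
move=> /ereal_inf_lt[_ [A FA <-] Ay]; apply: filterS FA => x Ax.
by apply: le_lt_trans Ay; apply: ereal_sup_ubound; exists x.
Qed.

Lemma jump_part_eq Z eps u v : u <= v ->
  (forall s, u < s <= v -> ~ big_jumps Z eps s) ->
  jump_part Z eps u = jump_part Z eps v.
Proof.
move=> uv H; rewrite /jump_part.
suff -> : [set s | 0 < s <= u] `&` big_jumps Z eps =
    [set s | 0 < s <= v] `&` big_jumps Z eps by [].
apply/seteqP; split=> s [/= /andP[s0 su] sJ]; split=> //=; rewrite s0 /=.
  exact: le_trans uv.
rewrite leNgt; apply/negP => us; apply: (H s) => //.
by rewrite us.
Qed.

(** Condition (C3) provides a size [eps] such that late cells oscillate by less than [eta] once the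
    jumps above [eps] are removed, and (C1) leaves at most one such jump in a cell. Away from it the
    removed part is constant, so [Z] itself oscillates as little. *)
Lemma tagged_eventually Z (pi : nat -> time_partition R) T (eta : R) :
  conditionC1 Z pi -> conditionC3 Z pi -> cadlag Z -> 0 <= T -> 0 < eta ->
  \forall n \near \oo, exists tau, tagged Z (pi n) T eta tau.
Proof.
move=> C1 C3 cZ T0 eta0.
have [eps eps0 osc] : exists2 eps : R, 0 < eps &
    \forall n \near \oo, (oscillation (Z \- jump_part Z eps)%R (pi n) T < eta%:E)%E.
  have /esup_lt_eventually : (limf_esup (fun eps => limn_esup (fun n =>
      oscillation (Z \- jump_part Z eps)%R (pi n) T)) 0^'+ < eta%:E)%E.
    by rewrite C3// lte_fin.
  move=> H; have [e [/= e0 /esup_lt_eventually He]] :=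
    filter_ex (filterI (nbhs_right_gt 0) H).
  by exists e.
have [N HN] := C1 T eps T0 eps0.
near=> n.
have oscn : (oscillation (Z \- jump_part Z eps)%R (pi n) T < eta%:E)%E by near: n.
have Nn : (N <= n)%N by near: n; exact: nbhs_infty_ge.
set p := pi n in oscn *.
have close i u v : p i < u -> u <= v -> v <= Num.min (p i.+1) T ->
    (forall s, u < s <= v -> ~ big_jumps Z eps s) -> `|Z u - Z v| <= eta.
  move=> pu uv; rewrite le_min => /andP[vp vT] nj.
  have -> : Z u - Z v = (Z \- jump_part Z eps) u - (Z \- jump_part Z eps) v.
    by rewrite /= (jump_part_eq uv nj); module R U.
  rewrite -lee_fin; apply/ltW/(le_lt_trans _ oscn)/ereal_sup_ubound; right.
  have u0 : 0 <= u by rewrite (le_trans (pt_ge0 p i))// ltW.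
  exists i, u, v; split => //.
  - by rewrite /cell /= in_itv /= pu (le_trans uv).
  - by rewrite /cell /= in_itv /= vp (lt_le_trans pu).
  - by rewrite u0 (le_trans uv).
  - by rewrite (le_trans u0 uv).
have tag i : exists t, p i < T ->
  [/\ p i < t <= Num.min (p i.+1) T,
      forall s, p i < s < t -> ~ big_jumps Z eps s &
      forall s, t < s <= Num.min (p i.+1) T -> ~ big_jumps Z eps s].
  have sub := HN n i Nn.
  have [[t [/andP[pt tm] tJ]]|nt] := pselect (exists t, p i < t <= Num.min (p i.+1) T /\
      big_jumps Z eps t).
    have it s : p i < s <= Num.min (p i.+1) T -> big_jumps Z eps s -> s = t.
      rewrite le_min => /andP[ps /andP[sp sT]] sJ.
      move: tm; rewrite le_min => /andP[tp tT].
      apply: sub; split => //; split; rewrite /cell /= in_itv /=.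
      - by rewrite ps.
      - by rewrite (le_trans (pt_ge0 p i) (ltW ps)).
      - by rewrite pt.
      - by rewrite (le_trans (pt_ge0 p i) (ltW pt)).
    exists t => _; split; first by rewrite pt.
      move=> s /andP[ps st] sJ.
      have E : s = t by apply: it => //; rewrite ps (le_trans (ltW st)).
      by rewrite E ltxx in st.
    move=> s /andP[ts sm] sJ.
    have E : s = t by apply: it => //; rewrite sm (lt_trans pt).
    by rewrite E ltxx in ts.
  (* Without a large jump the tag is the stopped right end, so that the second piece is a single
     point. *)
  exists (Num.min (p i.+1) T) => pT; split.
  - by rewrite lexx andbT lt_min pT pt_increasing.
  - by move=> s /andP[ps st] sJ; apply: nt; exists s; rewrite ps ltW.
  - by move=> s /andP[ts /(lt_le_trans ts)]; rewrite ltxx.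
have /choice[tau Htau] := tag.
exists tau => i pT; have [/andP[pt tm] J1 J2] := Htau i pT.
split; first by rewrite pt.
- have open u v : p i < u -> u <= v -> v < tau i -> `|Z u - Z v| <= eta.
    move=> pu uv vt; apply: (close i) => //; first exact: le_trans (ltW vt) tm.
    move=> s /andP[us sv]; apply: J1.
    by rewrite (lt_trans pu us) (le_lt_trans sv).
  (* The cell is open at [p i], so its oscillation says nothing about this endpoint;
     right-continuity reaches it. *)
  have cl u v : p i <= u -> u <= v -> v < tau i -> `|Z u - Z v| <= eta.
    rewrite le_eqVlt => /predU1P[<-|]; last exact: open.
    rewrite le_eqVlt => /predU1P[<- _|uv vt]; first by rewrite subrr normr0 ltW.
    apply/ler_addgt0Pr => e e0.
    near (p i)^'+ => c.
    have pc : p i < c by near: c; exact: nbhs_right_gt.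
    have cv : c <= v by near: c; exact: nbhs_right_le.
    have Hc : forall x, p i <= x <= c -> `|Z x - Z (p i)| <= e.
      by near: c; apply: cadlag_near_right => //; exact: pt_ge0.
    rewrite -[_ - Z v](subrKA (Z c)) (le_trans (ler_normD _ _))// addrC lerD//.
      exact: open.
    by rewrite distrC Hc// lexx ltW.
  move=> u v /andP[pu ut] /andP[pv vt].
  by have [uv|/ltW vu] := leP u v; [exact: cl|rewrite distrC cl].
- have cl u v : tau i <= u -> u <= v -> v <= Num.min (p i.+1) T -> `|Z u - Z v| <= eta.
    move=> tu uv vm; apply: (close i) => //; first exact: lt_le_trans tu.
    move=> s /andP[us sv]; apply: J2.
    by rewrite (le_lt_trans tu us) (le_trans sv).
  move=> u v /andP[pu ut] /andP[pv vt].
  by have [uv|/ltW vu] := leP u v; [exact: cl|rewrite distrC cl].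
Unshelve. all: by end_near. Qed.

End Tags.

(** * Norm and weak convergence *)

Section ModeConvergence.
Variable R : realType.

Lemma blin_comp_bounded (V1 V2 V3 : normedModType R) (S : blin V2 V3)
    (T : blin V1 V2) : S \o T \in @bounded_op R V1 V3.
Proof.
apply/asboolP; split=> [k x y|]; first by rewrite /= !linearP.
by move=> x; apply: continuous_comp; exact: blin_continuous.
Qed.

Definition blin_comp (V1 V2 V3 : normedModType R) (S : blin V2 V3)
  (T : blin V1 V2) : blin V1 V3 := Blin (blin_comp_bounded S T).

Variable m : cvg_mode.

Lemma mode_cvg_strong (V : normedModType R) (u : nat -> V) l :
  u @ \oo --> l -> mode_cvg m u l.
Proof.
case: m => //= ul v'; apply: (cvg_comp u v' ul).
exact: blin_continuous.
Qed.

Lemma mode_cvgD (V : normedModType R) (u v : nat -> V) l k :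
  mode_cvg m u l -> mode_cvg m v k -> mode_cvg m (fun n => u n + v n) (l + k).
Proof.
case: m => /= ul vk; first exact: cvgD.
move=> v'; rewrite linearD (_ : (fun _ => _) = (v' \o u) \+ (v' \o v)).
  by apply: cvgD; [exact: ul|exact: vk].
by apply/funext => n /=; rewrite linearD.
Qed.

Lemma mode_cvg_blin (V W : normedModType R) (T : blin V W) (u : nat -> V) l :
  mode_cvg m u l -> mode_cvg m (fun n => T (u n)) (T l).
Proof.
case: m => /= ul.
  by apply: (cvg_comp u T ul); exact: blin_continuous.
by move=> v'; exact: (ul (blin_comp v' T)).
Qed.

Lemma mode_cvgN (V : normedModType R) (u : nat -> V) l :
  mode_cvg m u l -> mode_cvg m (fun n => - u n) (- l).
Proof.
case: m => /= ul; first exact: cvgN.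
move=> v'; rewrite linearN (_ : (fun _ => _) = \- (v' \o u)).
  by apply: cvgN; exact: ul.
by apply/funext => n /=; rewrite linearN.
Qed.

Lemma mode_cvgB (V : normedModType R) (u v : nat -> V) l k :
  mode_cvg m u l -> mode_cvg m v k -> mode_cvg m (fun n => u n - v n) (l - k).
Proof. by move=> ul /mode_cvgN vk; exact: mode_cvgD. Qed.

Lemma mode_cvg_sum (V : normedModType R) (I : eqType) (s : seq I)
    (u : I -> nat -> V) (l : I -> V) :
  (forall i, i \in s -> mode_cvg m (u i) (l i)) ->
  mode_cvg m (fun n => \sum_(i <- s) u i n) (\sum_(i <- s) l i).
Proof.
elim: s => [|i s IH] ul.
  rewrite big_nil (_ : (fun _ => _) = cst 0); last first.
    by apply/funext => n; rewrite big_nil.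
  by apply: mode_cvg_strong; exact: cvg_cst.
rewrite big_cons (_ : (fun _ => _) = fun n => u i n + \sum_(i <- s) u i n).
  apply: mode_cvgD; first by apply: ul; rewrite mem_head.
  by apply: IH => j js; apply: ul; rewrite inE js orbT.
by apply/funext => n; rewrite big_cons.
Qed.

(** Norm errors are harmless in either mode: a functional [v'] enlarges them by at most the factor
    [|v'| + 1], which reduces the weak case to norm convergence of scalars. *)
Lemma mode_cvg_approx (V : normedModType R) (u : nat -> V) (l : V) :
  (forall e, 0 < e -> exists u' l', [/\ mode_cvg m u' l', `|l - l'| <= e &
     \forall n \near \oo, `|u n - u' n| <= e]) -> mode_cvg m u l.
Proof.
have strong (W : normedModType R) (v : nat -> W) (k : W) :
    (forall e, 0 < e -> exists v' k', [/\ v' @ \oo --> k', `|k - k'| <= e &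
     \forall n \near \oo, `|v n - v' n| <= e]) -> v @ \oo --> k.
  move=> H; apply/cvgrPdist_le => e e0.
  have e3 : 0 < e / 3 by rewrite divr_gt0.
  have [v' [k' [/cvgrPdist_le/(_ _ e3) vk kk vv]]] := H _ e3.
  near=> n.
  have h1 : `|k' - v' n| <= e / 3 by near: n.
  have h2 : `|v n - v' n| <= e / 3 by near: n.
  have -> : k - v n = (k - k') + (k' - v' n) - (v n - v' n) by module R W.
  rewrite (le_trans (ler_normB _ _))//.
  rewrite (le_trans (lerD (ler_normD _ _) h2))//.
  by rewrite (le_trans (lerD (lerD kk h1) (lexx _)))//; lra.
case: m => /= H; first exact: strong.
move=> v'; apply: strong => e e0.
have k0 : 0 < `|v'| + 1 by rewrite ltr_wpDl.
have [u' [l' [ul ll uu]]] := H _ (divr_gt0 e0 k0).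
have le (x y : V) : `|x - y| <= e / (`|v'| + 1) -> `|v' x - v' y| <= e.
  move=> xy; have -> : v' x - v' y = v' (x - y) by rewrite linearB.
  rewrite (le_trans (blin_normP _ _))// (le_trans (ler_wpM2l _ xy))//.
  by rewrite mulrCA ger_pMr// ler_pdivrMr// mul1r lerDl.
exists (v' \o u'), (v' l'); split; [exact: ul|exact: le|].
by apply: filterS uu => n; exact: le.
Unshelve. all: by end_near. Qed.

Lemma mode_cvg_unique (V : normedModType R) (u : nat -> V) l k :
  mode_cvg m u l -> mode_cvg m u k -> l = k.
Proof.
case: m => /= ul uk; first exact: cvg_unique ul uk.
apply: functionals_separate => v'.
exact: cvg_unique (ul v') (uk v').
Qed.

End ModeConvergence.

(** * Germs and the limits of their sums *)

Section Germs.
Variables (R : realType) (U : normedModType R) (Z : R -> U).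
Implicit Types (p : time_partition R) (T : R).

Definition cellval (H : normedModType R) (q : U -> U -> H) p (t : R) (i : nat) : H :=
  q (Z (Num.min (p i) t)) (Z (Num.min (p i.+1) t)).

Definition germ_sum (H : normedModType R) (q : U -> U -> H) p (t : R) : H :=
  sum_cells (cellval q p t).

(** A germ sum stopped at [t] cuts the cell containing [t]. Here every cell is kept whole and
    attributed to the interval that contains its tag, which makes the sums exactly additive in the
    interval. *)
Definition tag_sum (H : normedModType R) p T (tau : nat -> R) (a c : R)
    (F : nat -> H) : H :=
  \sum_(i < ncells p T | a < tau i <= c) F i.

Definition germ_on (H : normedModType R) (K : set U) (q : U -> U -> H) : Prop :=
  (forall z, q z z = 0) /\
  (forall e : R, 0 < e -> exists2 d : R, 0 < d & forall z w w',
     K z -> K w -> K w' -> `|w - w'| <= d -> `|q z w - q z w'| <= e).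

Section OneGerm.
Variables (H : normedModType R) (q : U -> U -> H).
Hypothesis q0 : forall z, q z z = 0.

Lemma cellval_out p t i : t <= p i -> cellval q p t i = 0.
Proof.
move=> tp; rewrite /cellval !min_r ?q0//.
exact: le_trans tp (ltW (pt_increasing p i)).
Qed.

Lemma germ_sumE p T t : t <= T ->
  germ_sum q p t = \sum_(i < ncells p T) cellval q p t i.
Proof.
move=> tT; apply: sum_cellsE => i Ni; apply: cellval_out.
by rewrite (le_trans tT)// (le_trans (ncells_ge p T))// pt_le.
Qed.

Lemma norm_sum_one (n : nat) (d : 'I_n -> H) (k : R) : 0 <= k ->
  (forall i, `|d i| <= k) -> (forall i j, d i != 0 -> d j != 0 -> i = j) ->
  `|\sum_i d i| <= k.
Proof.
move=> k0 dk d1; have [[i di]|nd] := pselect (exists i, d i != 0).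
  rewrite (bigD1 i)//= big1 ?addr0// => j /eqP ji.
  by apply: contrapT => /eqP dj; apply: ji; exact: d1.
rewrite big1 ?normr0// => i _; apply: contrapT => /eqP di.
by apply: nd; exists i.
Qed.

(* Only the cell containing [b] contributes to the difference. *)
Lemma germ_sum_tagged p T (eta kappa b : R) tau : 0 <= b -> b <= T -> 0 <= kappa ->
  tagged Z p T eta tau ->
  (forall z w w', path_range Z 0 T z -> path_range Z 0 T w ->
     path_range Z 0 T w' -> `|w - w'| <= eta -> `|q z w - q z w'| <= kappa) ->
  `|germ_sum q p b - tag_sum p T tau 0 b (cellval q p T)| <= kappa.
Proof.
move=> b0 bT k0 tg qk; rewrite (germ_sumE _ bT) /tag_sum [X in _ - X]big_mkcond -sumrB.
have tau0 (i : 'I_(ncells p T)) : 0 < tau i.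
  have [/andP[pt _] _ _] := tg i (ncells_lt (ltn_ord i)).
  exact: le_lt_trans (pt_ge0 p i) pt.
have zero (i : 'I_(ncells p T)) : ~~ (p i < b < p i.+1) -> cellval q p b i -
    (if 0 < tau i <= b then cellval q p T i else 0) = 0.
  have [/andP[pt ptm] _ _] := tg i (ncells_lt (ltn_ord i)).
  rewrite tau0 negb_and -!leNgt => /orP[bp|pb].
    by rewrite cellval_out// leNgt (le_lt_trans bp pt) /= subr0.
  rewrite (le_trans ptm) ?ge_min ?pb// /cellval.
  rewrite !min_l ?subrr//; first exact: le_trans pb bT.
  - by apply/ltW/ncells_lt/ltn_ord.
  - exact: le_trans (ltW (pt_increasing p i)) pb.
apply: norm_sum_one => // [i|i j].
  have [/andP[pb bp]|/zero ->] := boolP (p i < b < p i.+1); last by rewrite normr0.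
  have iT := ncells_lt (ltn_ord i).
  have [/andP[pt ptm] h1 h2] := tg i iT.
  have Kp : path_range Z 0 T (Z (p i)).
    by apply: path_range_val; rewrite pt_ge0 ltW.
  have Kb : path_range Z 0 T (Z b) by apply: path_range_val; rewrite b0.
  have m0 : 0 <= Num.min (p i.+1) T by rewrite le_min pt_ge0 (le_trans b0).
  have Km : path_range Z 0 T (Z (Num.min (p i.+1) T)).
    by apply: path_range_val; rewrite m0 ge_min lexx orbT.
  have bm : b <= Num.min (p i.+1) T by rewrite le_min (ltW bp).
  rewrite tau0 /cellval (min_l (ltW pb)) (min_r (ltW bp)) (min_l (ltW iT)) /=.
  (* If the tag is at most [b], then [b] and the stopped end of the cell both lie after it, where
     [Z] hardly moves; otherwise [b] lies on the side of [p i], and [q] is close to its value 0 on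
     the diagonal. *)
  have [tb|bt] := leP (tau i) b.
    by apply: qk => //; apply: h2; rewrite ?tb ?bm// lexx andbT.
  rewrite subr0 -[q _ _]subr0 -(q0 (Z (p i))); apply: qk => //.
  by apply: h1; rewrite ?lexx ?pt// ltW.
move=> di dj; apply/eqP; rewrite -val_eqE /=.
have /andP[ib bi] : p i < b < p i.+1 by apply: contraNT di => /zero ->.
have /andP[jb bj] : p j < b < p j.+1 by apply: contraNT dj => /zero ->.
have [ij|ji|//] := ltngtP i j.
  by have := lt_trans (le_lt_trans (pt_le p ij) jb) bi; rewrite ltxx.
by have := lt_trans (le_lt_trans (pt_le p ji) ib) bj; rewrite ltxx.
Qed.

End OneGerm.

Lemma tag_sum_cat (H : normedModType R) p T tau a b c (F : nat -> H) :
  a <= b -> b <= c ->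
  tag_sum p T tau a c F = tag_sum p T tau a b F + tag_sum p T tau b c F.
Proof.
move=> ab bc; rewrite /tag_sum [LHS]big_mkcond [X in _ = X + _]big_mkcond.
rewrite [X in _ = _ + X]big_mkcond -big_split /=; apply: eq_bigr => i _.
have [bt|tb] := ltP b (tau i).
  by rewrite (le_lt_trans ab bt) /= add0r.
by rewrite (le_trans tb bc) andbT addr0.
Qed.

Lemma tag_sumxx (H : normedModType R) p T tau a (F : nat -> H) :
  tag_sum p T tau a a F = 0.
Proof.
by rewrite /tag_sum big1// => i /andP[ai /(lt_le_trans ai)]; rewrite ltxx.
Qed.

Lemma tag_sum_full (H : normedModType R) p T eta tau (F : nat -> H) :
  tagged Z p T eta tau ->
  tag_sum p T tau 0 T F = \sum_(i < ncells p T) F i.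
Proof.
move=> tg; apply: eq_bigl => i.
have [/andP[pt]] := tg i (ncells_lt (ltn_ord i)).
rewrite le_min => /andP[_ ->] _ _; rewrite andbT.
exact: le_lt_trans (pt_ge0 p i) pt.
Qed.

(** The cell may start long before [a], but the later of [a] and its start precedes the tag, so [Z]
    there is close to its value at the start. *)
Lemma tag_before p T eta tau a c i : tagged Z p T eta tau -> (i < ncells p T)%N ->
  a < tau i <= c -> exists2 u, a <= u < c & `|Z (p i) - Z u| <= eta.
Proof.
move=> tg /ncells_lt iT /andP[at_ tc]; have [/andP[pt _] h _] := tg i iT.
exists (Num.max (p i) a).
  by rewrite le_max lexx orbT /= gt_max !(lt_le_trans _ tc).
by apply: h; rewrite ?lexx ?pt// le_max lexx gt_max pt.
Qed.

End Germs.

Section GermIntegrals.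
Variables (R : realType) (U H W : normedModType R) (Z : R -> U).
Variables (psi : U -> blin H W) (Q : R -> H) (mu : R -> R) (J : R -> W).
Hypothesis cZ : cadlag Z.

Lemma step_fun_cat (s t : seq (blin H W * R * R)) r :
  step_fun (s ++ t) r = step_fun s r + step_fun t r.
Proof. by rewrite /step_fun big_cat. Qed.

Lemma step_fun_out (s : seq (blin H W * R * R)) a c r :
  all (fun x => (a <= x.1.2) && (x.1.2 <= x.2 <= c)) s -> ~~ (a < r <= c) ->
  step_fun s r = 0.
Proof.
move=> sac rac; rewrite /step_fun big_seq big1// => x xs.
have /allP/(_ x xs)/and3P[ax _ xc] := sac.
case: ifP => // /andP[xr rx]; case/negP: rac.
by rewrite (le_lt_trans ax xr) (le_trans rx xc).
Qed.

Lemma step_integral_cat (g : R -> H) (s t : seq (blin H W * R * R)) :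
  step_integral g (s ++ t) = step_integral g s + step_integral g t.
Proof. by rewrite /step_integral big_cat. Qed.

(** One step function serves both the Stieltjes integral and the discrete sums. It equals
    [psi (Z a)] on []a, c]] if [Z] varies little on [[a, c[], and all four assertions are stable
    under concatenation of steps. *)
Lemma step_approximation T e : 0 <= T -> 0 < e ->
  modulus_on (path_range Z 0 T) psi -> local_integral (psi \o Z) Q mu J ->
  exists s : seq (blin H W * R * R),
  [/\ all (fun x => (0 <= x.1.2) && (x.1.2 <= x.2 <= T)) s,
      forall r, 0 < r <= T -> `|psi (leftlim Z r) - step_fun s r| <= e,
      `|J T - J 0 - step_integral Q s| <= e * (mu T - mu 0) &
      exists2 eta, 0 < eta & forall p tau, tagged Z p T eta tau ->
        forall q : nat -> H,
        `|tag_sum p T tau 0 T (fun i => psi (Z (p i)) (q i)) -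
          \sum_(x <- s) x.1.1 (tag_sum p T tau x.1.2 x.2 q)| <=
        e * tag_sum p T tau 0 T (fun i => `|q i| : R^o)].
Proof.
move=> T0 e0 mpsi JP.
(* Half of [d] is for the variation of [Z] on a piece, the other half for the distance from [Z] at
   the start of a cell to [Z] at a point of the piece containing its tag. *)
have [d d0 Hd] := mpsi e e0.
have d2 : 0 < d / 2 by rewrite divr_gt0.
have d4 : 0 < d / 2 / 2 by rewrite divr_gt0.
have d2d : d / 2 <= d by rewrite ler_pdivrMr// ler_pMr// ler1n.
pose P a c := 0 <= a -> c <= T -> exists s : seq (blin H W * R * R),
  [/\ all (fun x => (a <= x.1.2) && (x.1.2 <= x.2 <= c)) s,
      forall r, a < r <= c -> `|psi (leftlim Z r) - step_fun s r| <= e,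
      `|J c - J a - step_integral Q s| <= e * (mu c - mu a) &
      forall p tau, tagged Z p T (d / 2) tau -> forall q : nat -> H,
        `|tag_sum p T tau a c (fun i => psi (Z (p i)) (q i)) -
          \sum_(x <- s) x.1.1 (tag_sum p T tau x.1.2 x.2 q)| <=
        e * tag_sum p T tau a c (fun i => `|q i| : R^o)].
suff : P 0 T.
  move=> /(_ (lexx _) (lexx _))[s [s1 s2 s3 s4]]; exists s; split=> //.
  by exists (d / 2).
have base a c : a < c -> (forall x, a <= x < c -> `|Z x - Z a| <= d / 2) -> P a c.
  move=> ac Zac a0 cT.
  have aT : a <= T by exact: le_trans (ltW ac) cT.
  have Ka : path_range Z 0 T (Z a) by apply: path_range_val; rewrite a0.
  exists [:: (psi (Z a), a, c)]; split.
  - by rewrite /= lexx ltW//= lexx.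
  - move=> r /andP[ar rc]; rewrite /step_fun big_seq1 /= ar rc.
    apply: Hd => //.
      by apply: path_range_leftlim; rewrite (le_lt_trans a0 ar) (le_trans rc).
    rewrite (le_trans _ d2d)//; apply: (@leftlim_dist_le _ _ _ a) => //.
      exact: le_lt_trans ar.
    by move=> x /andP[ax xr]; apply: Zac; rewrite ax (lt_le_trans xr).
  - rewrite /step_integral big_seq1 /=; apply: JP => //; first exact: ltW.
    move=> x /andP[ax xc]; apply: Hd => //.
      by apply: path_range_val; rewrite (le_trans a0 ax) (le_trans (ltW xc)).
    by rewrite (le_trans _ d2d)// Zac// ax.
  - move=> p tau tg q; rewrite big_seq1 /= /tag_sum.
    have -> : psi (Z a) (\sum_(i < ncells p T | a < tau i <= c) q i) =
        \sum_(i < ncells p T | a < tau i <= c) psi (Z a) (q i).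
      exact: linear_sum.
    rewrite -sumrB (le_trans (ler_norm_sum _ _ _))// mulr_sumr.
    apply: ler_sum => i ai; rewrite -blinB (le_trans (blin_normP _ _))//.
    rewrite ler_wpM2r//.
    have iN := ltn_ord i.
    have [u uac pu] := tag_before tg iN ai.
    apply: Hd => //.
      by apply: path_range_val; rewrite pt_ge0 ltW// ncells_lt.
    rewrite -[_ - Z a](subrKA (Z u)) (le_trans (ler_normD _ _))// [leRHS]splitr.
    by rewrite lerD// Zac.
apply: interval_ind => //.
- move=> a _ _; exists [::]; split => //.
  + by move=> r /andP[ar /(lt_le_trans ar)]; rewrite ltxx.
  + by rewrite /step_integral big_nil !subrr normr0 mulr0.
  + by move=> p tau _ q; rewrite !tag_sumxx big_nil subrr normr0 mulr0.
- move=> a b c _ ab bc _ Pab Pbc a0 cT.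
  have [s [s1 s2 s3 s4]] := Pab a0 (le_trans bc cT).
  have [t [t1 t2 t3 t4]] := Pbc (le_trans a0 ab) cT.
  exists (s ++ t); split.
  + rewrite all_cat; apply/andP; split.
      apply: sub_all s1 => x /and3P[-> -> xb] /=; exact: le_trans bc.
    by apply: sub_all t1 => x /and3P[bx -> ->]; rewrite (le_trans ab bx).
  + move=> r /andP[ar rc]; rewrite step_fun_cat; have [rb|br] := leP r b.
      rewrite (step_fun_out t1) ?addr0; first by rewrite s2// ar.
      by rewrite negb_and -leNgt rb.
    rewrite (step_fun_out s1) ?add0r; first by rewrite t2// br.
    by rewrite negb_and -ltNge br orbT.
  + rewrite step_integral_cat.
    have -> : J c - J a - (step_integral Q s + step_integral Q t) =
        (J b - J a - step_integral Q s) + (J c - J b - step_integral Q t).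
      by module R W.
    rewrite (le_trans (ler_normD _ _))//.
    have -> : e * (mu c - mu a) = e * (mu b - mu a) + e * (mu c - mu b) by ring.
    exact: lerD.
  + move=> p tau tg q; rewrite !(tag_sum_cat _ _ _ _ ab bc) big_cat /= mulrDr.
    rewrite opprD addrACA (le_trans (ler_normD _ _))//.
    by apply: lerD; [exact: s4|exact: t4].
- move=> a a0 _; near=> c; apply: base; first by near: c; exact: nbhs_right_gt.
  have h : forall x, a <= x <= c -> `|Z x - Z a| <= d / 2.
    by near: c; exact: cadlag_near_right.
  by move=> x /andP[ax xc]; rewrite h// ax ltW.
- move=> b b0 _; near=> c.
  have cb : c < b by near: c; exact: nbhs_left_lt.
  have h : forall x, c <= x < b -> `|Z x - leftlim Z b| <= d / 2 / 2.
    by near: c; exact: cadlag_near_left.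
  apply: base => // x xcb.
  rewrite -[_ - Z c](subrKA (leftlim Z b)) (le_trans (ler_normD _ _))//.
  by rewrite [leRHS]splitr lerD// ?h// distrC h// lexx.
Unshelve. all: by end_near. Qed.

(** The mode of convergence only meets the step integral, a finite sum of operators applied to
    increments of the sums of [q]. The other errors are in norm: one from the cells cut at the ends
    of the steps, one from the uniform approximation of the integrand, weighted by [C]. *)
Theorem germ_integral_cvg (m : cvg_mode) (pi : nat -> time_partition R)
    (q : U -> U -> H) (C T : R) : 0 <= T ->
  (forall eta, 0 < eta -> \forall n \near \oo, exists tau, tagged Z (pi n) T eta tau) ->
  germ_on (path_range Z 0 T) q -> modulus_on (path_range Z 0 T) psi ->
  local_integral (psi \o Z) Q mu J ->
  (forall x y, 0 <= x -> x <= y -> y <= T ->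
     mode_cvg m (fun n => germ_sum Z q (pi n) y - germ_sum Z q (pi n) x) (Q y - Q x)) ->
  (forall n, \sum_(i < ncells (pi n) T) `|cellval Z q (pi n) T i| <= C) ->
  mode_cvg m (fun n => germ_sum Z (fun z w => psi z (q z w)) (pi n) T) (J T - J 0).
Proof.
move=> T0 tags [q0 qmod] mpsi JP Qcvg qC.
apply: mode_cvg_approx => e e0.
have C0 : 0 <= C by rewrite (le_trans _ (qC 0%N))// sumr_ge0.
(* The uniform error [e / 2 / k] gets multiplied by a sum of norms of [q], at most [C], or by the
   increment of [mu]; [k] dominates both and is positive. *)
pose k := C + `|mu T - mu 0| + 1.
have k0 : 0 < k by rewrite ltr_wpDl// addr_ge0.
have ek0 : 0 < e / 2 / k by rewrite !divr_gt0.
have kbound x : x <= C + `|mu T - mu 0| -> e / 2 / k * x <= e / 2.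
  move=> xk; rewrite -mulrA ger_pMr ?divr_gt0// mulrC ler_pdivrMr// mul1r.
  by rewrite (le_trans xk)// lerDl.
have [s [s1 s2 s3 [eta eta0 s4]]] := step_approximation T0 ek0 mpsi JP.
(* Each step has two ends, with error [e / 4 / c] each, and the norms of the operators add up to at
   most [c]: altogether [e / 2]. *)
pose c := \sum_(x <- s) `|x.1.1| + 1.
have c0 : 0 < c by rewrite ltr_wpDl// sumr_ge0.
have ec0 : 0 < e / 4 / c by rewrite !divr_gt0.
have [d d0 Hd] := qmod _ ec0.
exists (fun n => step_integral (germ_sum Z q (pi n)) s), (step_integral Q s).
split.
- apply: mode_cvg_sum => x xs; have /allP/(_ x xs)/and3P[x0 x12 xT] := s1.
  by apply: mode_cvg_blin; exact: Qcvg.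
- rewrite (le_trans s3)// (le_trans (kbound _ _))//; last first.
    by rewrite ler_pdivrMr// ler_pMr// ler1n.
  by rewrite (le_trans (ler_norm _))// lerDr.
have := tags (Num.min eta d); rewrite lt_min eta0 => /(_ d0).
apply: filterS => n [tau tg].
have tge : tagged Z (pi n) T eta tau.
  by apply: tagged_weaken tg; rewrite ge_min lexx.
have tgd : tagged Z (pi n) T d tau.
  by apply: tagged_weaken tg; rewrite ge_min lexx orbT.
have -> : germ_sum Z (fun z w => psi z (q z w)) (pi n) T =
    tag_sum (pi n) T tau 0 T (fun i => psi (Z (pi n i)) (cellval Z q (pi n) T i)).
  rewrite (tag_sum_full _ tg) (@germ_sumE _ _ _ _ _ _ _ T)//; last first.
    by move=> z; rewrite q0 linear0.
  apply: eq_bigr => i _; rewrite /cellval.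
  by rewrite (min_l (ltW (ncells_lt (ltn_ord i)))).
have h1 := s4 _ _ tge (cellval Z q (pi n) T).
set A := tag_sum _ _ _ _ _ _ in h1 *.
set B := \sum_(x <- s) _ in h1.
have h2 : `|B - step_integral (germ_sum Z q (pi n)) s| <= e / 2.
  rewrite /B /step_integral -sumrB (le_trans (ler_norm_sum _ _ _))//.
  apply: (@le_trans _ _ (\sum_(x <- s) `|x.1.1| * (2 * (e / 4 / c)))).
    rewrite big_seq [leRHS]big_seq; apply: ler_sum => x xs.
    have /allP/(_ x xs)/and3P[x0 x12 xT] := s1.
    rewrite -linearB (le_trans (blin_normP _ _))// ler_wpM2l//.
    have hg b : 0 <= b -> b <= T -> `|germ_sum Z q (pi n) b -
        tag_sum (pi n) T tau 0 b (cellval Z q (pi n) T)| <= e / 4 / c.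
      move=> b0 bT; apply: (germ_sum_tagged q0 b0 bT (ltW ec0) tgd).
      by move=> z w w' Kz Kw Kw'; apply: Hd.
    have := tag_sum_cat (pi n) T tau (cellval Z q (pi n) T) x0 x12.
    set g2 := germ_sum _ _ _ x.2; set g1 := germ_sum _ _ _ x.1.2.
    set t2 := tag_sum _ _ _ 0 x.2 _; set t1 := tag_sum _ _ _ 0 x.1.2 _ => E.
    set t := tag_sum _ _ _ _ _ _ in E *.
    have -> : t - (g2 - g1) = (g1 - t1) - (g2 - t2) by rewrite E; module R H.
    rewrite (le_trans (ler_normB _ _))// mulr_natl mulr2n lerD// hg//.
      exact: le_trans xT.
    exact: le_trans x12.
  rewrite -mulr_suml.
  have -> : 2 * (e / 4 / c) = e / 2 / c by field; rewrite gt_eqF.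
  have Sc : \sum_(x <- s) `|x.1.1| <= c by rewrite lerDl.
  rewrite (le_trans (ler_wpM2r _ Sc))//; first by rewrite !divr_ge0 ?ltW.
  by rewrite mulrC divfK// gt_eqF.
rewrite -[_ - step_integral _ _](subrKA B) (le_trans (ler_normD _ _))//.
rewrite [leRHS]splitr lerD// (le_trans h1)// kbound//.
by rewrite (tag_sum_full _ tg) (le_trans (qC n))// lerDl.
Qed.

End GermIntegrals.

(** * Norm limits of sums of remainders dominated by an energy *)

Section RemainderSums.
Variables (R : realType) (U : normedModType R) (G : completeNormedModType R).
Variables (Z : R -> U) (pi : nat -> time_partition R).
Variables (rho : U -> U -> G) (E : U -> U -> R^o) (C : R -> R).
Hypothesis cZ : cadlag Z.
Hypothesis tags : forall T eta, 0 <= T -> 0 < eta ->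
  \forall n \near \oo, exists tau, tagged Z (pi n) T eta tau.
Hypothesis E_ge0 : forall z w, 0 <= E z w.
Hypothesis rho0 : forall z, rho z z = 0.
Hypothesis rho_mod : forall T e : R, 0 <= T -> 0 < e -> exists2 d : R, 0 < d &
  forall z z' w w', path_range Z 0 T z -> path_range Z 0 T z' ->
    path_range Z 0 T w -> path_range Z 0 T w' ->
    `|z - z'| <= d -> `|w - w'| <= d -> `|rho z w - rho z' w'| <= e.
Hypothesis rho_small : forall T e : R, 0 <= T -> 0 < e -> exists2 d : R, 0 < d &
  forall z w, path_range Z 0 T z -> path_range Z 0 T w ->
    `|z - w| <= d -> `|rho z w| <= e * E z w.
Hypothesis rho_bound : forall T : R, 0 <= T -> exists2 M : R, 0 <= M &
  forall z w, path_range Z 0 T z -> path_range Z 0 T w ->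
    `|rho z w| <= M * E z w.
Hypothesis energy_bound : forall T n, 0 <= T ->
  \sum_(i < ncells (pi n) T) cellval Z E (pi n) T i <= C T.

Lemma cell_ex (p : time_partition R) (c : R) : 0 < c ->
  exists k, p k < c <= p k.+1.
Proof.
move=> c0; have := ncells_ge p c; have := @ncells_lt _ p c.
case: (ncells p c) => [_|k H ck]; first by rewrite pt0 leNgt c0.
by exists k; rewrite ck H.
Qed.

(** A jump larger than [eta] can only occur at a tag. Hence, if no cell is tagged at [c], the
    remainder of the jump at [c] is negligible. *)
Lemma leftlim_tagged (p : time_partition R) T eta tau c : tagged Z p T eta tau ->
  0 < c -> c <= T ->
  (forall i, (i < ncells p T)%N -> tau i <> c) -> `|leftlim Z c - Z c| <= eta.
Proof.
move=> tg c0 cT tc; have [k /andP[kc ck]] := cell_ex p c0.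
have kT : p k < T by exact: lt_le_trans kc cT.
have kN : (k < ncells p T)%N.
  rewrite ltnNge; apply/negP => Nk.
  by have := le_lt_trans (le_trans (ncells_ge p T) (pt_le p Nk)) kT; rewrite ltxx.
have [/andP[kt tm] h1 h2] := tg k kT.
have cm : c <= Num.min (p k.+1) T by rewrite le_min ck.
have [tkc|ctk|/(tc k kN)//] := ltgtP (tau k) c.
  apply: (@leftlim_dist_le _ _ _ (tau k)) => // x /andP[tx xc].
  apply: h2; rewrite ?tx ?cm ?andbT ?(ltW tkc)//; exact: le_trans (ltW xc) cm.
apply: (@leftlim_dist_le _ _ _ (p k)) => // x /andP[kx xc].
by apply: h1; rewrite ?kx ?(ltW kc) ?ctk//; exact: lt_trans ctk.
Qed.

Let K T := path_range Z 0 T.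
Let cell T p i := cellval Z rho p T i.
Let energy T p i := cellval Z E p T i.

Lemma range_cells T (p : time_partition R) i : (i < ncells p T)%N ->
  K T (Z (Num.min (p i) T)) /\ K T (Z (Num.min (p i.+1) T)).
Proof.
move=> /ncells_lt iT; have T0 : 0 <= T by exact: le_trans (pt_ge0 p i) (ltW iT).
by split; apply: path_range_val; rewrite le_min pt_ge0 T0 /= ge_min lexx orbT.
Qed.

(* Cells tagged before [c] contain only small increments; the cell tagged at [c],
   if any, contributes the jump of [Z] at [c]. *)
Lemma remainder_local T e : 0 <= T -> 0 < e -> exists2 d : R, 0 < d &
  forall a c, 0 <= a -> a < c -> c <= T ->
    (forall x, a <= x < c -> `|Z x - Z a| <= d) ->
  forall kappa, 0 < kappa -> exists2 eta, 0 < eta &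
  forall p tau, tagged Z p T eta tau ->
    `|tag_sum p T tau a c (cell T p) - rho (leftlim Z c) (Z c)| <=
      e * tag_sum p T tau a c (energy T p) + kappa.
Proof.
move=> T0 e0; have [d d0 Hd] := rho_small T0 e0.
have d4 : 0 < d / 4 by rewrite divr_gt0.
(* The increment over a cell tagged before [c] is split into four distances: from the start of the
   cell to a point of [[a, c[], from there to [a], from [a] to the tag, and from the tag to the
   end. *)
exists (d / 4) => // a c a0 ac cT Zac kappa k0.
have c0 : 0 < c by exact: le_lt_trans ac.
have [d' d0' Hd'] := rho_mod T0 k0.
exists (Num.min (d / 4) d'); first by rewrite lt_min d4.
move=> p tau tg.
have Kl : K T (leftlim Z c) by apply: path_range_leftlim; rewrite c0.
have Kc : K T (Z c) by apply: path_range_val; rewrite ltW.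
have eta4 : Num.min (d / 4) d' <= d / 4 by rewrite ge_min lexx.
have eta' : Num.min (d / 4) d' <= d' by rewrite ge_min lexx orbT.
rewrite /tag_sum.
have small (i : 'I_(ncells p T)) : a < tau i < c -> `|cell T p i| <= e * energy T p i.
  move=> /andP[at_ tc]; have iN := ltn_ord i.
  have [Kr Ks] := range_cells iN; apply: Hd => //.
  have iT := ncells_lt iN; rewrite (min_l (ltW iT)).
  have [/andP[_ tm] _ h2] := tg i iT.
  have [|u uac pu] := @tag_before _ _ _ _ _ _ _ a c _ tg iN.
    by rewrite at_ ltW.
  have h3 : `|Z (tau i) - Z (Num.min (p i.+1) T)| <= d / 4.
    by rewrite (le_trans (h2 _ _ _ _))// ?lexx ?tm.
  have h4 := Zac u uac.
  have h5 : `|Z (tau i) - Z a| <= d / 4 by rewrite Zac// tc ltW.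
  have -> : Z (p i) - Z (Num.min (p i.+1) T) =
    ((Z (p i) - Z u) + (Z u - Z a)) - ((Z (tau i) - Z a) - (Z (tau i) - Z (Num.min (p i.+1) T))).
    by module R U.
  rewrite (le_trans (ler_normB _ _))//.
  rewrite (le_trans (lerD (ler_normD _ _) (ler_normB _ _)))//.
  rewrite (le_trans (lerD (lerD (le_trans pu eta4) h4) (lerD h5 h3)))//.
  by lra.
have E0 i : 0 <= energy T p i by exact: E_ge0.
have [[k tk]|nk] := pselect (exists k : 'I_(ncells p T), tau k = c).
  have rest : `|\sum_(i < ncells p T | (a < tau i <= c) && (i != k)) cell T p i| <=
      e * \sum_(i < ncells p T | (a < tau i <= c) && (i != k)) energy T p i.
    rewrite (le_trans (ler_norm_sum _ _ _))// mulr_sumr; apply: ler_sum.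
    move=> i /andP[/andP[at_ tc] ik]; apply: small; rewrite at_ lt_neqAle tc andbT.
    apply: contraNN ik => /eqP tic; rewrite -val_eqE /=; apply/eqP.
    have [/andP[it + _ _]] := tg i (ncells_lt (ltn_ord i)).
    have [/andP[kt + _ _]] := tg k (ncells_lt (ltn_ord k)).
    rewrite !le_min tic tk => /andP[ck _] /andP[ci _].
    rewrite tic in it; rewrite tk in kt.
    have [ik|ki|//] := ltngtP i k.
      by have := lt_le_trans kt (le_trans ci (pt_le p ik)); rewrite ltxx.
    by have := lt_le_trans it (le_trans ck (pt_le p ki)); rewrite ltxx.
  rewrite (bigD1 k) ?tk ?ac ?lexx//= [X in e * X](bigD1 k) ?tk ?ac ?lexx//=.
  rewrite addrAC (le_trans (ler_normD _ _))// mulrDr.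
  have h : `|cell T p k - rho (leftlim Z c) (Z c)| <= kappa.
    have kN := ltn_ord k; have kT := ncells_lt kN.
    have [Kr Ks] := range_cells kN; have [/andP[kt tm] h1 h2] := tg k kT.
    rewrite tk in kt tm h1 h2.
    apply: Hd' => //.
      rewrite (min_l (ltW kT)) distrC (le_trans _ eta')//.
      apply: (@leftlim_dist_le _ _ _ (p k)) => // x xk.
      by apply: h1; rewrite ?xk// lexx.
    by rewrite (le_trans _ eta')//; apply: h2; rewrite ?lexx ?tm.
  have Ek : 0 <= e * energy T p k by rewrite mulr_ge0// ltW.
  by rewrite (le_trans (lerD h rest))//; lra.
have h : `|rho (leftlim Z c) (Z c)| <= kappa.
  rewrite -[rho _ _]subr0 -(rho0 (Z c)); apply: Hd' => //; last first.
    by rewrite subrr normr0 ltW.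
  rewrite (le_trans _ eta')//; apply: (leftlim_tagged tg) => // i iN tc.
  by apply: nk; exists (Ordinal iN).
rewrite (le_trans (ler_normB _ _))// lerD//.
rewrite (le_trans (ler_norm_sum _ _ _))// mulr_sumr; apply: ler_sum.
move=> i /andP[at_ tc]; apply: small; rewrite at_ lt_neqAle tc andbT.
by apply/eqP => tic; apply: nk; exists i.
Qed.

(** The vector [g] is a finite sum of values [rho (leftlim Z c) (Z c)] at division points that
    depend on [e] only. The error [kappa] is quantified after [g], so that it can be shared when
    intervals are glued. *)
Lemma remainder_approx T e : 0 <= T -> 0 < e -> exists g : G,
  forall kappa, 0 < kappa -> exists2 eta, 0 < eta &
  forall p tau, tagged Z p T eta tau ->
    `|tag_sum p T tau 0 T (cell T p) - g| <=
      e * tag_sum p T tau 0 T (energy T p) + kappa.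
Proof.
move=> T0 e0; have [d d0 Hd] := remainder_local T0 e0.
have d2 : 0 < d / 2 by rewrite divr_gt0.
pose P a c := 0 <= a -> c <= T -> exists g : G,
  forall kappa, 0 < kappa -> exists2 eta, 0 < eta &
  forall p tau, tagged Z p T eta tau ->
    `|tag_sum p T tau a c (cell T p) - g| <=
      e * tag_sum p T tau a c (energy T p) + kappa.
suff : P 0 T by move=> /(_ (lexx _) (lexx _)).
apply: interval_ind => //.
- move=> a _ _; exists 0 => kappa k0; exists 1 => // p tau _.
  by rewrite !tag_sumxx subrr normr0 mulr0 add0r ltW.
- move=> a b c _ ab bc _ Pab Pbc a0 cT.
  have [g Hg] := Pab a0 (le_trans bc cT); have [h Hh] := Pbc (le_trans a0 ab) cT.
  exists (g + h) => kappa k0; have k2 : 0 < kappa / 2 by rewrite divr_gt0.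
  have [eta eta0 H1] := Hg _ k2; have [eta' eta0' H2] := Hh _ k2.
  exists (Num.min eta eta'); first by rewrite lt_min eta0.
  move=> p tau tg.
  rewrite !(tag_sum_cat _ _ _ _ ab bc) opprD addrACA (le_trans (ler_normD _ _))//.
  rewrite mulrDr [kappa]splitr addrACA lerD//.
    by apply: H1; apply: tagged_weaken tg; rewrite ge_min lexx.
  by apply: H2; apply: tagged_weaken tg; rewrite ge_min lexx orbT.
- move=> a a0 _; near=> c => _ cT; exists (rho (leftlim Z c) (Z c)).
  have ac : a < c by near: c; exact: nbhs_right_gt.
  have h : forall x, a <= x <= c -> `|Z x - Z a| <= d.
    by near: c; exact: cadlag_near_right.
  by apply: Hd => // x /andP[ax xc]; rewrite h// ax ltW.
- move=> b b0 _; near=> c => c0 bT; exists (rho (leftlim Z b) (Z b)).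
  have cb : c < b by near: c; exact: nbhs_left_lt.
  have h : forall x, c <= x < b -> `|Z x - leftlim Z b| <= d / 2.
    by near: c; exact: cadlag_near_left.
  apply: Hd => // x xcb.
  rewrite -[_ - Z c](subrKA (leftlim Z b)) (le_trans (ler_normD _ _))//.
  by rewrite [leRHS]splitr lerD// ?h// distrC h// lexx.
Unshelve. all: by end_near. Qed.

Lemma energy_bound_ge0 T : 0 <= T -> 0 <= C T.
Proof.
by move=> T0; apply: le_trans (energy_bound 0 T0); apply: sumr_ge0 => i _; exact: E_ge0.
Qed.

Lemma energy_tag_sum T n eta tau a c : 0 <= T -> tagged Z (pi n) T eta tau ->
  0 <= a -> a <= c -> c <= T ->
  tag_sum (pi n) T tau a c (energy T (pi n)) <= C T.
Proof.
move=> T0 tg a0 ac cT; apply: le_trans (energy_bound n T0).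
rewrite -(tag_sum_full _ tg) (tag_sum_cat _ _ _ _ a0 (le_trans ac cT)).
rewrite (tag_sum_cat _ _ _ _ ac cT) addrCA lerDl.
by rewrite addr_ge0// sumr_ge0// => i _; exact: E_ge0.
Qed.

Lemma remainder_germ_tagged T kappa : 0 <= T -> 0 < kappa -> exists2 eta, 0 < eta &
  forall p tau, tagged Z p T eta tau -> forall a c, 0 <= a -> a <= c -> c <= T ->
  `|germ_sum Z rho p c - germ_sum Z rho p a - tag_sum p T tau a c (cell T p)| <= kappa.
Proof.
move=> T0 k0; have k2 : 0 < kappa / 2 by rewrite divr_gt0.
have [d d0 Hd] := rho_mod T0 k2; exists d => // p tau tg a c a0 ac cT.
have H b : 0 <= b -> b <= T ->
    `|germ_sum Z rho p b - tag_sum p T tau 0 b (cell T p)| <= kappa / 2.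
  move=> b0 bT; apply: (germ_sum_tagged rho0 b0 bT (ltW k2) tg).
  by move=> z w w' Kz Kw Kw' ww; apply: Hd => //; rewrite subrr normr0 ltW.
have := tag_sum_cat p T tau (cell T p) a0 ac.
set g2 := germ_sum _ _ _ c; set g1 := germ_sum _ _ _ a.
set t2 := tag_sum _ _ _ 0 c _; set t1 := tag_sum _ _ _ 0 a _ => tE.
set t := tag_sum _ _ _ _ _ _ in tE *.
have -> : g2 - g1 - t = (g2 - t2) - (g1 - t1) by rewrite tE; module R G.
rewrite (le_trans (ler_normB _ _))// [leRHS]splitr lerD// H//.
  exact: le_trans ac.
exact: le_trans cT.
Qed.

Lemma germ_sum_at0 p : germ_sum Z rho p 0 = 0.
Proof.
rewrite (@germ_sumE _ _ _ _ _ rho0 p 0)// big1// => i _.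
by apply: cellval_out => //; exact: pt_ge0.
Qed.

(** The energy is bounded uniformly in [n], so its factor can be chosen to make the sums eventually
    [e]-close to one vector [g]. Convergence is in norm, whatever the mode of the quadratic
    variation. *)
Lemma remainder_cvg b : 0 <= b ->
  cvg ((fun n => germ_sum Z rho (pi n) b) @ \oo).
Proof.
move=> b0; apply: cauchy_seq_cvg => e e0.
have C1 : 0 < C b + 1 by rewrite ltr_wpDl// energy_bound_ge0.
have e3 : 0 < e / 3 by rewrite divr_gt0.
have [g Hg] := remainder_approx b0 (divr_gt0 e3 C1).
have [eta eta0 H1] := Hg _ e3.
have [eta' eta0' H2] := remainder_germ_tagged b0 e3.
exists g; have m0 : 0 < Num.min eta eta' by rewrite lt_min eta0.
have := tags b0 m0; apply: filterS => n [tau tg].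
have tg1 : tagged Z (pi n) b eta tau by apply: tagged_weaken tg; rewrite ge_min lexx.
have tg2 : tagged Z (pi n) b eta' tau.
  by apply: tagged_weaken tg; rewrite ge_min lexx orbT.
have h1 := H1 _ _ tg1; have := H2 _ _ tg2 0 b (lexx _) b0 (lexx _).
rewrite germ_sum_at0 subr0 => h2.
rewrite -[_ - g](subrKA (tag_sum (pi n) b tau 0 b (cell b (pi n)))).
rewrite (le_trans (ler_normD _ _))// (le_trans (lerD h2 h1))//.
have h3 : e / 3 / (C b + 1) * tag_sum (pi n) b tau 0 b (energy b (pi n)) <= e / 3.
  rewrite -mulrA ger_pMr// mulrC ler_pdivrMr// mul1r.
  by rewrite (le_trans (energy_tag_sum b0 tg _ _ _))// lerDl.
by rewrite (le_trans (lerD (lexx _) (lerD h3 (lexx _))))//; lra.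
Qed.

Definition remainder (b : R) : G := lim ((fun n => germ_sum Z rho (pi n) b) @ \oo).

(** The local estimate passes to the limit, with the energy replaced by its bound. It yields the
    jumps of the limit and, as [rho] vanishes on the diagonal, its right-continuity. *)
Lemma remainder_jump T e : 0 <= T -> 0 < e -> exists2 d : R, 0 < d &
  forall a c, 0 <= a -> a < c -> c <= T ->
    (forall x, a <= x < c -> `|Z x - Z a| <= d) ->
  `|remainder c - remainder a - rho (leftlim Z c) (Z c)| <= e.
Proof.
move=> T0 e0; have C1 : 0 < C T + 1 by rewrite ltr_wpDl// energy_bound_ge0.
have [d d0 Hd] := remainder_local T0 (divr_gt0 e0 C1).
exists d => // a c a0 ac cT Zac.
have c0 : 0 <= c by exact: le_trans (ltW ac).
apply: (@lim_dist_le _ _ (fun n => germ_sum Z rho (pi n) c - germ_sum Z rho (pi n) a)).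
  by apply: cvgB; exact: remainder_cvg.
move=> k k0; have k2 : 0 < k / 2 by rewrite divr_gt0.
have [eta eta0 H1] := Hd a c a0 ac cT Zac _ k2.
have [eta' eta0' H2] := remainder_germ_tagged T0 k2.
have m0 : 0 < Num.min eta eta' by rewrite lt_min eta0.
have := tags T0 m0; apply: filterS => n [tau tg].
have tg1 : tagged Z (pi n) T eta tau by apply: tagged_weaken tg; rewrite ge_min lexx.
have tg2 : tagged Z (pi n) T eta' tau.
  by apply: tagged_weaken tg; rewrite ge_min lexx orbT.
have h1 := H1 _ _ tg1; have h2 := H2 _ _ tg2 a c a0 (ltW ac) cT.
rewrite -[X in `|X|](subrKA (tag_sum (pi n) T tau a c (cell T (pi n)))).
rewrite (le_trans (ler_normD _ _))// (le_trans (lerD h2 h1))//.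
have h3 : e / (C T + 1) * tag_sum (pi n) T tau a c (energy T (pi n)) <= e.
  rewrite -mulrA ger_pMr// mulrC ler_pdivrMr// mul1r.
  by rewrite (le_trans (energy_tag_sum T0 tg _ _ _))// ?lerDl// ltW.
by rewrite (le_trans (lerD (lexx _) (lerD h3 (lexx _))))//; lra.
Qed.

(** Disjoint time intervals collect disjoint sets of tagged cells, so the sum of norms is at most
    [M] times the total energy, up to an error [e / (N + 1)] for each of the [N] increments. *)
Lemma remainder_variation T : 0 <= T -> exists M : R, forall (x : nat -> R) N,
  {homo x : i j / (i <= j)%N >-> i <= j} -> 0 <= x 0%N -> x N <= T ->
  \sum_(i < N) `|remainder (x i.+1) - remainder (x i)| <= M.
Proof.
move=> T0; have [M M0 HM] := rho_bound T0; exists (M * C T) => x N xi x0 xN.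
have xge i : 0 <= x i by exact: le_trans x0 (xi _ _ (leq0n i)).
have xle i : (i <= N)%N -> x i <= T by move=> /xi/le_trans; exact.
have S0 : 0 <= \sum_(i < N) `|remainder (x i.+1) - remainder (x i)| by exact: sumr_ge0.
rewrite -[leLHS](ger0_norm S0) -[X in `|X|]subr0.
apply: (@lim_dist_le _ R^o (fun n => \sum_(i < N)
  `|germ_sum Z rho (pi n) (x i.+1) - germ_sum Z rho (pi n) (x i)|)).
  apply: (@mode_cvg_sum R Strong R^o _ (index_enum 'I_N) (fun i n =>
    `|germ_sum Z rho (pi n) (x i.+1) - germ_sum Z rho (pi n) (x i)|)
    (fun i => `|remainder (x i.+1) - remainder (x i)|)) => i _; apply: cvg_norm.
  by apply: cvgB; exact: remainder_cvg.
move=> e e0; have eN : 0 < e / N.+1%:R by rewrite divr_gt0.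
have [eta eta0 H] := remainder_germ_tagged T0 eN.
have := tags T0 eta0; apply: filterS => n [tau tg].
rewrite subr0 ger0_norm ?sumr_ge0//.
have le1 i : (i < N)%N ->
    `|germ_sum Z rho (pi n) (x i.+1) - germ_sum Z rho (pi n) (x i)| <=
    M * tag_sum (pi n) T tau (x i) (x i.+1) (energy T (pi n)) + e / N.+1%:R.
  move=> iN; have := H _ _ tg (x i) (x i.+1) (xge i) (xi _ _ (leqnSn i)) (xle _ iN).
  set t := tag_sum _ _ _ _ _ _ => h.
  rewrite -[X in `|X|](subrK t) addrC (le_trans (ler_normD _ _))// lerD//.
  rewrite /t /tag_sum (le_trans (ler_norm_sum _ _ _))// mulr_sumr; apply: ler_sum.
  move=> j _; have [Kr Ks] := range_cells (ltn_ord j); exact: HM.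
have tele k : (k <= N)%N -> \sum_(i < k) tag_sum (pi n) T tau (x i) (x i.+1) (energy T (pi n)) =
    tag_sum (pi n) T tau (x 0%N) (x k) (energy T (pi n)).
  elim: k => [|k IH kN]; first by rewrite big_ord0 tag_sumxx.
  by rewrite big_ord_recr /= IH ?(ltnW kN)// -tag_sum_cat// xi.
apply: (@le_trans _ _ (\sum_(i < N) (M * tag_sum (pi n) T tau (x i) (x i.+1)
    (energy T (pi n)) + e / N.+1%:R))).
  by apply: ler_sum => i _; exact: le1.
rewrite big_split /= -mulr_sumr tele// sumr_const card_ord lerD//.
  by rewrite ler_wpM2l// (energy_tag_sum T0 tg)// xi.
by rewrite -[leLHS]mulr_natl mulrCA ger_pMr// ler_pdivrMr// mul1r ler_nat.
Qed.

End RemainderSums.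

(** * Tensors and Taylor's formula *)

Section TensorCalculus.
Variables (R : realType) (alpha : uniform_crossnorm R).

Lemma tensDl (E F : completeNormedModType R) (x x' : E) (y : F) :
  tens alpha (x + x') y = tens alpha x y + tens alpha x' y.
Proof.
have [lin _ _] := ctens_completion alpha E F.
have -> : tens alpha x y + tens alpha x' y =
    ctens_inj alpha (1 *: ptens x y + ptens x' y).
  by rewrite lin scale1r.
congr ctens_inj; rewrite scale1r; apply/val_inj/funext => b.
by rewrite /= /pure_form linearDl.
Qed.

Lemma tensDr (E F : completeNormedModType R) (x : E) (y y' : F) :
  tens alpha x (y + y') = tens alpha x y + tens alpha x y'.
Proof.
have [lin _ _] := ctens_completion alpha E F.
have -> : tens alpha x y + tens alpha x y' =
    ctens_inj alpha (1 *: ptens x y + ptens x y').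
  by rewrite lin scale1r.
congr ctens_inj; rewrite scale1r; apply/val_inj/funext => b.
by rewrite /= /pure_form linearDr.
Qed.

Lemma norm_tens (E F : completeNormedModType R) (x : E) (y : F) :
  `|tens alpha x y| <= `|x| * `|y|.
Proof.
rewrite /tens (completion_norm (ctens_completion alpha E F)).
exact: (crossnorm_pure (crossnorm_reasonable alpha E F)).
Qed.

Lemma tens0l (E F : completeNormedModType R) (y : F) : tens alpha (0 : E) y = 0.
Proof.
apply/eqP; rewrite -normr_le0 (le_trans (norm_tens _ _))//.
by rewrite normr0 mul0r.
Qed.

Lemma tens_square_dist (E : completeNormedModType R) (x y : E) :
  `|tens alpha x x - tens alpha y y| <= (`|x| + `|y|) * `|x - y|.
Proof.
have -> : tens alpha x x - tens alpha y y =
    tens alpha x (x - y) + tens alpha (x - y) y.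
  have hr : tens alpha x x = tens alpha x (x - y) + tens alpha x y.
    by rewrite -tensDr subrK.
  have hl : tens alpha x y = tens alpha (x - y) y + tens alpha y y.
    by rewrite -tensDl subrK.
  by rewrite hr hl; module R (ctens alpha E E).
rewrite (le_trans (ler_normD _ _))// mulrDl lerD// (le_trans (norm_tens _ _))//.
by rewrite mulrC.
Qed.

Section Operators.
Variables E1 E2 F1 F2 : completeNormedModType R.

Lemma tens_op_pure (T : blin E1 E2) (S : blin F1 F2) x y :
  tens_op alpha T S (tens alpha x y) = tens alpha (T x) (S y).
Proof. by rewrite /tens_op; case: cid => TS /= [TSE _]; exact: TSE. Qed.

Lemma norm_tens_op (T : blin E1 E2) (S : blin F1 F2) :
  `|tens_op alpha T S| <= `|T| * `|S|.
Proof. by rewrite /tens_op; case: cid => TS /= [_ TSn]; exact: TSn. Qed.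

(** Pure tensors span a dense subspace. As [tens_op] is obtained by choice and known on pure
    tensors, its additivity in each operator comes from here. *)
Lemma blin_eq_tens (W : normedModType R) (P Q : blin (ctens alpha E1 F1) W) :
  (forall x y, P (tens alpha x y) = Q (tens alpha x y)) -> P = Q.
Proof.
move=> PQ; have [lin _ dns] := ctens_completion alpha E1 F1.
have PQj u : P (ctens_inj alpha u) = Q (ctens_inj alpha u).
  case: u => f mf; have /asboolP[s def_f] := mf.
  set v := (X in ctens_inj alpha X).
  have -> : v = \sum_(p <- s) ptens p.1 p.2.
    apply/val_inj; rewrite /= def_f.
    by elim: s {def_f v} => [|p s IH]; rewrite ?big_nil// !big_cons IH.
  have j0 : ctens_inj alpha (0 : algtensor E1 F1) = 0.
    have := lin (-1) 0 0; rewrite scaler0 addr0 => {1}->.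
    by rewrite scaleN1r addNr.
  have jD (w w' : algtensor E1 F1) :
      ctens_inj alpha (w + w') = ctens_inj alpha w + ctens_inj alpha w'.
    by have := lin 1 w w'; rewrite !scale1r.
  elim: s {f mf def_f v} => [|p s IH]; first by rewrite big_nil j0 !linear0.
  have PD a b : P (a + b) = P a + P b by exact: linearD.
  have QD a b : Q (a + b) = Q a + Q b by exact: linearD.
  by rewrite big_cons jD PD QD IH; congr (_ + _); exact: PQ.
apply: blin_ext => w; apply/eqP; rewrite -subr_eq0 -normr_le0.
apply: (@ler_addgt0_scale _ _ _ (`|P - Q|)) => e e0; rewrite add0r mulrC.
have [x [wv [u _ ju]]] : ball w e `&` range (@ctens_inj _ alpha E1 F1) !=set0.
  by apply: dns; [exists w; exact: ballxx|exact: ball_open].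
move: wv; rewrite -ju -ball_normE /= => /ltW wv.
have -> : P w - Q w = (P - Q) (w - ctens_inj alpha u).
  have PB a b : P (a - b) = P a - P b by exact: linearB.
  have QB a b : Q (a - b) = Q a - Q b by exact: linearB.
  by rewrite blinB PB QB PQj; module R W.
by rewrite (le_trans (blin_normP _ _))// ler_wpM2l.
Qed.

Lemma tens_op_dist (T T' : blin E1 E2) (S S' : blin F1 F2) :
  `|tens_op alpha T S - tens_op alpha T' S'| <= `|T - T'| * `|S| + `|T'| * `|S - S'|.
Proof.
have -> : tens_op alpha T S - tens_op alpha T' S' =
    tens_op alpha (T - T') S + tens_op alpha T' (S - S').
  apply: blin_eq_tens => x y; rewrite blinB blinD !tens_op_pure !blinB.
  have hl : tens alpha (T x) (S y) = tens alpha (T x - T' x) (S y) + tens alpha (T' x) (S y).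
    by rewrite -tensDl subrK.
  have hr : tens alpha (T' x) (S y) = tens alpha (T' x) (S y - S' y) + tens alpha (T' x) (S' y).
    by rewrite -tensDr subrK.
  by rewrite hl hr; module R (ctens alpha E2 F2).
by rewrite (le_trans (ler_normD _ _))// lerD// norm_tens_op.
Qed.

End Operators.
End TensorCalculus.

Section CompactHull.
Variables (R : realType) (F E : normedModType R).

(** The derivatives are only continuous on compact sets, so Taylor's formula between points of [K]
    needs a compact set containing the intermediate points; the two parameters are independent
    because the coordinates are moved one after the other. *)
Definition box_hull (K : set (F * E)) : set (F * E) :=
  [set y | exists z w (s t : R), [/\ K z, K w, 0 <= s <= 1, 0 <= t <= 1 &
     y = (z.1 + s *: (w.1 - z.1), z.2 + t *: (w.2 - z.2))]].

Lemma compact_box_hull (K : set (F * E)) : compact K -> compact (box_hull K).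
Proof.
move=> cK.
pose I := [set s : R | 0 <= s <= 1].
have cI : compact I.
  suff -> : I = `[0, 1]%classic by exact: segment_compact.
  by apply/seteqP; split=> s; rewrite /= in_itv.
pose h (x : (F * E) * (F * E) * (R * R)) : F * E :=
  (x.1.1.1 + x.2.1 *: (x.1.2.1 - x.1.1.1), x.1.1.2 + x.2.2 *: (x.1.2.2 - x.1.1.2)).
have -> : box_hull K = h @` ((K `*` K) `*` (I `*` I)).
  apply/seteqP; split.
    by move=> y [z [w [s [t [Kz Kw s1 t1 ->]]]]]; exists ((z, w), (s, t)).
  move=> _ [[[z w] [s t]] /= [[Kz Kw] [s1 t1]] <-].
  by exists z, w, s, t.
apply: continuous_compact; last first.
  by apply: compact_setX; apply: compact_setX.
apply: continuous_subspaceT => x.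
pose X := ((F * E) * (F * E) * (R * R))%type.
have c1 : (fun y : X => y.1.1) @ x --> x.1.1.
  by apply: cvg_comp; [exact: cvg_fst|exact: cvg_fst].
have c2 : (fun y : X => y.1.2) @ x --> x.1.2.
  by apply: cvg_comp; [exact: cvg_fst|exact: cvg_snd].
have c3 : (fun y : X => y.2.1) @ x --> x.2.1.
  by apply: cvg_comp; [exact: cvg_snd|exact: cvg_fst].
have c4 : (fun y : X => y.2.2) @ x --> x.2.2.
  by apply: cvg_comp; [exact: cvg_snd|exact: cvg_snd].
have c11 : (fun y : X => y.1.1.1) @ x --> x.1.1.1.
  by apply: cvg_comp c1 _; exact: cvg_fst.
have c12 : (fun y : X => y.1.1.2) @ x --> x.1.1.2.
  by apply: cvg_comp c1 _; exact: cvg_snd.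
have c21 : (fun y : X => y.1.2.1) @ x --> x.1.2.1.
  by apply: cvg_comp c2 _; exact: cvg_fst.
have c22 : (fun y : X => y.1.2.2) @ x --> x.1.2.2.
  by apply: cvg_comp c2 _; exact: cvg_snd.
by apply: cvg_pair; apply: cvgD => //; apply: cvgZ => //; exact: cvgB.
Qed.

End CompactHull.

Section Taylor.
Variables (R : realType) (E F G : completeNormedModType R).
Variable alpha : uniform_crossnorm R.
Variables (f : F * E -> G) (Daf : F * E -> blin F G) (Dxf : F * E -> blin E G).
Variables (D2xf : F * E -> blin E (blin E G)).
Variables (D2xf_ext : F * E -> blin (ctens alpha E E) G).
Hypothesis hDaf :
  forall a x, gateaux_derivative (fun b => f (b, x)) a (Daf (a, x)).
Hypothesis hDxf :
  forall a x, gateaux_derivative (fun y => f (a, y)) x (Dxf (a, x)).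
Hypothesis hD2xf :
  forall a x, gateaux_derivative (fun y => Dxf (a, y)) x (D2xf (a, x)).
Hypothesis hext : forall z u v, D2xf_ext z (tens alpha u v) = D2xf z u v.

Definition taylor_rem (z w : F * E) : G :=
  f w - f z - Dxf z (w.2 - z.2)
  - (2^-1 : R) *: D2xf_ext z (tens alpha (w.2 - z.2) (w.2 - z.2))
  - Daf z (w.1 - z.1).

(** The order of smallness that sums to a bounded quantity along the partitions: 2-variation for
    [X], total variation for [A]. *)
Definition energy (z w : F * E) : R^o := `|w.2 - z.2| ^+ 2 + `|w.1 - z.1|.

Lemma energy_ge0 z w : 0 <= energy z w.
Proof. by rewrite addr_ge0// exprn_ge0. Qed.

Lemma taylor_a (a b : F) (x : E) (D : blin F G) (M : R) :
  (forall s : R, 0 <= s <= 1 -> `|Daf (a + s *: (b - a), x) - D| <= M) ->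
  `|f (b, x) - f (a, x) - D (b - a)| <= M * `|b - a|.
Proof.
move=> HM; have := @gateaux_mean_value R F G (fun c => f (c, x))
  (fun c => Daf (c, x)) a (b - a) (D (b - a)) (M * `|b - a|) (hDaf^~ x).
rewrite [a + (b - a)]addrC subrK; apply => s s01.
by rewrite -blinB (le_trans (blin_normP _ _))// ler_wpM2r// HM.
Qed.

(** The hypothesis on the extension bounds the operator norm of increments of [D2xf] applied to [h],
    since the crossnorm of the tensor of [h] and [k] is at most [|h| * |k|]. *)
Lemma taylor_x1 (a : F) (x h : E) (M : R) :
  (forall s : R, 0 <= s <= 1 -> `|D2xf_ext (a, x + s *: h) - D2xf_ext (a, x)| <= M) ->
  `|Dxf (a, x + h) - Dxf (a, x) - D2xf (a, x) h| <= M * `|h|.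
Proof.
move=> HM; apply: (@gateaux_mean_value R E _ (fun y => Dxf (a, y))
  (fun y => D2xf (a, y)) x h (D2xf (a, x) h) (M * `|h|) (hD2xf a)) => s s01.
have M0 : 0 <= M by exact: le_trans (HM _ s01).
apply: blin_norm_le => [|k]; first by rewrite mulr_ge0.
rewrite blinB -!hext -blinB (le_trans (blin_normP _ _))// -mulrA.
apply: ler_pM => //; [exact: HM|exact: norm_tens].
Qed.

Lemma taylor_x2 (a : F) (x h : E) (M : R) :
  (forall s : R, 0 <= s <= 1 -> `|D2xf_ext (a, x + s *: h) - D2xf_ext (a, x)| <= M) ->
  `|f (a, x + h) - f (a, x) - Dxf (a, x) h
    - (2^-1 : R) *: D2xf_ext (a, x) (tens alpha h h)| <= M * `|h| ^+ 2.
Proof.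
move=> HM; set c := D2xf_ext (a, x) (tens alpha h h).
(* Subtracting the Taylor polynomial turns the second-order remainder into an increment of [phi],
   whose derivative is the first-order remainder of [Dxf] applied to [h]. *)
pose phi s := f (a, x + s *: h) - s *: Dxf (a, x) h - (s ^+ 2 / 2) *: c.
pose dphi s := Dxf (a, x + s *: h) h - Dxf (a, x) h - s *: c.
have -> : f (a, x + h) - f (a, x) - Dxf (a, x) h - (2^-1 : R) *: c = phi 1 - phi 0.
  rewrite /phi expr1n expr0n /= mul0r mul1r !scale1r !scale0r !addr0 !subr0.
  by module R G.
apply: (mean_value_bound (dphi := dphi)) => [s _ e e0|s /andP[s0 s1]].
  have e2 : 0 < e / 2 by rewrite divr_gt0.
  have K := is_derive_expansion (hDxf a (x + s *: h) h) e2.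
  have c1 : 0 < `|c| + 1 by rewrite ltr_wpDl.
  near=> t.
  have h1 : `|f (a, x + s *: h + t *: h) - f (a, x + s *: h) -
      t *: Dxf (a, x + s *: h) h| <= e / 2 * `|t| by near: t.
  have h2 : `|t| <= e / (`|c| + 1).
    near: t; apply/nbhs_ballP; exists (e / (`|c| + 1)); first exact: divr_gt0.
    by move=> t; rewrite -ball_normE /= sub0r normrN => /ltW.
  have -> : phi (s + t) - phi s - t *: dphi s =
    (f (a, x + s *: h + t *: h) - f (a, x + s *: h) - t *: Dxf (a, x + s *: h) h)
    - (t ^+ 2 / 2) *: c.
    rewrite /phi /dphi.
    have -> : x + s *: h + t *: h = x + (s + t) *: h by module R E.
    have -> : (s + t) ^+ 2 / 2 = s ^+ 2 / 2 + t * s + t ^+ 2 / 2 by field.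
    by module R G.
  rewrite (le_trans (ler_normB _ _))// [e in leRHS]splitr mulrDl lerD//.
  rewrite normrZ normrM normrX (ger0_norm (_ : 0 <= 2^-1 :> R)) ?invr_ge0//.
  have -> : `|t| ^+ 2 / 2 * `|c| = (`|t| * `|c|) * `|t| / 2 by ring.
  have tc : `|t| * `|c| <= e.
    rewrite (le_trans (ler_wpM2r _ h2))// mulrAC ler_pdivrMr//.
    by rewrite ler_wpM2l ?(ltW e0)// lerDl.
  by have := ler_wpM2r (normr_ge0 t) tc; lra.
rewrite /dphi /c hext.
have -> : Dxf (a, x + s *: h) h - Dxf (a, x) h - s *: D2xf (a, x) h h =
    (Dxf (a, x + s *: h) - Dxf (a, x) - D2xf (a, x) (s *: h)) h.
  have -> : D2xf (a, x) (s *: h) = s *: D2xf (a, x) h by exact: linearZ.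
  by rewrite !blinB blinZ.
rewrite (le_trans (blin_normP _ _))// expr2 mulrA ler_wpM2r//.
have M0 : 0 <= M by apply: (le_trans _ (HM 0 _)); rewrite ?lexx ?ler01.
apply: (@le_trans _ _ (M * `|s *: h|)).
  apply: taylor_x1 => r /andP[r0 r1]; rewrite scalerA; apply: HM.
  by rewrite mulr_ge0//= mulr_ile1.
by rewrite normrZ ler_wpM2l// ler_piMl// ger0_norm.
Unshelve. all: by end_near. Qed.

(** The path goes through [(z.1, w.2)]: second order in [x] with [a] fixed, then first order in [a].
    The second move takes place at [w.2] while [Daf] is frozen at [z], so points differing in both
    coordinates are compared. *)
Lemma taylor_rem_le (z w : F * E) (M : R) :
  (forall s t : R, 0 <= s <= 1 -> 0 <= t <= 1 ->
    let y := (z.1 + s *: (w.1 - z.1), z.2 + t *: (w.2 - z.2)) in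
    `|Daf y - Daf z| <= M /\ `|D2xf_ext y - D2xf_ext z| <= M) ->
  `|taylor_rem z w| <= M * energy z w.
Proof.
move=> HM; rewrite /taylor_rem /energy.
have h1 : `|f (w.1, w.2) - f (z.1, w.2) - Daf z (w.1 - z.1)| <= M * `|w.1 - z.1|.
  apply: taylor_a => s s01; have := (HM s 1 s01).
  by rewrite scale1r [z.2 + _]addrC subrK lexx ler01 => /(_ isT)[].
have h2 : `|f (z.1, z.2 + (w.2 - z.2)) - f (z.1, z.2) - Dxf (z.1, z.2) (w.2 - z.2)
    - (2^-1 : R) *: D2xf_ext (z.1, z.2) (tens alpha (w.2 - z.2) (w.2 - z.2))|
    <= M * `|w.2 - z.2| ^+ 2.
  apply: taylor_x2 => t t01; have := HM 0 t.
  by rewrite scale0r addr0 lexx ler01 -surjective_pairing => /(_ isT t01)[].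
rewrite [z.2 + _]addrC subrK -!surjective_pairing in h1 h2.
have -> : f w - f z - Dxf z (w.2 - z.2) -
    (2^-1 : R) *: D2xf_ext z (tens alpha (w.2 - z.2) (w.2 - z.2)) - Daf z (w.1 - z.1)
  = (f (z.1, w.2) - f z - Dxf z (w.2 - z.2) -
    (2^-1 : R) *: D2xf_ext z (tens alpha (w.2 - z.2) (w.2 - z.2))) +
    (f w - f (z.1, w.2) - Daf z (w.1 - z.1)) by module R G.
by rewrite (le_trans (ler_normD _ _))// mulrDr lerD.
Qed.

Hypotheses (cDaf : CK Daf) (cDxf : CK Dxf) (cD2xf : CK D2xf_ext).
Variable K : set (F * E).
Hypothesis cK : compact K.

Let Kc := box_hull K.

Lemma sub_box_hull z : K z -> Kc z.
Proof.
move=> Kz; exists z, z, 0, 0; split; rewrite ?lexx ?ler01//.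
by rewrite !scale0r !addr0 -surjective_pairing.
Qed.

Lemma taylor_rem_small e : 0 < e -> exists2 d : R, 0 < d & forall z w, K z -> K w ->
  `|z - w| <= d -> `|taylor_rem z w| <= e * energy z w.
Proof.
move=> e0.
have [d1 d10 H1] := compact_modulus (compact_box_hull cK) (cDaf (compact_box_hull cK)) e0.
have [d2 d20 H2] := compact_modulus (compact_box_hull cK) (cD2xf (compact_box_hull cK)) e0.
exists (Num.min d1 d2); first by rewrite lt_min d10.
move=> z w Kz Kw zw; apply: taylor_rem_le => s t s01 t01 y.
have Ky : Kc y by exists z, w, s, t.
have yz : `|y - z| <= Num.min d1 d2.
  apply: le_trans zw; rewrite distrC !ProdNormedZmodule.prod_normE.
  have le (V : normedModType R) (a b : V) (r : R) : 0 <= r <= 1 ->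
      `|a - (a + r *: (b - a))| <= `|a - b|.
    move=> /andP[r0 r1].
    have -> : a - (a + r *: (b - a)) = r *: (a - b) by module R V.
    by rewrite normrZ ger0_norm// ler_piMl.
  rewrite ge_max; apply/andP; split; rewrite le_max.
    by rewrite [X in X || _]le.
  by rewrite [X in _ || X]le// orbT.
split.
  by apply: H1 => //; [exact: sub_box_hull|rewrite (le_trans yz)// ge_min lexx].
by apply: H2 => //; [exact: sub_box_hull|rewrite (le_trans yz)// ge_min lexx orbT].
Qed.

Lemma taylor_rem_bounded : exists2 M : R, 0 <= M &
  forall z w, K z -> K w -> `|taylor_rem z w| <= M * energy z w.
Proof.
have [M1 M10 H1] := compact_image_bounded (compact_box_hull cK) (cDaf (compact_box_hull cK)).
have [M2 M20 H2] := compact_image_bounded (compact_box_hull cK) (cD2xf (compact_box_hull cK)).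
exists (2 * M1 + 2 * M2); first by rewrite addr_ge0// mulr_ge0// ltW.
move=> z w Kz Kw; apply: taylor_rem_le => s t s01 t01 y.
have Ky : Kc y by exists z, w, s, t.
have Kz' := sub_box_hull Kz.
split; rewrite (le_trans (ler_normB _ _))//.
  by have := H1 _ Ky; have := H1 _ Kz'; lra.
by have := H2 _ Ky; have := H2 _ Kz'; lra.
Qed.

End Taylor.

(** * Identification of the primitives with vector Stieltjes integrals *)

Section StieltjesIntegral.
Variables (R : realType) (H W : normedModType R).

(** The constant [B] carries the induction: on the interval of the first step its value is absorbed
    into [B]. *)
Lemma measurable_norm_step (B : blin H W) (s : seq (blin H W * R * R)) :
  measurable_fun [set: R] (fun r => `|B + step_fun s r| : R).
Proof.
elim: s B => [|x s IH] B.
  rewrite (_ : (fun _ => _) = cst `|B|); first exact: measurable_cst.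
  by apply/funext => r; rewrite /step_fun big_nil addr0.
rewrite (_ : (fun _ => _) = fun r => if x.1.2 < r <= x.2
    then `|(B + x.1.1) + step_fun s r| else `|B + step_fun s r|); last first.
  apply/funext => r; rewrite /step_fun big_cons.
  by case: ifP => _; rewrite ?add0r// addrA.
apply: measurable_fun_ifT => //.
by apply: measurable_and; [exact: measurable_fun_ltr|exact: measurable_fun_ler].
Qed.

Lemma measurable_norm_stepB (s t : seq (blin H W * R * R)) :
  measurable_fun [set: R] (fun r => `|step_fun s r - step_fun t r| : R).
Proof.
have := measurable_norm_step 0 (s ++ [seq (- x.1.1, x.1.2, x.2) | x <- t]).
congr (measurable_fun _ _); apply/funext => r; rewrite add0r step_fun_cat.
congr `|_ + _|; rewrite /step_fun big_map -sumrN; apply: eq_bigr => x _ /=.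
by case: ifP => _; rewrite ?oppr0.
Qed.

Lemma stieltjes_measure_itv (mu : cumulative R R) (a b : R) : a <= b ->
  (lebesgue_stieltjes_measure mu `]a, b]%classic = (mu b - mu a)%:E)%E.
Proof.
move=> ab; rewrite /lebesgue_stieltjes_measure /measure_extension.
by rewrite measurable_mu_extE/= ?wlength_itv_bnd//; exact: is_ocitv.
Qed.

Lemma invSn_cvg (c : R) : (fun n => n.+1%:R^-1 * c) @ \oo --> (0 : R).
Proof.
by rewrite -(mul0r c); apply: cvgMr_tmp; exact: cvg_harmonic.
Qed.

(** Step functions within [1 / (n + 1)] of the integrand, uniformly on []0, T]], also converge in
    the mean since the variation measure of []0, T]] is finite; their step integrals converge to the
    increment of the primitive by the same construction. *)
Theorem is_stieltjes_integralP (U : normedModType R) (Z : R -> U)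
    (psi : U -> blin H W) (g : R -> H) (J : R -> W) (phi : R -> blin H W) (T : R) :
  cadlag Z -> cadlag g -> finite_variation g -> 0 <= T ->
  modulus_on (path_range Z 0 T) psi ->
  local_integral (psi \o Z) g (varfun g) J ->
  (forall r, 0 < r -> phi r = psi (leftlim Z r)) ->
  is_stieltjes_integral phi g T (J T - J 0).
Proof.
move=> cZ cg fg T0 mpsi JP phiE.
have [mu muE] := varfun_cumulative fg cg.
have step n : exists s : seq (blin H W * R * R),
  [/\ all (fun x => (0 <= x.1.2 <= x.2) && (x.2 <= T)) s,
      forall r, 0 < r <= T -> `|phi r - step_fun s r| <= n.+1%:R^-1 &
      `|J T - J 0 - step_integral g s| <= n.+1%:R^-1 * (varfun g T - varfun g 0)].
  have n0 : 0 < n.+1%:R^-1 :> R by rewrite invr_gt0.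
  have [s [s1 s2 s3 _]] := step_approximation cZ T0 n0 mpsi JP.
  exists s; split=> //.
    by apply: sub_all s1 => x /and3P[-> -> ->].
  by move=> r rT; rewrite phiE ?s2//; case/andP: rT.
have /choice[s Hs] := step.
(* Measurability of this real function is obtained from its being a pointwise limit of norms of
   differences of step functions. *)
have mphi n : measurable_fun `]0, T] (fun r => `|phi r - step_fun (s n) r|).
  apply: (@measurable_fun_cvg _ _ _ _ (fun k r => `|step_fun (s k) r - step_fun (s n) r|)).
    by move=> k; apply: measurable_funS (measurable_norm_stepB _ _).
  move=> r /=; rewrite in_itv /= => rT; apply: cvg_norm; apply: cvgB; last exact: cvg_cst.
  apply/cvgrPdist_le => e e0.
  have := invSn_cvg 1; move=> /cvgrPdist_le/(_ e e0); apply: filterS => k.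
  rewrite mulr1 sub0r normrN ger0_norm ?invr_ge0//; apply: le_trans.
  by have [_ + _] := Hs k; apply.
exists mu, s; split.
- exact: muE.
- by move=> n; case: (Hs n).
- exact: mphi.
- apply: (@squeeze_cvge _ _ _ _ (cst 0%E) _
    (fun n => (n.+1%:R^-1 * (mu T - mu 0))%:E)); last 2 first.
  + exact: cvg_cst.
  + by apply/cvg_EFin; [near=> n|exact: invSn_cvg].
  near=> n; apply/andP; split; first by apply: integral_ge0 => r _; rewrite lee_fin.
  rewrite EFinM -stieltjes_measure_itv// -integral_cst//.
  apply: ge0_le_integral => //.
  + by apply/measurable_EFinP; exact: mphi.
  + move=> r /=; rewrite in_itv /= lee_fin => rT.
    by have [_ + _] := Hs n; apply.
- apply/cvgrPdist_le => e e0.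
  have /cvgrPdist_le/(_ e e0) := invSn_cvg (varfun g T - varfun g 0).
  apply: filterS => n; rewrite sub0r normrN; apply: le_trans.
  by have [_ _ h] := Hs n; rewrite (le_trans h)// ler_norm.
Unshelve. all: by end_near. Qed.

End StieltjesIntegral.

(** * Moduli of continuity along a path *)

Section JointModulus.
Variables (R : realType) (U : normedModType R) (K : set U).

Definition joint_modulus (V : normedModType R) (r : U -> U -> V) : Prop :=
  forall e : R, 0 < e -> exists2 d : R, 0 < d & forall z z' w w',
    K z -> K z' -> K w -> K w' -> `|z - z'| <= d -> `|w - w'| <= d ->
    `|r z w - r z' w'| <= e.

Lemma joint_modulusB (V : normedModType R) (r s : U -> U -> V) :
  joint_modulus r -> joint_modulus s -> joint_modulus (fun z w => r z w - s z w).
Proof.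
move=> hr hs e e0; have e2 : 0 < e / 2 by rewrite divr_gt0.
have [d d0 Hd] := hr _ e2; have [d' d0' Hd'] := hs _ e2.
exists (Num.min d d'); first by rewrite lt_min d0.
move=> z z' w w' Kz Kz' Kw Kw'; rewrite !le_min => /andP[z1 z2] /andP[w1 w2].
have -> : r z w - s z w - (r z' w' - s z' w') =
  (r z w - r z' w') - (s z w - s z' w') by module R V.
by rewrite (le_trans (ler_normB _ _))// [leRHS]splitr lerD ?Hd ?Hd'.
Qed.

Lemma joint_modulus_l (V : normedModType R) (g : U -> V) :
  modulus_on K g -> joint_modulus (fun z _ => g z).
Proof. by move=> mg e /mg[d d0 Hd]; exists d => // z z' w w' Kz Kz' _ _ zz _; exact: Hd. Qed.

Lemma joint_modulus_r (V : normedModType R) (g : U -> V) :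
  modulus_on K g -> joint_modulus (fun _ w => g w).
Proof. by move=> mg e /mg[d d0 Hd]; exists d => // z z' w w' _ _ Kw Kw' _; exact: Hd. Qed.

Lemma joint_modulus_app (V W : normedModType R) (T : U -> blin V W)
    (q : U -> U -> V) (M B : R) :
  modulus_on K T -> joint_modulus q -> 0 < M -> 0 < B ->
  (forall z, K z -> `|T z| <= M) -> (forall z w, K z -> K w -> `|q z w| <= B) ->
  joint_modulus (fun z w => T z (q z w)).
Proof.
move=> mT mq M0 B0 TM qB e e0.
have [|d d0 Hd] := mT (e / 2 / B); first by rewrite !divr_gt0.
have [|d' d0' Hd'] := mq (e / 2 / M); first by rewrite !divr_gt0.
exists (Num.min d d'); first by rewrite lt_min d0.
move=> z z' w w' Kz Kz' Kw Kw'; rewrite !le_min => /andP[z1 z2] /andP[w1 w2].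
have -> : T z (q z w) - T z' (q z' w') = (T z - T z') (q z w) + T z' (q z w - q z' w').
  have LB x y : T z' (x - y) = T z' x - T z' y by exact: linearB.
  by rewrite blinB LB; module R W.
rewrite (le_trans (ler_normD _ _))// [leRHS]splitr lerD// (le_trans (blin_normP _ _))//.
  rewrite (le_trans (ler_pM _ _ (Hd _ _ Kz Kz' z1) (qB _ _ Kz Kw)))//.
  by rewrite divfK ?gt_eqF.
rewrite (le_trans (ler_pM _ _ (TM _ Kz') (Hd' _ _ _ _ Kz Kz' Kw Kw' z2 w2)))//.
by rewrite mulrC divfK ?gt_eqF.
Qed.

End JointModulus.

Section PairedPaths.
Variables (R : realType) (F E : normedModType R).

Lemma pair_norm_le (a : F) (x : E) (e : R) :
  `|a| <= e -> `|x| <= e -> `|(a, x)| <= e.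
Proof. by move=> ae xe; rewrite ProdNormedZmodule.prod_normE ge_max ae. Qed.

Lemma fst_norm_le (z : F * E) : `|z.1| <= `|z|.
Proof. by rewrite ProdNormedZmodule.prod_normE le_max lexx. Qed.

Lemma snd_norm_le (z : F * E) : `|z.2| <= `|z|.
Proof. by rewrite ProdNormedZmodule.prod_normE le_max lexx orbT. Qed.

Lemma cadlag_pair (A : R -> F) (X : R -> E) : cadlag A -> cadlag X ->
  cadlag (fun t => (A t, X t)) /\ forall b, 0 < b ->
  leftlim (fun t => (A t, X t)) b = (leftlim A b, leftlim X b).
Proof.
move=> cA cX; apply: (@cadlag_intro _ _ _ (fun b => (leftlim A b, leftlim X b))).
  move=> a e a0 e0; near=> x.
  have ax : a <= x by near: x; exact: nbhs_right_ge.
  have hA : forall y, a <= y <= x -> `|A y - A a| <= e.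
    by near: x; exact: cadlag_near_right.
  have hX : forall y, a <= y <= x -> `|X y - X a| <= e.
    by near: x; exact: cadlag_near_right.
  by apply: pair_norm_le; [apply: hA|apply: hX]; rewrite ax lexx.
move=> b e b0 e0; near=> x.
have xb : x < b by near: x; exact: nbhs_left_lt.
have hA : forall y, x <= y < b -> `|A y - leftlim A b| <= e.
  by near: x; exact: cadlag_near_left.
have hX : forall y, x <= y < b -> `|X y - leftlim X b| <= e.
  by near: x; exact: cadlag_near_left.
by apply: pair_norm_le; [apply: hA|apply: hX]; rewrite xb lexx.
Unshelve. all: by end_near. Qed.

End PairedPaths.

Lemma cadlagB (R : realType) (V : normedModType R) (Z W : R -> V) :
  cadlag Z -> cadlag W -> cadlag (fun t => Z t - W t) /\
  forall b, 0 < b -> leftlim (fun t => Z t - W t) b = leftlim Z b - leftlim W b.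
Proof.
move=> cZ cW; apply: (@cadlag_intro _ _ _ (fun b => leftlim Z b - leftlim W b)).
  move=> a e a0 e0; have e2 : 0 < e / 2 by rewrite divr_gt0.
  near=> x; have ax : a <= x by near: x; exact: nbhs_right_ge.
  have hZ : forall y, a <= y <= x -> `|Z y - Z a| <= e / 2.
    by near: x; exact: cadlag_near_right.
  have hW : forall y, a <= y <= x -> `|W y - W a| <= e / 2.
    by near: x; exact: cadlag_near_right.
  have -> : Z x - W x - (Z a - W a) = (Z x - Z a) - (W x - W a) by module R V.
  by rewrite (le_trans (ler_normB _ _))// [leRHS]splitr lerD ?hZ ?hW ?ax ?lexx.
move=> b e b0 e0; have e2 : 0 < e / 2 by rewrite divr_gt0.
near=> x; have xb : x < b by near: x; exact: nbhs_left_lt.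
have hZ : forall y, x <= y < b -> `|Z y - leftlim Z b| <= e / 2.
  by near: x; exact: cadlag_near_left.
have hW : forall y, x <= y < b -> `|W y - leftlim W b| <= e / 2.
  by near: x; exact: cadlag_near_left.
have -> : Z x - W x - (leftlim Z b - leftlim W b) =
  (Z x - leftlim Z b) - (W x - leftlim W b) by module R V.
by rewrite (le_trans (ler_normB _ _))// [leRHS]splitr lerD ?hZ ?hW ?xb ?lexx.
Unshelve. all: by end_near. Qed.

Lemma remainder_cadlag (R : realType) (U : normedModType R)
    (G : completeNormedModType R) (Z : R -> U) (rho : U -> U -> G) (S : R -> G) :
  cadlag Z -> (forall z, rho z z = 0) ->
  (forall T, 0 <= T -> joint_modulus (path_range Z 0 T) rho) ->
  (forall T e : R, 0 <= T -> 0 < e -> exists2 d : R, 0 < d &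
    forall a c, 0 <= a -> a < c -> c <= T ->
    (forall x, a <= x < c -> `|Z x - Z a| <= d) ->
    `|S c - S a - rho (leftlim Z c) (Z c)| <= e) ->
  cadlag S /\ forall b, 0 < b -> leftlim S b = S b - rho (leftlim Z b) (Z b).
Proof.
move=> cZ rho0 rmod Sjump.
apply: (@cadlag_intro _ _ _ (fun b => S b - rho (leftlim Z b) (Z b))).
  move=> a e a0 e0; have e2 : 0 < e / 2 by rewrite divr_gt0.
  have a1 : 0 <= a + 1 by rewrite addr_ge0.
  have [d d0 Hd] := Sjump _ _ a1 e2; have [d' d0' Hd'] := rmod _ a1 _ e2.
  near=> c.
  have ac : a < c by near: c; exact: nbhs_right_gt.
  have c1 : c <= a + 1 by near: c; apply: nbhs_right_le; rewrite ltrDl ltr01.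
  have h : forall x, a <= x <= c -> `|Z x - Z a| <= d.
    by near: c; exact: cadlag_near_right.
  have h' : forall x, a <= x <= c -> `|Z x - Z a| <= d'.
    by near: c; exact: cadlag_near_right.
  have c0 : 0 < c by exact: le_lt_trans ac.
  have h1 : `|S c - S a - rho (leftlim Z c) (Z c)| <= e / 2.
    by apply: Hd => // x /andP[ax xc]; apply: h; rewrite ax ltW.
  have h2 : `|rho (leftlim Z c) (Z c)| <= e / 2.
    rewrite -[rho _ _]subr0 -(rho0 (Z a)); apply: Hd'.
    - by apply: path_range_leftlim; rewrite c0.
    - by apply: path_range_val; rewrite a0 (le_trans (ltW ac)).
    - by apply: path_range_val; rewrite (ltW c0).
    - by apply: path_range_val; rewrite a0 (le_trans (ltW ac)).
    - apply: (@leftlim_dist_le _ _ _ a) => // x /andP[ax xc].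
      by apply: h'; rewrite ax ltW.
    - by apply: h'; rewrite lexx ltW.
  rewrite -[S c - S a](subrK (rho (leftlim Z c) (Z c))).
  by rewrite (le_trans (ler_normD _ _))// [leRHS]splitr lerD.
move=> b e b0 e0; have [d d0 Hd] := Sjump _ _ (ltW b0) e0.
have d2 : 0 < d / 2 by rewrite divr_gt0.
near=> x.
have x0 : 0 <= x by near: x; exact: nbhs_left_ge.
have xb : x < b by near: x; exact: nbhs_left_lt.
have h : forall y, x <= y < b -> `|Z y - leftlim Z b| <= d / 2.
  by near: x; exact: cadlag_near_left.
have := Hd x b x0 xb (lexx _).
have -> : S b - S x - rho (leftlim Z b) (Z b) =
  - (S x - (S b - rho (leftlim Z b) (Z b))) by module R G.
rewrite normrN; apply => y yb.
rewrite -[_ - Z x](subrKA (leftlim Z b)) (le_trans (ler_normD _ _))//.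
by rewrite [leRHS]splitr lerD// ?h// distrC h// lexx.
Unshelve. all: by end_near. Qed.

Section TaylorModulus.
Variables (R : realType) (E F G : completeNormedModType R).
Variable alpha : uniform_crossnorm R.
Variables (f : F * E -> G) (Daf : F * E -> blin F G) (Dxf : F * E -> blin E G).
Variables (D2xf_ext : F * E -> blin (ctens alpha E E) G).
Hypothesis hDaf :
  forall a x, gateaux_derivative (fun b => f (b, x)) a (Daf (a, x)).
Hypothesis hDxf :
  forall a x, gateaux_derivative (fun y => f (a, y)) x (Dxf (a, x)).
Hypotheses (cDaf : CK Daf) (cDxf : CK Dxf) (cD2xf : CK D2xf_ext).
Variable K : set (F * E).
Hypothesis cK : compact K.

(** Continuity of [f] is not among the data; bounds for both partial derivatives on the compact box
    hull make [f] Lipschitz on [K]. *)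
Lemma function_modulus : modulus_on K f.
Proof.
have [M1 M10 H1] := compact_image_bounded (compact_box_hull cK) (cDaf (compact_box_hull cK)).
have [M2 M20 H2] := compact_image_bounded (compact_box_hull cK) (cDxf (compact_box_hull cK)).
have M0 : 0 < M1 + M2 by rewrite addr_gt0.
move=> e e0; exists (e / (M1 + M2)); first by rewrite divr_gt0.
move=> z w Kz Kw; rewrite distrC => zw.
have h1 : `|f (w.1, w.2) - f (z.1, w.2)| <= M1 * `|w.1 - z.1|.
  rewrite -[X in `|X|]subr0 -[0]/((0 : blin F G) (w.1 - z.1)).
  apply: (taylor_a hDaf) => s s01; rewrite subr0; apply: H1.
  exists z, w, s, 1; split => //; rewrite ?lexx ?ler01//=.
  by rewrite scale1r [z.2 + _]addrC subrK.
have h2 : `|f (z.1, z.2 + (w.2 - z.2)) - f (z.1, z.2)| <= M2 * `|w.2 - z.2|.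
  rewrite -[X in `|X|]subr0; apply: (gateaux_mean_value (hDxf z.1)) => t t01.
  rewrite subr0 (le_trans (blin_normP _ _))// ler_wpM2r//; apply: H2.
  exists z, w, 0, t; split => //; rewrite ?lexx ?ler01//=.
  by rewrite scale0r addr0.
rewrite [z.2 + _]addrC subrK -!surjective_pairing in h1 h2.
rewrite distrC -[_ - f z](subrKA (f (z.1, w.2))) (le_trans (ler_normD _ _))//.
rewrite (le_trans (lerD h1 h2))//.
have h3 : `|w.1 - z.1| <= `|w - z| by exact: (fst_norm_le (w - z)).
have h4 : `|w.2 - z.2| <= `|w - z| by exact: (snd_norm_le (w - z)).
have h5 : (M1 + M2) * `|w - z| <= e by rewrite mulrC -ler_pdivlMr.
have h6 := ler_wpM2l (ltW M10) h3; have h7 := ler_wpM2l (ltW M20) h4.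
by move: h5; rewrite mulrDl; lra.
Qed.

Lemma increment_joint_modulus :
  joint_modulus K (fun z w => w.2 - z.2) /\ joint_modulus K (fun z w => w.1 - z.1).
Proof.
split=> e e0; exists (e / 2); rewrite ?divr_gt0// => z z' w w' _ _ _ _ zz ww.
  have -> : w.2 - z.2 - (w'.2 - z'.2) = (w.2 - w'.2) - (z.2 - z'.2) by module R E.
  rewrite (le_trans (ler_normB _ _))// [leRHS]splitr lerD//.
    by rewrite (le_trans _ ww)//; exact: (snd_norm_le (w - w')).
  by rewrite (le_trans _ zz)//; exact: (snd_norm_le (z - z')).
have -> : w.1 - z.1 - (w'.1 - z'.1) = (w.1 - w'.1) - (z.1 - z'.1) by module R F.
rewrite (le_trans (ler_normB _ _))// [leRHS]splitr lerD//.
  by rewrite (le_trans _ ww)//; exact: (fst_norm_le (w - w')).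
by rewrite (le_trans _ zz)//; exact: (fst_norm_le (z - z')).
Qed.

Lemma compact_norm_bound : exists2 B : R, 0 < B & forall z, K z -> `|z| <= B.
Proof.
apply: (@compact_image_bounded _ _ _ _ id) => //.
by apply: continuous_subspaceT => x; exact: cvg_id.
Qed.

Lemma increment_bound : exists2 B : R, 0 < B & forall z w, K z -> K w ->
  `|w.2 - z.2| <= B /\ `|w.1 - z.1| <= B.
Proof.
have [B B0 HB] := compact_norm_bound; exists (B + B); first by rewrite addr_gt0.
move=> z w Kz Kw; have Bz := HB _ Kz; have Bw := HB _ Kw.
split; rewrite (le_trans (ler_normB _ _))// lerD//.
- exact: le_trans (snd_norm_le w) Bw.
- exact: le_trans (snd_norm_le z) Bz.
- exact: le_trans (fst_norm_le w) Bw.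
- exact: le_trans (fst_norm_le z) Bz.
Qed.

Lemma tensor_increment_joint_modulus :
  joint_modulus K (fun z w => tens alpha (w.2 - z.2) (w.2 - z.2)).
Proof.
have [B B0 HB] := increment_bound => e e0.
have BB : 0 < B + B by rewrite addr_gt0.
have [d d0 Hd] := increment_joint_modulus.1 _ (divr_gt0 e0 BB).
exists d => // z z' w w' Kz Kz' Kw Kw' zz ww.
rewrite (le_trans (tens_square_dist _ _ _))//.
have h := Hd _ _ _ _ Kz Kz' Kw Kw' zz ww.
rewrite (le_trans (ler_pM _ _ (lerD (HB _ _ Kz Kw).1 (HB _ _ Kz' Kw').1) h))//.
by rewrite mulrC divfK// gt_eqF.
Qed.

Lemma scaled_modulus (k : R) (V : normedModType R) (g : F * E -> V) :
  modulus_on K g -> modulus_on K (fun z => k *: g z).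
Proof.
move=> mg e e0; have k0 : 0 < `|k| + 1 by rewrite ltr_wpDl.
have [d d0 Hd] := mg _ (divr_gt0 e0 k0); exists d => // z w Kz Kw zw.
rewrite -scalerBr normrZ (le_trans (ler_wpM2l _ (Hd _ _ Kz Kw zw)))//.
by rewrite mulrCA ger_pMr// ler_pdivrMr// mul1r lerDl.
Qed.

Lemma CK_modulus (V : normedModType R) (g : F * E -> V) : CK g -> modulus_on K g.
Proof. by move=> cg e; exact: compact_modulus (cg _ cK). Qed.

Lemma taylor_rem_joint_modulus : joint_modulus K (taylor_rem f Daf Dxf D2xf_ext).
Proof.
have [B B0 HB] := increment_bound.
have [M1 M10 H1] := compact_image_bounded cK (cDaf cK).
have [M2 M20 H2] := compact_image_bounded cK (cDxf cK).
have [M3 M30 H3] := compact_image_bounded cK (cD2xf cK).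
have BB : 0 < B * B by rewrite mulr_gt0.
apply: joint_modulusB; last first.
  apply: (joint_modulus_app (CK_modulus cDaf) increment_joint_modulus.2 M10 B0) => //.
  by move=> z w Kz Kw; case: (HB z w Kz Kw).
apply: joint_modulusB; last first.
  apply: (@joint_modulus_app _ _ _ _ _ (fun z => (2^-1 : R) *: D2xf_ext z) _ M3 (B * B)) => //.
  - exact/scaled_modulus/CK_modulus.
  - exact: tensor_increment_joint_modulus.
  - move=> z Kz; rewrite normrZ ger0_norm ?invr_ge0// (le_trans _ (H3 _ Kz))//.
    by rewrite ler_piMl// invf_le1// ler1n.
  - move=> z w Kz Kw; rewrite (le_trans (norm_tens _ _ _))//.
    by have [h _] := HB z w Kz Kw; exact: ler_pM.
apply: joint_modulusB; last first.
  apply: (joint_modulus_app (CK_modulus cDxf) increment_joint_modulus.1 M20 B0) => //.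
  by move=> z w Kz Kw; case: (HB z w Kz Kw).
apply: joint_modulusB.
  exact: joint_modulus_r function_modulus.
exact: joint_modulus_l function_modulus.
Qed.

Lemma square_modulus :
  modulus_on K (fun z => tens_op alpha (Dxf z) (Dxf z)).
Proof.
have [M2 M20 H2] := compact_image_bounded cK (cDxf cK) => e e0.
have MM : 0 < M2 + M2 by rewrite addr_gt0.
have [d d0 Hd] := CK_modulus cDxf (divr_gt0 e0 MM); exists d => // z w Kz Kw zw.
rewrite (le_trans (tens_op_dist _ _ _ _ _))//.
have h := Hd _ _ Kz Kw zw; have hz := H2 _ Kz; have hw := H2 _ Kw.
have h1 := ler_pM (normr_ge0 _) (normr_ge0 _) h hz.
have h2 := ler_pM (normr_ge0 _) (normr_ge0 _) hw h.
have : e / (M2 + M2) * (M2 + M2) = e by rewrite divfK// gt_eqF.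
by rewrite mulrDr; lra.
Qed.

End TaylorModulus.

(** * The Ito-Follmer integral *)

Section ItoFollmer.
Variables (R : realType) (E F G : completeNormedModType R).
Variables (alpha : uniform_crossnorm R) (pi : nat -> time_partition R).
Variables (m : cvg_mode) (X : R -> E) (QX : R -> ctens alpha E E) (A : R -> F).
Hypothesis hX : has_tensor_qv m pi X QX.
Hypothesis hX2 : finite_2variation X pi.
Hypotheses (hA : cadlag A) (hAfv : finite_variation A).
Hypothesis hC : conditionC (fun t => (A t, X t)) pi.
Variables (f : F * E -> G) (Daf : F * E -> blin F G) (Dxf : F * E -> blin E G).
Variables (D2xf : F * E -> blin E (blin E G)).
Variables (D2xf_ext : F * E -> blin (ctens alpha E E) G).
Hypothesis hDaf :
  forall a x, gateaux_derivative (fun b => f (b, x)) a (Daf (a, x)).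
Hypothesis hDxf :
  forall a x, gateaux_derivative (fun y => f (a, y)) x (Dxf (a, x)).
Hypothesis hD2xf :
  forall a x, gateaux_derivative (fun y => Dxf (a, y)) x (D2xf (a, x)).
Hypothesis hext : forall z u v, D2xf_ext z (tens alpha u v) = D2xf z u v.
Hypotheses (cDaf : CK Daf) (cDxf : CK Dxf) (cD2xf : CK D2xf_ext).

Let Z (t : R) : F * E := (A t, X t).
Let K (T : R) : set (F * E) := path_range Z 0 T.
Let qx (z w : F * E) : ctens alpha E E := tens alpha (w.2 - z.2) (w.2 - z.2).
Let qa (z w : F * E) : F := w.1 - z.1.
Let half_D2 (z : F * E) : blin (ctens alpha E E) G := (2^-1 : R) *: D2xf_ext z.
Let square (z : F * E) := tens_op alpha (Dxf z) (Dxf z).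
Let rho := taylor_rem f Daf Dxf D2xf_ext.
Let ito_germ (z w : F * E) : G := Dxf z (w.2 - z.2).

Let cX : cadlag X. Proof. exact: qv_cadlag_path hX. Qed.
Let cQ : cadlag QX. Proof. exact: qv_cadlag hX. Qed.
Let fvQ : finite_variation QX. Proof. exact: qv_finite_variation hX. Qed.
Let cZ : cadlag Z. Proof. exact: (cadlag_pair hA cX).1. Qed.

Let leftlimZ (b : R) : 0 < b -> leftlim Z b = (leftlim A b, leftlim X b).
Proof. exact: (cadlag_pair hA cX).2. Qed.

Let cK (T : R) : 0 <= T -> compact (K T).
Proof. exact: compact_path_range. Qed.

Let tags (T eta : R) : 0 <= T -> 0 < eta ->
  \forall n \near \oo, exists tau, tagged Z (pi n) T eta tau.
Proof. by case: hC => C1 _ C3; exact: tagged_eventually. Qed.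

(** The squares are bounded by the 2-variation of [X], the increments of [A] by those of its
    variation function, which telescope. *)
Let energy_bound_ex : exists C : R -> R, forall T n, 0 <= T ->
  \sum_(i < ncells (pi n) T) cellval Z (@energy R E F) (pi n) T i <= C T.
Proof.
suff /choice[C HC] : forall T : R, exists c : R, forall n, 0 <= T ->
    \sum_(i < ncells (pi n) T) cellval Z (@energy R E F) (pi n) T i <= c.
  by exists C.
move=> T; have [T0|T0] := ltP T 0; first by exists 0.
have [C HC] := hX2 T0.
exists (C + (varfun A T - varfun A 0)) => n _; rewrite big_split /= lerD//.
  rewrite -lee_fin (le_trans _ (HC n))// -sumEFin.
  have := nneseries_lim_ge (u_ := fun i => (`|incr X T (pi n i) (pi n i.+1)| ^+ 2)%:E)
    (P := xpredT) (m := 0%N) (ncells (pi n) T).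
  by rewrite big_mkord; apply => i _ _; rewrite lee_fin exprn_ge0.
have le N : \sum_(i < N) `|A (Num.min (pi n i.+1) T) - A (Num.min (pi n i) T)| <=
    varfun A (Num.min (pi n N) T) - varfun A (Num.min (pi n 0) T).
  elim: N => [|N IH]; first by rewrite big_ord0 subrr.
  rewrite big_ord_recr /= -[leRHS](subrKA (varfun A (Num.min (pi n N) T))) addrC lerD//.
  apply: varfun_dominates => //; first by rewrite le_min pt_ge0.
  by rewrite le_min ge_min (ltW (pt_increasing _ _)) ge_min lexx orbT.
apply: le_trans (le _) _; rewrite pt0 (min_l T0) min_r//.
exact: ncells_ge.
Qed.

Let C := sval (cid energy_bound_ex).

Let CP T n : 0 <= T ->
  \sum_(i < ncells (pi n) T) cellval Z (@energy R E F) (pi n) T i <= C T.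
Proof. exact: (svalP (cid energy_bound_ex)). Qed.

Let rho0 z : rho z z = 0.
Proof. by rewrite /rho /taylor_rem !subrr tens0l !linear0 !addr0. Qed.

Let qx0 z : qx z z = 0. Proof. by rewrite /qx subrr tens0l. Qed.
Let qa0 z : qa z z = 0. Proof. by rewrite /qa subrr. Qed.
Let ito0 z : ito_germ z z = 0. Proof. by rewrite /ito_germ subrr linear0. Qed.
Let rho_joint T : 0 <= T -> joint_modulus (K T) rho.
Proof. by move=> T0; exact: taylor_rem_joint_modulus (cK T0). Qed.

Let rho_mod (T e : R) (T0 : 0 <= T) (e0 : 0 < e) := rho_joint T0 e0.

Let germ_of_joint (V : normedModType R) (T : R) (q : F * E -> F * E -> V) :
  (forall z, q z z = 0) -> joint_modulus (K T) q -> germ_on (K T) q.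
Proof.
move=> q0 mq; split=> // e /mq[d d0 Hd]; exists d => // z w w' Kz Kw Kw' ww.
by apply: Hd => //; rewrite subrr normr0 ltW.
Qed.

Let qx_germ T : 0 <= T -> germ_on (K T) qx.
Proof. by move=> /cK KT; apply: germ_of_joint => //; exact: tensor_increment_joint_modulus. Qed.

Let qa_germ T : 0 <= T -> germ_on (K T) qa.
Proof. by move=> /cK KT; apply: germ_of_joint => //; exact: (increment_joint_modulus _).2. Qed.

Let modD T : 0 <= T -> modulus_on (K T) Daf.
Proof. by move=> /cK KT; exact: CK_modulus. Qed.

Let modx T : 0 <= T -> modulus_on (K T) Dxf.
Proof. by move=> /cK KT; exact: CK_modulus. Qed.

Let modh T : 0 <= T -> modulus_on (K T) half_D2.
Proof. by move=> /cK KT; exact/scaled_modulus/CK_modulus. Qed.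

Let mods T : 0 <= T -> modulus_on (K T) square.
Proof. by move=> /cK KT; exact: square_modulus. Qed.

Let modf T : 0 <= T -> modulus_on (K T) f.
Proof. by move=> /cK KT; exact: (function_modulus hDaf hDxf cDaf cDxf KT). Qed.

Let primitive (V : normedModType R) (W : completeNormedModType R)
    (psi : F * E -> blin V W) (g : R -> V) :
  (forall T, 0 <= T -> modulus_on (K T) psi) -> finite_variation g ->
  exists J, J 0 = 0 /\ local_integral (psi \o Z) g (varfun g) J.
Proof.
move=> mpsi fg; apply: local_integral_ex; last exact: varfun_dominates.
by apply: cadlag_regulated; exact: (cadlag_comp cZ mpsi).1.
Qed.

(** With left limits in the integrands, [J1] is half the integral of the second derivative against
    [QX], [J2] the integral of [Daf] against [A], and [J3] the asserted quadratic variation of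
    [Y]. *)
Let J1 := sval (cid (primitive modh fvQ)).
Let J2 := sval (cid (primitive modD hAfv)).
Let J3 := sval (cid (primitive mods fvQ)).
Let J1P : J1 0 = 0 /\ local_integral (half_D2 \o Z) QX (varfun QX) J1.
Proof. exact: (svalP (cid (primitive modh fvQ))). Qed.
Let J2P : J2 0 = 0 /\ local_integral (Daf \o Z) A (varfun A) J2.
Proof. exact: (svalP (cid (primitive modD hAfv))). Qed.
Let J3P : J3 0 = 0 /\ local_integral (square \o Z) QX (varfun QX) J3.
Proof. exact: (svalP (cid (primitive mods fvQ))). Qed.

Let S := remainder Z pi rho.
(** Ito's formula solved for the integral. This exhibits the limit in [G], which a Cauchy argument
    need not provide in the weak topology, and gives access to its regularity term by term. *)
Let Y (t : R) : G := f (Z t) - f (Z 0) - J1 t - J2 t - S t.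

Let rho_small (T e : R) : 0 <= T -> 0 < e -> exists2 d : R, 0 < d &
  forall z w, K T z -> K T w -> `|z - w| <= d -> `|rho z w| <= e * energy z w.
Proof.
by move=> T0 e0; exact: (taylor_rem_small hDaf hDxf hD2xf hext cDaf cD2xf (cK T0)).
Qed.

Let rho_bound (T : R) : 0 <= T -> exists2 M : R, 0 <= M &
  forall z w, K T z -> K T w -> `|rho z w| <= M * energy z w.
Proof.
by move=> T0; exact: (taylor_rem_bounded hDaf hDxf hD2xf hext cDaf cD2xf (cK T0)).
Qed.

Let S_cvg (t : R) : 0 <= t -> (fun n => germ_sum Z rho (pi n) t) @ \oo --> S t.
Proof.
by move=> t0; exact: (remainder_cvg cZ tags (@energy_ge0 R E F) rho0 rho_mod
  rho_small CP t0).
Qed.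

Let S_cadlag : cadlag S /\
  forall b, 0 < b -> leftlim S b = S b - rho (leftlim Z b) (Z b).
Proof.
apply: remainder_cadlag => // T e T0 e0.
exact: (remainder_jump cZ tags (@energy_ge0 R E F) rho0 rho_mod rho_small CP T0 e0).
Qed.

Let S_variation (T : R) : 0 <= T -> exists M : R, forall (x : nat -> R) N,
  {homo x : i j / (i <= j)%N >-> i <= j} -> 0 <= x 0%N -> x N <= T ->
  \sum_(i < N) `|S (x i.+1) - S (x i)| <= M.
Proof.
move=> T0.
exact: (remainder_variation cZ tags (@energy_ge0 R E F) rho0 rho_mod rho_small
  rho_bound CP T0).
Qed.

(** The integrand is evaluated at [p i] in one sum and at [p i] stopped at [t] in the other; they
    differ only for cells starting after [t], where the increment vanishes. *)
Lemma ito_sumE (p : time_partition R) (t : R) : 0 <= t ->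
  sum_cells (fun i => Dxf (A (p i), X (p i)) (incr X t (p i) (p i.+1))) =
  germ_sum Z ito_germ p t.
Proof.
move=> t0; rewrite /germ_sum; congr sum_cells; apply/funext => i.
rewrite /cellval /ito_germ /incr /=.
have [pt|tp] := leP (p i) t; first by [].
by rewrite min_r ?subrr ?linear0//; exact: le_trans (ltW tp) (ltW (pt_increasing p i)).
Qed.

Let germ_identity (p : time_partition R) (t : R) : 0 <= t -> germ_sum Z ito_germ p t =
  f (Z t) - f (Z 0) - germ_sum Z (fun z w => half_D2 z (qx z w)) p t
  - germ_sum Z (fun z w => Daf z (qa z w)) p t - germ_sum Z rho p t.
Proof.
move=> t0; rewrite !(@germ_sumE _ _ _ _ _ _ p t t)//; last 2 first.
- by move=> z; rewrite qa0 linear0.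
- by move=> z; rewrite qx0 linear0.
have tele N : \sum_(i < N) (f (Z (Num.min (p i.+1) t)) - f (Z (Num.min (p i) t))) =
    f (Z (Num.min (p N) t)) - f (Z (Num.min (p 0%N) t)).
  elim: N => [|N IH]; first by rewrite big_ord0 subrr.
  by rewrite big_ord_recr /= IH; module R G.
have -> : f (Z t) - f (Z 0) = \sum_(i < ncells p t)
    (f (Z (Num.min (p i.+1) t)) - f (Z (Num.min (p i) t))).
  by rewrite tele pt0 (min_l t0) min_r// ncells_ge.
rewrite -!sumrB; apply: eq_bigr => i _.
rewrite /cellval /ito_germ /rho /taylor_rem /half_D2 blinZ /qx /qa.
by module R G.
Qed.

Let qx_cvg (x y : R) : 0 <= x -> x <= y ->
  mode_cvg m (fun n => germ_sum Z qx (pi n) y - germ_sum Z qx (pi n) x) (QX y - QX x).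
Proof.
move=> x0 xy; apply: mode_cvgB; first exact: (qv_cvg hX (le_trans x0 xy)).
exact: (qv_cvg hX x0).
Qed.

Let qa_sum (p : time_partition R) (t : R) : 0 <= t -> germ_sum Z qa p t = A t - A 0.
Proof.
move=> t0; rewrite (@germ_sumE _ _ _ _ _ qa0 p t t)//.
have tele N : \sum_(i < N) cellval Z qa p t i =
    A (Num.min (p N) t) - A (Num.min (p 0%N) t).
  elim: N => [|N IH]; first by rewrite big_ord0 subrr.
  by rewrite big_ord_recr /= IH /cellval /qa /=; module R F.
by rewrite tele pt0 (min_l t0) min_r// ncells_ge.
Qed.

Let qx_bound (T : R) n : 0 <= T ->
  \sum_(i < ncells (pi n) T) `|cellval Z qx (pi n) T i| <= C T.
Proof.
move=> T0; apply: le_trans (CP n T0); apply: ler_sum => i _.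
by rewrite /cellval /qx /energy (le_trans (norm_tens _ _ _))// -expr2 lerDl.
Qed.

Let qa_bound (T : R) n : 0 <= T ->
  \sum_(i < ncells (pi n) T) `|cellval Z qa (pi n) T i| <= C T.
Proof.
move=> T0; apply: le_trans (CP n T0); apply: ler_sum => i _.
by rewrite /cellval /qa /energy lerDr exprn_ge0.
Qed.

(** Only the second-order sums inherit the mode of [QX]; the sums against [A] and the remainders
    converge in norm. *)
Lemma ito_integral_cvg (t : R) : 0 <= t ->
  mode_cvg m (fun n => germ_sum Z ito_germ (pi n) t) (Y t).
Proof.
move=> t0; rewrite (_ : (fun _ => _) = fun n =>
  f (Z t) - f (Z 0) - germ_sum Z (fun z w => half_D2 z (qx z w)) (pi n) t
  - germ_sum Z (fun z w => Daf z (qa z w)) (pi n) t - germ_sum Z rho (pi n) t); last first.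
  by apply/funext => n; exact: germ_identity.
apply: mode_cvgB; last exact/mode_cvg_strong/S_cvg.
have tgs eta : 0 < eta -> \forall n \near \oo, exists tau, tagged Z (pi n) t eta tau.
  exact: tags.
apply: mode_cvgB; last first.
  rewrite -[J2 t]subr0 -J2P.1.
  apply: (germ_integral_cvg cZ t0 tgs (qa_germ t0) (modD t0) J2P.2) => [x y x0 xy yt|n].
    apply: mode_cvg_strong; rewrite (_ : (fun _ => _) = cst (A y - A x)).
      exact: cvg_cst.
    by apply/funext => n; rewrite !qa_sum ?(le_trans x0)//=; module R F.
  exact: qa_bound.
apply: mode_cvgB; first by apply: mode_cvg_strong; exact: cvg_cst.
rewrite -[J1 t]subr0 -J1P.1.
apply: (germ_integral_cvg cZ t0 tgs (qx_germ t0) (modh t0) J1P.2) => [x y x0 xy yt|n].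
  exact: qx_cvg.
exact: qx_bound.
Qed.

Lemma square_integral_cvg (t : R) : 0 <= t ->
  mode_cvg m (fun n => germ_sum Z (fun z w => square z (qx z w)) (pi n) t) (J3 t).
Proof.
move=> t0; rewrite -[J3 t]subr0 -J3P.1.
apply: (germ_integral_cvg cZ t0 (fun eta => @tags t eta t0) (qx_germ t0) (mods t0) J3P.2)
  => [x y x0 xy yt|n].
  exact: qx_cvg.
exact: qx_bound.
Qed.

Let QX_jump (b : R) : 0 < b -> QX b - leftlim QX b =
  tens alpha (X b - leftlim X b) (X b - leftlim X b).
Proof. by move=> b0; have := qv_jump hX (ltW b0); rewrite /jump b0. Qed.

(** The jump of [S] is the Taylor remainder of the jump of [Z], which cancels the jumps of the other
    terms except [Dxf] applied to the jump of [X]; that [QX] jumps by the tensor square is used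
    here. *)
Lemma ito_integral_cadlag : cadlag Y /\ forall b, 0 < b ->
  leftlim Y b = Y b - Dxf (leftlim Z b) (X b - leftlim X b).
Proof.
have [cf lf] := cadlag_comp cZ modf.
have [cph lph] := cadlag_comp cZ modh.
have [cpd lpd] := cadlag_comp cZ modD.
have [c1 l1] := local_integral_cadlag cph cQ (varfun_dominates fvQ) J1P.2.
have [c2 l2] := local_integral_cadlag cpd hA (varfun_dominates hAfv) J2P.2.
have cc : cadlag (fun _ : R => f (Z 0)).
  by split=> [a _|b _]; [exact: cvg_cst|exact: is_cvg_cst].
have lc b : 0 < b -> leftlim (fun _ : R => f (Z 0)) b = f (Z 0).
  by move=> b0; apply: leftlim_unique => e e0; near=> x; rewrite subrr normr0 ltW.
have [d1 e1] := cadlagB cf cc.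
have [d2 e2] := cadlagB d1 c1.
have [d3 e3] := cadlagB d2 c2.
have [d4 e4] := cadlagB d3 S_cadlag.1.
split=> // b b0; rewrite e4// e3// e2// e1// lf// lc// l1// l2// S_cadlag.2//.
rewrite lph// lpd// QX_jump// leftlimZ//.
rewrite /Y /rho /taylor_rem /half_D2 blinZ /=.
by module R G.
Unshelve. all: by end_near. Qed.

(** The sums stopped at [a] and at [b] coincide for every partition, so uniqueness of limits, norm
    or weak, identifies [Y a] and [Y b]. *)
Lemma ito_integral_const (a b : R) : 0 <= a -> a <= b ->
  (forall u, a <= u <= b -> Z u = Z a) -> Y a = Y b.
Proof.
move=> a0 ab Zc; apply: (mode_cvg_unique (ito_integral_cvg a0)).
have := ito_integral_cvg (le_trans a0 ab).
congr (mode_cvg m _ _); apply/funext => n; rewrite /germ_sum; congr sum_cells.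
apply/funext => i; rewrite /cellval.
have ZE r : Z (Num.min r b) = Z (Num.min r a).
  have [ra|ar] := leP r a; first by rewrite min_l// (le_trans ra).
  by rewrite Zc// le_min (ltW ar) ab /= ge_min lexx orbT.
by rewrite !ZE.
Qed.

Let Y_modulus (T e : R) : 0 <= T -> 0 < e -> exists2 d : R, 0 < d &
  forall u v, 0 <= u -> u <= v -> v <= T -> osc_le Z u v d -> `|Y u - Y v| <= e.
Proof.
move=> T0 e0; have [cY lY] := ito_integral_cadlag.
apply: dominated_modulus => //; first exact: ito_integral_const.
move=> b b0 Zb; rewrite lY//.
have -> : leftlim X b = X b by move: Zb; rewrite leftlimZ// => -[].
by rewrite subrr linear0 subr0.
Qed.

Definition ito_err (p : time_partition R) (T : R) (i : nat) : G :=
  incr Y T (p i) (p i.+1) - cellval Z ito_germ p T i.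

(** Before and after the tag both [Y] and [Z] hardly move. At the tag the jump of [Y] leaves the
    difference of [Dxf] at the left limit and at the start of the cell, applied to the jump of [X].
    The movements of [Y] and [X] on the two sides and this term account for five times [e / 5]. *)
Lemma ito_err_small (T e : R) : 0 <= T -> 0 < e -> exists2 eta : R, 0 < eta &
  forall p tau, tagged Z p T eta tau ->
  forall i, (i < ncells p T)%N -> `|ito_err p T i| <= e.
Proof.
move=> T0 e0; have [M M0 HM] := compact_image_bounded (cK T0) (cDxf (cK T0)).
have [B B0 HB] := compact_norm_bound (cK T0).
have e1 : 0 < e / 5 by rewrite divr_gt0.
have BB : 0 < B + B by rewrite addr_gt0.
have [d d0 Hd] := Y_modulus T0 e1.
have [d' d0' Hd'] := modx T0 (divr_gt0 e1 BB).
exists (Num.min d (Num.min d' (e / 5 / M))).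
  by rewrite !lt_min d0 d0' divr_gt0.
set eta := Num.min _ _ => p tau tg i iN.
have [etad etad' etaM] : [/\ eta <= d, eta <= d' & eta * M <= e / 5].
  by rewrite -ler_pdivlMr// /eta !ge_min !lexx ?orbT.
have iT := ncells_lt iN; have [/andP[rt ts] h1 h2] := tg i iT.
have r0 := pt_ge0 p i.
rewrite /ito_err /incr /cellval /ito_germ (min_l (ltW iT)).
set r := p i in iT rt r0 h1 h2 *; set s := Num.min (p i.+1) T in ts h2 *.
set t := tau i in rt ts h1 h2 *.
have t0 : 0 < t by exact: le_lt_trans rt.
have sT : s <= T by rewrite ge_min lexx orbT.
have tT := le_trans ts sT.
have [cY lY] := ito_integral_cadlag.
have hY1 : `|leftlim Y t - Y r| <= e / 5.
  apply: (leftlim_dist_le cY t0 rt) => x /andP[rx xt].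
  rewrite distrC; apply: Hd => //; first exact: le_trans (ltW xt) tT.
  move=> u v /andP[ru ux] /andP[rv vx]; rewrite (le_trans _ etad)// h1//.
    by rewrite ru (le_lt_trans ux).
  by rewrite rv (le_lt_trans vx).
have hY2 : `|Y t - Y s| <= e / 5.
  apply: Hd => //; first exact: ltW.
  by move=> u v tu tv; rewrite (le_trans _ etad)// h2.
have hZ1 : `|leftlim Z t - Z r| <= eta.
  by apply: (leftlim_dist_le cZ t0 rt) => x rx; apply: h1 => //; rewrite lexx.
have hZ2 : `|Z t - Z s| <= eta by apply: h2; rewrite ?lexx ?ts.
have Kl : K T (leftlim Z t) by apply: path_range_leftlim; rewrite t0.
have Kt : K T (Z t) by apply: path_range_val; rewrite ltW.
have Kr : K T (Z r) by apply: path_range_val; rewrite r0 ltW.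
have lX : (leftlim Z t).2 = leftlim X t by rewrite leftlimZ.
have dX1 : `|leftlim X t - X r| <= eta.
  by rewrite -lX (le_trans _ hZ1)//; exact: (snd_norm_le (leftlim Z t - Z r)).
have dX2 : `|X t - X s| <= eta.
  by rewrite (le_trans _ hZ2)//; exact: (snd_norm_le (Z t - Z s)).
have jX : `|X t - leftlim X t| <= B + B.
  rewrite -lX (le_trans (ler_normB _ _))// lerD//.
    exact: le_trans (snd_norm_le (Z t)) (HB _ Kt).
  exact: le_trans (snd_norm_le _) (HB _ Kl).
have LB u v : Dxf (Z r) (u - v) = Dxf (Z r) u - Dxf (Z r) v by exact: linearB.
have -> : Y s - Y r - Dxf (Z r) (X s - X r) =
    ((leftlim Y t - Y r) - (Y t - Y s)) +
    ((Dxf (leftlim Z t) - Dxf (Z r)) (X t - leftlim X t) +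
     Dxf (Z r) ((X t - X s) - (leftlim X t - X r))).
  by rewrite blinB (lY t t0) !LB; module R G.
have h3 : `|(Dxf (leftlim Z t) - Dxf (Z r)) (X t - leftlim X t)| <= e / 5.
  rewrite (le_trans (blin_normP _ _))//.
  have h := Hd' _ _ Kl Kr (le_trans hZ1 etad').
  rewrite (le_trans (ler_pM (normr_ge0 _) (normr_ge0 _) h jX))//.
  by rewrite divfK// gt_eqF.
have h4 : `|Dxf (Z r) ((X t - X s) - (leftlim X t - X r))| <= e / 5 + e / 5.
  rewrite (le_trans (blin_normP _ _))//.
  have h := le_trans (ler_normB _ _) (lerD dX2 dX1).
  rewrite (le_trans (ler_pM (normr_ge0 _) (normr_ge0 _) (HM _ Kr) h))//.
  by rewrite mulrDr lerD// mulrC.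
rewrite (le_trans (ler_normD _ _))//.
rewrite (le_trans (lerD (ler_normB _ _) (ler_normD _ _)))//.
by rewrite (le_trans (lerD (lerD hY1 hY2) (lerD h3 h4)))//; lra.
Qed.

Let telescope_cells (V : zmodType) (p : time_partition R) (T : R) (v : R -> V) :
  0 <= T -> \sum_(i < ncells p T) (v (Num.min (p i.+1) T) - v (Num.min (p i) T)) =
  v T - v 0.
Proof.
move=> T0; have tele N : \sum_(i < N) (v (Num.min (p i.+1) T) - v (Num.min (p i) T)) =
    v (Num.min (p N) T) - v (Num.min (p 0%N) T).
  elim: N => [|N IH]; first by rewrite big_ord0 subrr.
  by rewrite big_ord_recr /= IH addrC subrKA.
by rewrite tele pt0 (min_l T0) min_r// ncells_ge.
Qed.

(** By Taylor's formula the error consists of second-order, [A] and remainder terms, dominated by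
    the energy, and of increments of [J1], [J2] and [S], which have finite variation. *)
Lemma ito_err_sum (T : R) : 0 <= T -> exists2 M : R, 0 <= M &
  forall n, \sum_(i < ncells (pi n) T) `|ito_err (pi n) T i| <= M.
Proof.
move=> T0.
have [M1 M10 H1] := compact_image_bounded (cK T0) (cDaf (cK T0)).
have [M3 M30 H3] := compact_image_bounded (cK T0) (cD2xf (cK T0)).
have Hh z : K T z -> `|half_D2 z| <= M3.
  move=> Kz; rewrite /half_D2 normrZ ger0_norm ?invr_ge0// (le_trans _ (H3 _ Kz))//.
  by rewrite ler_piMl// invf_le1// ler1n.
have [Mr Mr0 Hr] := rho_bound T0.
have [MS HS] := S_variation T0.
have psi1 x : 0 <= x <= T -> `|(half_D2 \o Z) x| <= M3.
  by move=> xT; apply: Hh; exact: path_range_val.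
have psi2 x : 0 <= x <= T -> `|(Daf \o Z) x| <= M1.
  by move=> xT; apply: H1; exact: path_range_val.
pose M := (M3 + M1 + Mr) * C T + M3 * (varfun QX T - varfun QX 0) +
  M1 * (varfun A T - varfun A 0) + MS.
suff le n : \sum_(i < ncells (pi n) T) `|ito_err (pi n) T i| <= M.
  by exists M => //; rewrite (le_trans _ (le 0%N))// sumr_ge0.
pose x i := Num.min (pi n i) T.
have xi : {homo x : i j / (i <= j)%N >-> i <= j}.
  by move=> i j ij; rewrite /x le_min !ge_min pt_le// lexx orbT.
have x0 i : 0 <= x i by rewrite le_min pt_ge0.
have xT i : x i <= T by rewrite ge_min lexx orbT.
apply: (@le_trans _ _ (\sum_(i < ncells (pi n) T)
  ((M3 + M1 + Mr) * cellval Z (@energy R E F) (pi n) T i +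
   M3 * (varfun QX (x i.+1) - varfun QX (x i)) +
   M1 * (varfun A (x i.+1) - varfun A (x i)) + `|S (x i.+1) - S (x i)|))).
  apply: ler_sum => i _.
  have Kz j : K T (Z (x j)) by apply: path_range_val; rewrite x0 xT.
  have xi1 := xi _ _ (leqnSn i).
  have -> : ito_err (pi n) T i =
      (half_D2 (Z (x i)) (qx (Z (x i)) (Z (x i.+1))) +
       Daf (Z (x i)) (qa (Z (x i)) (Z (x i.+1))) + rho (Z (x i)) (Z (x i.+1))) -
      (J1 (x i.+1) - J1 (x i)) - (J2 (x i.+1) - J2 (x i)) - (S (x i.+1) - S (x i)).
    rewrite /ito_err /incr /cellval /Y /ito_germ /rho /taylor_rem /half_D2 blinZ.
    by rewrite /qx /qa -/(x i) -/(x i.+1); module R G.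
  have hS : `|S (x i.+1) - S (x i)| <= `|S (x i.+1) - S (x i)| by [].
  have h2 := local_integral_dist J2P.2 psi2 (x0 i) xi1 (xT i.+1).
  have h1 := local_integral_dist J1P.2 psi1 (x0 i) xi1 (xT i.+1).
  rewrite (le_trans (ler_normB _ _))// lerD//.
  rewrite (le_trans (ler_normB _ _))// lerD//.
  rewrite (le_trans (ler_normB _ _))// lerD//.
  rewrite (le_trans (ler_normD _ _))// [leRHS]mulrDl lerD ?Hr//.
  rewrite (le_trans (ler_normD _ _))// mulrDl lerD// (le_trans (blin_normP _ _))//.
    apply: ler_pM => //; first exact: Hh.
    by rewrite /qx /energy (le_trans (norm_tens _ _ _))// -expr2 lerDl.
  apply: ler_pM => //; first exact: H1.
  by rewrite /qa /energy lerDr exprn_ge0.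
rewrite !big_split /= -!mulr_sumr /M !lerD//.
- by rewrite ler_wpM2l ?CP// !addr_ge0// ltW.
- by rewrite (telescope_cells (pi n) (varfun QX) T0).
- by rewrite (telescope_cells (pi n) (varfun A) T0).
- by apply: HS.
Qed.

(* With errors at most [d ^+ 2], the cross term [x * |r|] is at most
   [d * x ^+ 2 + d * |r|], which is summable. *)
Lemma ito_square_cvg (t : R) : 0 <= t ->
  mode_cvg m (fun n => sum_cells (fun i =>
    tens alpha (incr Y t (pi n i) (pi n i.+1)) (incr Y t (pi n i) (pi n i.+1))))
  (J3 t).
Proof.
move=> t0; have [M M0 HM] := compact_image_bounded (cK t0) (cDxf (cK t0)).
have [L L0 HL] := ito_err_sum t0.
rewrite -[J3 t]addr0 (_ : (fun _ => _) = fun n =>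
  germ_sum Z (fun z w => square z (qx z w)) (pi n) t +
  (sum_cells (fun i => tens alpha (incr Y t (pi n i) (pi n i.+1))
     (incr Y t (pi n i) (pi n i.+1))) -
   germ_sum Z (fun z w => square z (qx z w)) (pi n) t)); last first.
  by apply/funext => n; rewrite addrC subrK.
apply: mode_cvgD; first exact: square_integral_cvg.
apply: mode_cvg_strong; apply/cvgrPdist_le => e e0.
have Ct : 0 <= C t.
  by apply: le_trans (CP 0%N t0); apply: sumr_ge0 => i _; exact: energy_ge0.
(* Per cell, the tensor squares differ by at most [|r| ^+ 2 + 2 * M * (x * |r|)]. Summing the bounds
   in terms of [d] gives at most [d * (L + 2 * M * (C t + L))], hence at most [e]. *)
pose k := L + 2 * M * (C t + L) + 1.
have k0 : 0 < k by rewrite ltr_wpDl// addr_ge0// !mulr_ge0// ?addr_ge0// ltW.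
pose d := Num.min 1 (e / k).
have d0 : 0 < d by rewrite lt_min ltr01 divr_gt0.
have d1 : d <= 1 by rewrite ge_min lexx.
have de : d * k <= e by rewrite -ler_pdivlMr// ge_min lexx orbT.
have dd : 0 < d ^+ 2 by rewrite exprn_gt0.
have [eta eta0 Heta] := ito_err_small t0 dd.
have := tags t0 eta0; apply: filterS => n [tau tg].
have small := Heta _ _ tg.
rewrite sub0r normrN (@germ_sumE _ _ _ _ _ _ (pi n) t t)//; last first.
  by move=> z; rewrite qx0 linear0.
rewrite (@sum_cellsE _ _ _ (ncells (pi n) t)); last first.
  move=> i Ni; have ti : t <= pi n i by exact: le_trans (ncells_ge _ _) (pt_le _ Ni).
  rewrite /incr !min_r ?subrr ?tens0l//.
  exact: le_trans ti (ltW (pt_increasing _ _)).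
rewrite -sumrB (le_trans (ler_norm_sum _ _ _))//.
apply: (@le_trans _ _ (\sum_(i < ncells (pi n) t) (d * `|ito_err (pi n) t i| +
  2 * M * (d * cellval Z (@energy R E F) (pi n) t i + d * `|ito_err (pi n) t i|)))).
  apply: ler_sum => i _.
  have -> : cellval Z (fun z w => square z (qx z w)) (pi n) t i =
      tens alpha (cellval Z ito_germ (pi n) t i) (cellval Z ito_germ (pi n) t i).
    by rewrite /cellval /square /qx tens_op_pure.
  have Yi : incr Y t (pi n i) (pi n i.+1) =
      cellval Z ito_germ (pi n) t i + ito_err (pi n) t i.
    by rewrite /ito_err addrC subrK.
  rewrite (le_trans (tens_square_dist _ _ _))// Yi.
  set c := cellval Z ito_germ _ _ _; set r := ito_err _ _ _.
  have -> : c + r - c = r by module R G.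
  have rd : `|r| <= d ^+ 2 by apply: small.
  pose x := `|X (Num.min (pi n i.+1) t) - X (Num.min (pi n i) t)|.
  have cx : `|c| <= M * x.
    rewrite /c /cellval /ito_germ (le_trans (blin_normP _ _))// ler_wpM2r// HM//.
    by apply: path_range_val; rewrite le_min pt_ge0 t0 /= ge_min lexx orbT.
  have xE : x ^+ 2 <= cellval Z (@energy R E F) (pi n) t i.
    by rewrite /cellval /energy lerDl.
  have r0 : 0 <= `|r| by [].
  have x0 : 0 <= x by exact: normr_ge0.
  have cr : `|c + r| <= M * x + `|r|.
    by rewrite (le_trans (ler_normD _ _))// lerD.
  have rr : `|r| * `|r| <= d * `|r|.
    by rewrite ler_wpM2r// (le_trans rd)// expr2 ler_piMl// ltW.
  have xr : x * `|r| <= d * x ^+ 2 + d * `|r|.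
    have [xd|dx] := leP x d.
      have := ler_wpM2r r0 xd; have : 0 <= d * x ^+ 2 by rewrite mulr_ge0 ?sqr_ge0// ltW.
      lra.
    have : x * `|r| <= d * x ^+ 2.
      rewrite mulrC expr2 mulrA ler_wpM2r// (le_trans rd)// expr2.
      by apply: ler_wpM2l; exact: ltW.
    have : 0 <= d * `|r| by rewrite mulr_ge0// ltW.
    lra.
  have h := ler_wpM2r r0 (lerD cr cx).
  apply: (le_trans h).
  have h5 : M * (x * `|r|) <= M * (d * x ^+ 2 + d * `|r|) by rewrite ler_wpM2l// ltW.
  have h6 : M * (d * x ^+ 2) <= M * (d * cellval Z (@energy R E F) (pi n) t i).
    by rewrite !ler_wpM2l// ltW.
  by lra.
rewrite big_split /= -!mulr_sumr big_split /= -!mulr_sumr.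
rewrite (le_trans _ de)// /k.
have h1 := HL n; have h2 := CP n t0.
set a := \sum_(i < _) `|_| in h1 *; set b := \sum_(i < _) _ in h2 *.
have g1 := ler_wpM2l (ltW d0) h1; have g2 := ler_wpM2l (ltW d0) h2.
have g3 := ler_wpM2l (ltW M0) (lerD g2 g1).
by lra.
Qed.

Lemma ito_follmer_quadratic_variation : exists Y0 : R -> G,
  (forall t, 0 <= t ->
     is_ito_follmer_integral m pi (fun s => Dxf (A s, X s)) X t (Y0 t)) /\
  exists QY : R -> ctens alpha G G,
    has_tensor_qv m pi Y0 QY /\
    (forall t, 0 <= t ->
       is_stieltjes_integral
         (fun s => let D := Dxf (leftlim A s, leftlim X s) in tens_op alpha D D)
         QX t (QY t)).
Proof.
have [cps lps] := cadlag_comp cZ mods.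
have [c3 l3] := local_integral_cadlag cps cQ (varfun_dominates fvQ) J3P.2.
have [cY lY] := ito_integral_cadlag.
exists Y; split.
  move=> t t0; rewrite /is_ito_follmer_integral.
  rewrite (_ : (fun _ => _) = fun n => germ_sum Z ito_germ (pi n) t).
    exact: ito_integral_cvg.
  by apply/funext => n; exact: ito_sumE.
exists J3; split.
  split => //.
  - have bound T : exists M : R, 0 <= T -> forall x, 0 <= x <= T ->
        `|(square \o Z) x| <= M.
      have [T0|T0] := ltP T 0; first by exists 0.
      have [M _ HM] := cadlag_bounded cps T0.
      by exists M => _ x xT; apply: HM; exact: path_range_val.
    have /choice[M HM] := bound.
    apply: (@dominates_finite_variation _ _ _ (varfun QX) M) => T u v u0 uv vT.
    apply: (local_integral_dist J3P.2 _ u0 uv vT); apply: HM.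
    exact: le_trans u0 (le_trans uv vT).
  - exact: ito_square_cvg.
  - move=> t t0; rewrite /jump; case: ifPn => [tp|_]; last by rewrite tens0l.
    (* The jump of [J3] is the tensor square of [Dxf] at the left limit, applied to the tensor
       square of the jump of [X]; on this pure tensor it is the tensor square of the jump of [Y]. *)
    rewrite l3// lY// lps//.
    have -> a b : a - (a - b) = b :> ctens alpha G G by module R (ctens alpha G G).
    have -> a b : a - (a - b) = b :> G by module R G.
    by rewrite QX_jump// /square tens_op_pure.
move=> t t0; rewrite -[J3 t]subr0 -J3P.1.
apply: (is_stieltjes_integralP cZ cQ fvQ t0 (mods t0) J3P.2) => r r0.
by rewrite /square leftlimZ.
Qed.

End ItoFollmer.

Theorem theorem6p1 (R : realType) (E F G : completeNormedModType R)
  (alpha : uniform_crossnorm R) (pi : nat -> time_partition R) (m : cvg_mode)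
  (X : R -> E) (QX : R -> ctens alpha E E) (A : R -> F)
  (hX : has_tensor_qv m pi X QX)
  (hX2 : finite_2variation X pi)
  (hA : cadlag A) (hAfv : finite_variation A)
  (hC : conditionC (fun t => (A t, X t)) pi)
  (hleft : approximates_from_left (fun t => (A t, X t)) pi)
  (f : F * E -> G)
  (Daf : F * E -> blin F G)
  (Dxf : F * E -> blin E G)
  (D2xf : F * E -> blin E (blin E G))
  (D2xf_ext : F * E -> blin (ctens alpha E E) G)
  (hDaf : forall a x, gateaux_derivative (fun b => f (b, x)) a (Daf (a, x)))
  (hDxf : forall a x, gateaux_derivative (fun y => f (a, y)) x (Dxf (a, x)))
  (hD2xf : forall a x,
    gateaux_derivative (fun y => Dxf (a, y)) x (D2xf (a, x)))
  (hext : forall z u v, D2xf_ext z (tens alpha u v) = D2xf z u v)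
  (cDaf : CK Daf) (cDxf : CK Dxf) (cD2xf : CK D2xf_ext) :
  exists Y : R -> G,
    (forall t, 0 <= t ->
       is_ito_follmer_integral m pi (fun s => Dxf (A s, X s)) X t (Y t)) /\
    exists QY : R -> ctens alpha G G,
      has_tensor_qv m pi Y QY /\
      (forall t, 0 <= t ->
         is_stieltjes_integral
           (fun s => let D := Dxf (leftlim A s, leftlim X s) in
                     tens_op alpha D D)
           QX t (QY t)).
Proof.
exact: (ito_follmer_quadratic_variation hX hX2 hA hAfv hC hDaf hDxf hD2xf hext
  cDaf cDxf cD2xf).
Qed.
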